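(* Let $(M,Q,h)$ be a sub-Riemannian structure with associated bundle map $g:T^*M\to TM$, and let $\nabla$ be a $g$-connection. Then the following statements are equivalent: (1) $\nabla$ is a normal $g$-connection; (2) for all $\alpha\in\mathcal X^*(M)$: $\nabla_\alpha\alpha=\frac12\{\alpha,\alpha\}$; (3) for all $\alpha,\beta\in\mathcal X^*(M)$ and all $X\in\mathcal X(M)$, $$\langle\nabla_\alpha X,\beta\rangle+\langle\nabla_\beta X,\alpha\rangle=\langle[g(\alpha),X],\beta\rangle+\langle[g(\beta),X],\alpha\rangle+X(\overline g(\alpha,\beta));$$ (4) $\Gamma^\nabla=X_H$ or, equivalently, every geodesic of $\nabla$ is a normal extremal and vice versa; (5) let $G$ be a Riemannian metric on $M$ restricting to $h$ and let $\nabla^G$ be its Levi-Civita connection; then for all $\alpha\in\mathcal X^*(M)$, $\nabla$ satisfies $$\nabla_\alpha\alpha=\nabla^G_{g(\alpha)}\tau(\alpha)+\delta^B_{g(\alpha)}\tau^\bot(\alpha).$$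
   Context: All manifolds are real, Hausdorff, second countable and $C^\infty$; $\mathcal X(M)$, $\mathcal X^*(M)$, $\mathcal F(M)$ denote smooth vector fields, one-forms and functions; $\mathcal L$ is the Lie derivative. A sub-Riemannian structure $(M,Q,h)$ consists of a smooth manifold $M$, a smooth constant-rank distribution $Q\subset TM$, assumed not integrable (not involutive), and a smooth Riemannian bundle metric $h$ on $Q$. With $i:Q\hookrightarrow TM$ the inclusion, $i^*:T^*M\to Q^*$ its adjoint, and $\sharp_h:Q^*\to Q$ the inverse of $X\mapsto h(X,\cdot)$, put $g=i\circ\sharp_h\circ i^*:T^*M\to TM$; its image is $Q$ and its kernel is the annihilator $Q^0$. Put $\overline g(\alpha,\beta)=\langle g(\alpha),\beta\rangle$ (symmetric). A Riemannian metric $G$ on $M$ restricts to $h$ if $G|_{Q\times Q}=h$. Let $Q^\bot$ be the $G$-orthogonal complement of $Q$; then $T^*M=(Q^\bot)^0\oplus Q^0$, with corresponding projections $\tau$ onto $(Q^\bot)^0$ and $\tau^\bot$ onto $Q^0$. $\nabla^G$ acts on one-forms in the usual way. A $g$-connection is a map $\nabla:\mathcal X^*(M)\times\mathcal X^*(M)\to\mathcal X^*(M)$, $(\alpha,\beta)\mapsto\nabla_\alpha\beta$, which is $\mathbb R$-bilinear, $\mathcal F(M)$-linear in $\alpha$, and satisfies $\nabla_\alpha(f\beta)=f\nabla_\alpha\beta+g(\alpha)(f)\beta$. It acts on vector fields by $\langle\nabla_\alpha X,\beta\rangle=g(\alpha)(\langle X,\beta\rangle)-\langle X,\nabla_\alpha\beta\rangle$.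 The symmetric bracket is $\{\alpha,\beta\}=\mathcal L_{g(\alpha)}\beta+\mathcal L_{g(\beta)}\alpha-d(\overline g(\alpha,\beta))$. A $g$-connection is normal if $\nabla_\alpha\beta+\nabla_\beta\alpha=\{\alpha,\beta\}$ for all one-forms $\alpha,\beta$. For $X\in\Gamma(Q)$, $\eta\in\Gamma(Q^0)$: $\delta^B_X\eta=i_Xd\eta$. Let $\pi_M:T^*M\to M$ be the projection. A curve $\alpha$ in $T^*M$ with base curve $c=\pi_M\circ\alpha$ is $g$-admissible if $g(\alpha(t))=\dot c(t)$ for all $t$. It is an auto-parallel curve of $\nabla$ if moreover $\nabla_\alpha\alpha(t)=0$ for all $t$, where $\nabla_\alpha$ is the induced covariant derivative of sections of $T^*M$ along $c$; its base curve $c$ in $M$ is then called a geodesic of $\nabla$. In local coordinates $(x^i,p_i)$ on $T^*M$, with $\nabla_{dx^i}dx^k=\Gamma^{ik}_j\,dx^j$ and $g^{ij}=\overline g(dx^i,dx^j)$, $\Gamma^\nabla$ is the vector field on $T^*M$ given by $\Gamma^\nabla=g^{ij}p_j\frac{\partial}{\partial x^i}-\Gamma^{ik}_jp_ip_k\frac{\partial}{\partial p_j}$; its integral curves are the auto-parallel curves of $\nabla$. $X_H$ is the Hamiltonian vector field (canonical symplectic structure on $T^*M$) of $H(\alpha_x)=\frac12\overline g(x)(\alpha_x,\alpha_x)$, i.e. $X_H=g^{ij}p_j\frac{\partial}{\partial x^i}-\frac12\frac{\partial g^{ij}}{\partial x^k}p_ip_j\frac{\partial}{\partial p_k}$. A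 curve $c$ in $M$ tangent to $Q$ is a normal extremal if there is a curve $\psi$ in $T^*M$ with $\pi_M\circ\psi=c$, not meeting the zero section, which is an integral curve of $X_H$.
   Formalization: In (4), ''every geodesic is a normal extremal and vice versa'' is false as an equivalent for base curves; it is replaced by ''auto-parallel curves in T*M are exactly the integral curves of X_H'', and for base curves only the consequence of Γ^∇ = X_H is stated. *)

(* Defs.v *)
From HB Require Import structures.
From mathcomp Require Import all_boot all_order all_algebra.
From mathcomp Require Import all_classical all_reals all_analysis.
Import Order.TTheory GRing.Theory Num.Theory.
Import numFieldNormedType.Exports.

Set Implicit Arguments.
Unset Strict Implicit.
Unset Printing Implicit Defensive.

Local Open Scope classical_set_scope.
Local Open Scope ring_scope.

(* C^k and C^oo real functions on an open subset U of R^n, by continuity of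
   all iterated partial derivatives; values outside U are irrelevant. *)
Fixpoint is_Ck (R : realType) (n k : nat) (U : set 'rV[R]_n)
    (f : 'rV[R]_n -> R) : Prop :=
  (forall z, U z -> {for z, continuous f}) /\
  match k with
  | 0%N => True
  | k'.+1 => forall i : 'I_n,
      (forall z, U z -> derivable f z (delta_mx 0 i)) /\
      is_Ck k' U (fun z => 'D_(delta_mx 0 i) f z)
  end.

Definition is_Coo (R : realType) (n : nat) (U : set 'rV[R]_n)
    (f : 'rV[R]_n -> R) : Prop := forall k, is_Ck k U f.

(* A chart is a homeomorphism between open sets. [coord] and [param] are total
   functions; their values off [cdom] and off its image carry no meaning. *)
Record chart (R : realType) (n : nat) (T : topologicalType) := Chart {
  cdom : set T;
  coord : T -> 'rV[R]_n;
  param : 'rV[R]_n -> T;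
  cdom_open : open cdom;
  cimg_open : open (coord @` cdom);
  coordK : forall x, cdom x -> param (coord x) = x;
  coord_continuous : forall x, cdom x -> {for x, continuous coord};
  param_continuous : forall z, (coord @` cdom) z -> {for z, continuous param}
}.

(* [chart_at x] is a chosen chart of the atlas around x. It is used to identify
   the fibres T_xM and T*_xM with R^n (see below), and is part of the data in
   the same way as the atlas; no definition depends on the choice up to this
   identification. *)
Record manifold (R : realType) (n : nat) := Manifold {
  mpt :> topologicalType;
  m_hausdorff : hausdorff_space mpt;
  m_second_countable : @second_countable mpt;
  atlas : set (chart R n mpt);
  atlas_smooth : forall a b, atlas a -> atlas b -> forall j : 'I_n,
    is_Coo (coord a @` (cdom a `&` cdom b))
           (fun z => coord b (param a z) 0 j);
  chart_at : mpt -> chart R n mpt;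
  chart_at_atlas : forall x, atlas (chart_at x);
  chart_at_dom : forall x, cdom (chart_at x) x
}.

Section TangentCotangent.
Context {R : realType} {n : nat} (M : manifold R n).

(* A tangent vector at x is the row of its components, and a covector at x the
   column of its components, in the chart [chart_at x]. *)
Definition pairing (xi : 'cV[R]_n) (v : 'rV[R]_n) : R := (v *m xi) 0 0.

(* the partial derivative of f at x along the i-th coordinate of the chart a *)
Definition pd (a : chart R n M) (i : 'I_n) (f : M -> R) (x : M) : R :=
  'D_(delta_mx 0 i) (f \o param a) (coord a x).

(* jac a b x i j = d x_b^j / d x_a^i *)
Definition jac (a b : chart R n M) (x : M) : 'M[R]_n :=
  \matrix_(i, j) pd a i (fun y => coord b y 0 j) x.

(* components in the chart a of a tangent vector / covector at x, and the
   covector at x with given components in the chart a *)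
Definition vec_in (a : chart R n M) (x : M) (v : 'rV[R]_n) : 'rV[R]_n :=
  v *m jac (chart_at x) a x.
Definition covec_in (a : chart R n M) (x : M) (xi : 'cV[R]_n) : 'cV[R]_n :=
  jac a (chart_at x) x *m xi.
Definition covec_of (a : chart R n M) (x : M) (p : 'cV[R]_n) : 'cV[R]_n :=
  jac (chart_at x) a x *m p.

(* the covector dx_a^i at x *)
Definition dcoord (a : chart R n M) (i : 'I_n) (x : M) : 'cV[R]_n :=
  covec_of a x (delta_mx i 0).

Definition smooth_on (U : set M) (f : M -> R) : Prop :=
  forall a, atlas a -> is_Coo (coord a @` (U `&` cdom a)) (f \o param a).

Definition vf_on (U : set M) (X : M -> 'rV[R]_n) : Prop :=
  forall a, atlas a -> forall i : 'I_n,
    is_Coo (coord a @` (U `&` cdom a))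
      ((fun x => vec_in a x (X x) 0 i) \o param a).

Definition form_on (U : set M) (al : M -> 'cV[R]_n) : Prop :=
  forall a, atlas a -> forall i : 'I_n,
    is_Coo (coord a @` (U `&` cdom a))
      ((fun x => covec_in a x (al x) i 0) \o param a).

Definition smooth (f : M -> R) := smooth_on setT f.
Definition vector_field (X : M -> 'rV[R]_n) := vf_on setT X.
Definition one_form (al : M -> 'cV[R]_n) := form_on setT al.

Definition pairing_fun (al : M -> 'cV[R]_n) (X : M -> 'rV[R]_n) : M -> R :=
  fun x => pairing (al x) (X x).

Definition df (f : M -> R) : M -> 'cV[R]_n :=
  fun x => \col_i pd (chart_at x) i f x.

(* X(f) *)
Definition act (X : M -> 'rV[R]_n) (f : M -> R) : M -> R := pairing_fun (df f) X.

(* The next three operations are given by their classical coordinate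
   expressions, evaluated at each x in the chart [chart_at x]. *)

(* [X, Y]^i = X(Y^i) - Y(X^i) *)
Definition lie_bracket (X Y : M -> 'rV[R]_n) : M -> 'rV[R]_n := fun x =>
  let a := chart_at x in
  \row_i (act X (fun y => vec_in a y (Y y) 0 i) x -
          act Y (fun y => vec_in a y (X y) 0 i) x).

(* (L_X beta)_j = X(beta_j) + beta_i d_j X^i *)
Definition lie_form (X : M -> 'rV[R]_n) (be : M -> 'cV[R]_n) : M -> 'cV[R]_n :=
  fun x => let a := chart_at x in
  \col_j (act X (fun y => covec_in a y (be y) j 0) x +
          \sum_i be x i 0 * pd a j (fun y => vec_in a y (X y) 0 i) x).

(* (d eta)_ij = d_i eta_j - d_j eta_i *)
Definition dform (eta : M -> 'cV[R]_n) : M -> 'M[R]_n := fun x =>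
  let a := chart_at x in
  \matrix_(i, j) (pd a i (fun y => covec_in a y (eta y) j 0) x -
                  pd a j (fun y => covec_in a y (eta y) i 0) x).

(* (i_X omega)_j = X^i omega_ij *)
Definition interior (X : M -> 'rV[R]_n) (om : M -> 'M[R]_n) : M -> 'cV[R]_n :=
  fun x => (X x *m om x)^T.

Definition annihilator (V : set 'rV[R]_n) : set 'cV[R]_n :=
  [set xi | forall v, V v -> pairing xi v = 0].

Definition section (Q : M -> set 'rV[R]_n) (X : M -> 'rV[R]_n) : Prop :=
  vector_field X /\ forall x, Q x (X x).

Definition distribution (k : nat) (Q : M -> set 'rV[R]_n) : Prop :=
  forall x, exists (U : set M) (F : M -> 'M[R]_(k, n)),
    [/\ open U, U x,
        forall i, vf_on U (fun y => row i (F y)) &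
        forall y, U y ->
          row_free (F y) /\ Q y = [set v : 'rV[R]_n | (v <= F y)%MS]].

Definition involutive (Q : M -> set 'rV[R]_n) : Prop :=
  forall X Y, section Q X -> section Q Y -> section Q (lie_bracket X Y).

(* Smooth Riemannian metric on a subbundle E of TM; [h x] is only meaningful
   on E x. *)
Record bundle_metric (E : M -> set 'rV[R]_n)
    (h : M -> 'rV[R]_n -> 'rV[R]_n -> R) : Prop := BundleMetric {
  metric_sym : forall x v w, E x v -> E x w -> h x v w = h x w v;
  metric_lin : forall x (c : R) u v w, E x u -> E x v -> E x w ->
    h x (c *: u + v) w = c * h x u w + h x v w;
  metric_pos : forall x v, E x v -> v != 0 -> 0 < h x v v;
  metric_smooth : forall U X Y, open U -> vf_on U X -> vf_on U Y ->
    (forall x, U x -> E x (X x) /\ E x (Y x)) ->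
    smooth_on U (fun x => h x (X x) (Y x))
}.

Definition riemannian_metric (G : M -> 'rV[R]_n -> 'rV[R]_n -> R) : Prop :=
  bundle_metric (fun=> setT) G.

(* R-bilinearity is contained in the last three clauses (f constant); the same
   applies to [g_connection] below. *)
Record levi_civita (G : M -> 'rV[R]_n -> 'rV[R]_n -> R)
    (D : (M -> 'rV[R]_n) -> (M -> 'rV[R]_n) -> M -> 'rV[R]_n) : Prop :=
  LeviCivita {
  lc_smooth : forall X Y, vector_field X -> vector_field Y ->
    vector_field (D X Y);
  lc_torsion : forall X Y, vector_field X -> vector_field Y ->
    forall x, D X Y x - D Y X x = lie_bracket X Y x;
  lc_metric : forall X Y Z, vector_field X -> vector_field Y ->
    vector_field Z -> forall x,
    act X (fun y => G y (Y y) (Z y)) x =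
    G x (D X Y x) (Z x) + G x (Y x) (D X Z x);
  lc_linear : forall f X X' Y, smooth f ->
    vector_field X -> vector_field X' -> vector_field Y ->
    forall x, D (fun y => f y *: X y + X' y) Y x = f x *: D X Y x + D X' Y x;
  lc_additive : forall X Y Y',
    vector_field X -> vector_field Y -> vector_field Y' ->
    forall x, D X (fun y => Y y + Y' y) x = D X Y x + D X Y' x;
  lc_leibniz : forall f X Y, smooth f -> vector_field X -> vector_field Y ->
    forall x, D X (fun y => f y *: Y y) x = f x *: D X Y x + act X f x *: Y x
}.

(* action of an affine connection on one-forms: the form gamma determined by
   <gamma, Y> = X<beta, Y> - <beta, D_X Y> *)
Definition dual_form (D : (M -> 'rV[R]_n) -> (M -> 'rV[R]_n) -> M -> 'rV[R]_n)
    (X : M -> 'rV[R]_n) (be : M -> 'cV[R]_n) : M -> 'cV[R]_n :=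
  xget (fun=> 0) [set ga | forall Y, vector_field Y -> forall x,
    pairing_fun ga Y x = act X (pairing_fun be Y) x - pairing_fun be (D X Y) x].

(* Vector fields on T*M are given by their components (xdot, pdot) in the
   coordinates (x_a^i, p_i) of T*M induced by the charts a of M. *)
Definition cot_field : Type :=
  chart R n M -> M -> 'cV[R]_n -> 'rV[R]_n * 'cV[R]_n.

Definition eq_cot_field (V W : cot_field) : Prop :=
  forall a x p, atlas a -> cdom a x -> V a x p = W a x p.

(* Hamilton's equations xdot^i = dH/dp_i, pdot_i = - dH/dx^i *)
Definition hamiltonian_field (H : M -> 'cV[R]_n -> R) : cot_field :=
  fun a x p =>
  (\row_i 'D_(delta_mx i 0) (fun q => H x (covec_of a x q)) p,
   \col_i - pd a i (fun y => H y (covec_of a y p)) x).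

(* A curve in T*M over the base curve c is a map p with p t a covector at c t.
   Since [coord a] is arbitrary off its domain, differentiability has to be
   supplemented with continuity of c. *)
Definition velocity (c : R -> M) (t : R) (v : 'rV[R]_n) : Prop :=
  {for t, continuous c} /\
  forall a, atlas a -> cdom a (c t) -> forall i,
    is_derive t (1 : R) (fun s => coord a (c s) 0 i) (vec_in a (c t) v 0 i).

Definition lift_derivable (c : R -> M) (p : R -> 'cV[R]_n) (t : R) : Prop :=
  {for t, continuous c} /\
  forall a, atlas a -> cdom a (c t) -> forall i : 'I_n,
    derivable (fun s => coord a (c s) 0 i) t 1 /\
    derivable (fun s => covec_in a (c s) (p s) i 0) t 1.

Definition integral_curve (V : cot_field) (I : set R) (c : R -> M)
    (p : R -> 'cV[R]_n) : Prop :=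
  forall t, I t -> {for t, continuous c} /\
  forall a, atlas a -> cdom a (c t) ->
  let v := V a (c t) (covec_in a (c t) (p t)) in
  forall i,
    is_derive t (1 : R) (fun s => coord a (c s) 0 i) (v.1 0 i) /\
    is_derive t (1 : R) (fun s => covec_in a (c s) (p s) i 0) (v.2 i 0).

End TangentCotangent.

Record sub_riemannian (R : realType) (n : nat) (M : manifold R n) :=
  SubRiemannian {
  sr_rank : nat;
  sr_Q : M -> set 'rV[R]_n;
  sr_h : M -> 'rV[R]_n -> 'rV[R]_n -> R;
  Q_distribution : distribution sr_rank sr_Q;
  Q_not_involutive : ~ involutive sr_Q;
  h_metric : bundle_metric sr_Q sr_h
}.

Section GConnections.
Context {R : realType} {n : nat} {M : manifold R n} (S : sub_riemannian M).

(* g = i o sharp_h o i^* : the vector of Q x representing the restriction of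
   xi to Q x *)
Definition g (x : M) (xi : 'cV[R]_n) : 'rV[R]_n :=
  xget 0 [set v | sr_Q S x v /\
                 forall w, sr_Q S x w -> sr_h S x v w = pairing xi w].

Definition gf (al : M -> 'cV[R]_n) : M -> 'rV[R]_n := fun x => g x (al x).

Definition gbar (x : M) (xi zeta : 'cV[R]_n) : R := pairing zeta (g x xi).

Definition gbarf (al be : M -> 'cV[R]_n) : M -> R :=
  fun x => gbar x (al x) (be x).

Definition sym_bracket (al be : M -> 'cV[R]_n) : M -> 'cV[R]_n := fun x =>
  lie_form (gf al) be x + lie_form (gf be) al x - df (gbarf al be) x.

Record g_connection
    (nabla : (M -> 'cV[R]_n) -> (M -> 'cV[R]_n) -> M -> 'cV[R]_n) : Prop :=
  GConnection {
  gc_smooth : forall al be, one_form al -> one_form be ->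
    one_form (nabla al be);
  gc_linear : forall f al al' be, smooth f ->
    one_form al -> one_form al' -> one_form be -> forall x,
    nabla (fun y => f y *: al y + al' y) be x =
    f x *: nabla al be x + nabla al' be x;
  gc_additive : forall al be be', one_form al -> one_form be -> one_form be' ->
    forall x, nabla al (fun y => be y + be' y) x =
              nabla al be x + nabla al be' x;
  gc_leibniz : forall f al be, smooth f -> one_form al -> one_form be ->
    forall x, nabla al (fun y => f y *: be y) x =
              f x *: nabla al be x + act (gf al) f x *: be x
}.

Section Connection.
Variable nabla : (M -> 'cV[R]_n) -> (M -> 'cV[R]_n) -> M -> 'cV[R]_n.

Definition normal_connection : Prop :=
  forall al be, one_form al -> one_form be ->
  forall x, nabla al be x + nabla be al x = sym_bracket al be x.

(* action on vector fields: the field Z determined by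
   <Z, beta> = g(alpha)<X, beta> - <X, nabla_alpha beta> *)
Definition nabla_vf (al : M -> 'cV[R]_n) (X : M -> 'rV[R]_n) : M -> 'rV[R]_n :=
  xget (fun=> 0) [set Z | forall be, one_form be -> forall x,
    pairing_fun be Z x = act (gf al) (pairing_fun be X) x - pairing_fun (nabla al be) X x].

(* a global one-form that coincides with dx_a^i near x *)
Definition dcoord_ext (a : chart R n M) (i : 'I_n) (x : M) : M -> 'cV[R]_n :=
  xget (fun=> 0)
    [set A | one_form A /\ \forall y \near nbhs x, A y = dcoord a i y].

(* Gamma^{ik}_j at x, where nabla_{dx^i} dx^k = Gamma^{ik}_j dx^j. As nabla acts
   on global forms, it is evaluated on extensions of dx^i and dx^k; the value
   does not depend on these because nabla is local. *)
Definition christoffel (a : chart R n M) (x : M) (i k j : 'I_n) : R :=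
  covec_in a x (nabla (dcoord_ext a i x) (dcoord_ext a k x) x) j 0.

Definition g_coef (a : chart R n M) (x : M) (i j : 'I_n) : R :=
  gbar x (dcoord a i x) (dcoord a j x).

(* Gamma^nabla *)
Definition geodesic_field : cot_field M := fun a x p =>
  (\row_i \sum_j g_coef a x i j * p j 0,
   \col_j - \sum_i \sum_k christoffel a x i k j * p i 0 * p k 0).

(* nabla_alpha psi along c for curves alpha, psi in T*M over c, in the chart
   [chart_at (c t)] *)
Definition nabla_along (c : R -> M) (al psi : R -> 'cV[R]_n) (t : R)
    : 'cV[R]_n :=
  let a := chart_at (c t) in
  \col_j (derive1 (fun s => covec_in a (c s) (psi s) j 0) t +
          \sum_i \sum_k christoffel a (c t) i k j * al t i 0 * psi t k 0).

Definition g_admissible (I : set R) (c : R -> M) (al : R -> 'cV[R]_n) : Prop :=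
  forall t, I t -> velocity c t (g (c t) (al t)).

Definition auto_parallel (I : set R) (c : R -> M) (al : R -> 'cV[R]_n) : Prop :=
  [/\ g_admissible I c al,
      forall t, I t -> lift_derivable c al t &
      forall t, I t -> nabla_along c al al t = 0].

Definition geodesic (I : set R) (c : R -> M) : Prop :=
  exists al, auto_parallel I c al.

End Connection.

Definition sr_hamiltonian (x : M) (xi : 'cV[R]_n) : R := 2^-1 * gbar x xi xi.

Definition X_H : cot_field M := hamiltonian_field sr_hamiltonian.

Definition tangent_to_Q (I : set R) (c : R -> M) : Prop :=
  forall t, I t -> exists2 v, sr_Q S (c t) v & velocity c t v.

Definition normal_extremal (I : set R) (c : R -> M) : Prop :=
  tangent_to_Q I c /\
  exists psi, (forall t, I t -> psi t != 0) /\ integral_curve X_H I c psi.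

Definition open_interval (I : set R) : Prop := open I /\ is_interval I.

Definition restricts_to_h (G : M -> 'rV[R]_n -> 'rV[R]_n -> R) : Prop :=
  forall x v w, sr_Q S x v -> sr_Q S x w -> G x v w = sr_h S x v w.

Section Restriction.
Variable G : M -> 'rV[R]_n -> 'rV[R]_n -> R.

Definition Qperp (x : M) : set 'rV[R]_n :=
  [set v | forall w, sr_Q S x w -> G x v w = 0].

(* the projections of T*M = (Qperp)^0 (+) Q^0 *)
Definition tau (al : M -> 'cV[R]_n) : M -> 'cV[R]_n := fun x =>
  xget 0 [set zeta | annihilator (Qperp x) zeta /\
                     annihilator (sr_Q S x) (al x - zeta)].

Definition tau_perp (al : M -> 'cV[R]_n) : M -> 'cV[R]_n :=
  fun x => al x - tau al x.

End Restriction.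

(* delta^B_X eta, for X a section of Q and eta a section of Q^0 *)
Definition deltaB (X : M -> 'rV[R]_n) (eta : M -> 'cV[R]_n) : M -> 'cV[R]_n :=
  interior X (dform eta).

End GConnections.

(* Main.v *)
(** Put T(alpha, beta) = nabla_alpha beta + nabla_beta alpha - {alpha, beta}. The
    derivation terms cancel, so T is a symmetric tensor, and normality is T = 0.
    Polarization gives (2), and pairing T with vector fields gives (3). Since
    L_X (df) = d (X f), one has {dx^i, dx^k} = d g^ik; as T is a tensor, T = 0 says
    that the symmetrized Christoffel symbols are the partial derivatives of the
    g^ik, i.e. that the quadratic maps p |-> Gamma^ik_j p_i p_k and
    p |-> 1/2 d_j g^ik p_i p_k agree, which is (4). For (5), tau(alpha) is the
    G-dual of X = g(alpha) and tau^bot(alpha) annihilates X, so Cartan's formula and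
    the Koszul-type identity
    L_X X^flat - 1/2 d |X|^2 = (nabla^G_X X)^flat turn 1/2 {alpha, alpha} into the
    right-hand side of (5).

    For the curves, X_H transforms as a vector field on T^*M under change of charts,
    and the Picard theorem provides an integral curve of X_H through every covector.
    A geodesic can have an auto-parallel lift meeting the zero section; then the lift
    vanishes identically and the geodesic is constant, hence also the projection of
    a constant nonzero curve in Q^0, because Q <> TM and H and dH vanish on Q^0. *)
Require Import Defs.
From HB Require Import structures.
From mathcomp Require Import all_boot all_order all_algebra.
From mathcomp Require Import all_classical all_reals all_analysis.
From mathcomp Require Import ring lra.
Import Order.TTheory GRing.Theory Num.Theory.
Import numFieldNormedType.Exports.
(* Gives precedence to [Defs.coord] over [vector.coord]. *)
Import Defs.
Local Open Scope classical_set_scope.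
Local Open Scope ring_scope.
Set Implicit Arguments.
Unset Strict Implicit.
Unset Printing Implicit Defensive.

(** * Differential calculus in coordinates *)

(** Smoothness is defined by continuity of iterated partial derivatives, so the chain rule, the
    symmetry of second derivatives and the Lipschitz bound for Hamilton's equations are all derived
    from mean values along coordinate directions.

    A connection acts on global forms, while Christoffel symbols and Hamilton's equations are local.
    Bump functions bridge the gap: they extend the dx^i, and they show that a functional which is
    linear over functions at a point is determined by its values on these extensions. Objects
    selected by [xget] are treated by exhibiting a witness, since otherwise they would be the
    default 0.

    Lie derivatives and brackets are computed at x in the chart chosen at x, which varies with x
    without any regularity. Smoothness of the bracket is therefore read off from an invariant
    identity. For curves the same obstacle is met by showing that Hamilton's equations in one chart
    imply them in all charts.

    That an integral curve stays in the zero section once it meets it comes from an estimate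
    iterated on a short interval, followed by connectedness of the interval. *)

Section RowVectors.
Context {R : realType} {n : nat}.
Implicit Types (w z v : 'rV[R]_n) (f : 'rV[R]_n -> R).

Lemma normr_coord w i : `|w 0 i| <= `|w|.
Proof. by rewrite [leRHS]/Num.Def.normr/= mx_normrE; exact: (le_bigmax _ _ (0, i)). Qed.

Lemma normr_row_le w c : 0 <= c -> (forall i, `|w 0 i| <= c) -> `|w| <= c.
Proof.
move=> c0 h; rewrite [leLHS]/Num.Def.normr/= mx_normrE; apply: bigmax_le => //.
by move=> -[i j] _ /=; rewrite (ord1 i).
Qed.

Lemma is_derive_line f w v (s d : R) :
  is_derive (s *: v + w) v f d -> is_derive s 1 (fun t : R => f (t *: v + w)) d.
Proof.
have e : (fun h : R => h^-1 *: (((fun t : R => f (t *: v + w)) \o shift s) (h *: 1) -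
    f (s *: v + w)))
  = (fun h => h^-1 *: ((f \o shift (s *: v + w)) (h *: v) - f (s *: v + w))).
  by apply/funext => h /=; rewrite [h *: 1]mulr1 scalerDl -addrA.
by case=> h1 <-; split; rewrite /derivable /derive e.
Qed.

(** Restricted to the line through z, the claim is the one-variable chain rule for s |-> c s, which
    covers c = 0 without a case distinction. *)
Lemma is_derive_scale f z v (c d : R) :
  is_derive z v f d -> is_derive z (c *: v) f (c * d).
Proof.
move=> fd.
have h1 : is_derive (0 : R) 1 (fun t : R => f (t *: v + z)) d.
  by apply: is_derive_line; rewrite scale0r add0r.
have h2 : is_derive (0 : R) 1 ( *%R c) c.
  by have h := @is_deriveZ R R R id c 0 1 1 (is_derive_id _ _);
    apply: (is_derive_eq h); rewrite [c *: 1]mulr1.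
have h3 : is_derive (0 : R) 1 (fun s => f ((c * s) *: v + z)) (c * d).
  have h1' : is_derive (c * 0) 1 (fun t : R => f (t *: v + z)) d by rewrite mulr0.
  split.
    have d1 : differentiable ( *%R c) (0 : R) by apply/derivable1_diffP.
    have d2 : differentiable (fun t : R => f (t *: v + z)) (c * 0).
      by apply/derivable1_diffP.
    by apply/derivable1_diffP; exact: (differentiable_comp d1 d2).
  rewrite -derive1E (@derive1_comp _ ( *%R c) (fun t : R => f (t *: v + z))) //.
  by rewrite !derive1E !derive_val mulrC.
have e : (fun h : R => h^-1 *: (((fun s => f ((c * s) *: v + z)) \o shift 0) (h *: 1) -
    f ((c * 0) *: v + z)))
  = (fun h => h^-1 *: ((f \o shift z) (h *: (c *: v)) - f z)).
  by apply/funext => h /=; rewrite [h *: 1]mulr1 addr0 mulr0 scale0r add0r scalerA mulrC.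
by case: h3 => h3 <-; split; rewrite /derivable /derive -e.
Qed.

Lemma MVT_line f w v :
  (forall s : R, 0 <= s <= 1 -> derivable f (s *: v + w) v) ->
  exists2 s : R, 0 <= s <= 1 & f (v + w) - f w = 'D_v f (s *: v + w).
Proof.
move=> h.
have d (s : R) : s \in `[0, 1]%R ->
    is_derive s 1 (fun t : R => f (t *: v + w)) ('D_v f (s *: v + w)).
  by rewrite in_itv /= => hs; apply: is_derive_line; apply/derivableP/h.
have d' (s : R) : s \in `]0, 1[%R ->
    is_derive s 1 (fun t : R => f (t *: v + w)) ('D_v f (s *: v + w)).
  by move=> hs; apply: d; move: hs; rewrite !in_itv /= => /andP[/ltW -> /ltW ->].
have c : {within `[0, 1], continuous (fun t : R => f (t *: v + w))}.
  apply: derivable_within_continuous => s hs.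
  by have [] := d s hs.
have [s + e] := @MVT_segment R (fun t => f (t *: v + w)) _ _ _ ler01 d' c.
rewrite in_itv /= => hs; exists s => //.
by move: e; rewrite scale1r scale0r add0r subr0 mulr1.
Qed.

Local Notation e_ i := (delta_mx 0 i : 'rV[R]_n).

Lemma MVT_coord f w (c : R) (i : 'I_n) :
  (forall s : R, 0 <= s <= 1 -> derivable f ((s * c) *: e_ i + w) (e_ i)) ->
  exists2 s : R, 0 <= s <= 1 &
    f (c *: e_ i + w) - f w = c * 'D_(e_ i) f ((s * c) *: e_ i + w).
Proof.
move=> h.
have h' (s : R) : 0 <= s <= 1 -> is_derive (s *: (c *: e_ i) + w) (c *: e_ i) f
    (c * 'D_(e_ i) f ((s * c) *: e_ i + w)).
  by move=> hs; rewrite scalerA; apply: is_derive_scale; apply/derivableP/h.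
have [s hs|s hs ->] := @MVT_line f w (c *: e_ i); first by have [] := h' s hs.
by exists s => //; have [_ ->] := h' s hs.
Qed.

(* Moving from [w] to [w'] one coordinate at a time. *)
Lemma finite_increments f w w' :
  (forall y, `|y - w| <= `|w' - w| -> forall j, derivable f y (e_ j)) ->
  exists xi : 'I_n -> 'rV[R]_n,
    (forall j, `|xi j - w| <= `|w' - w|) /\
    f w' - f w = \sum_j (w' 0 j - w 0 j) * 'D_(e_ j) f (xi j).
Proof.
move=> h.
pose H (k : nat) : 'rV[R]_n := \row_j (if (j < k)%N then w' 0 j else w 0 j).
have H0 : H 0%N = w by apply/rowP => j; rewrite mxE.
have Hn : H n = w' by apply/rowP => j; rewrite mxE ltn_ord.
have HS (j : 'I_n) : H j.+1 = (w' 0 j - w 0 j) *: e_ j + H j.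
  apply/rowP => i; rewrite !mxE eqxx /= ltnS leq_eqVlt -val_eqE /=.
  case: eqVneq => [/val_inj ->|] /=; first by rewrite ltnn mulr1 subrK.
  by rewrite mulr0 add0r.
(* The norm on rows is the maximum norm, so no point of the coordinate path is farther from w than
   w' is. *)
have Hb (j : 'I_n) (s : R) : 0 <= s <= 1 ->
    `|((s * (w' 0 j - w 0 j)) *: e_ j + H j) - w| <= `|w' - w|.
  move=> /andP[s0 s1]; apply: normr_row_le => // i; rewrite !mxE eqxx /= -val_eqE /=.
  have hi : `|w' 0 i - w 0 i| <= `|w' - w| by have := normr_coord (w' - w) i; rewrite !mxE.
  case: eqVneq => [/val_inj ->|] /=.
    rewrite ltnn mulr1 addrK normrM ger0_norm //.
    have := normr_coord (w' - w) j; rewrite !mxE; apply: le_trans.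
    by rewrite ler_piMl.
  by rewrite mulr0 add0r; case: ifP => _ //; rewrite subrr normr0.
have mv (j : 'I_n) : exists x, `|x - w| <= `|w' - w| /\
    f (H j.+1) - f (H j) = (w' 0 j - w 0 j) * 'D_(e_ j) f x.
  have [s hs|s hs e] := @MVT_coord f (H j) (w' 0 j - w 0 j) j.
    by apply: h; apply: Hb.
  by eexists; split; [exact: (Hb j s hs)|rewrite HS e].
have [xi hxi] := choice mv; exists xi; split=> [j|]; first by have [] := hxi j.
transitivity (\sum_(j < n) (f (H j.+1) - f (H j))).
  rewrite -(big_mkord xpredT (fun j => f (H j.+1) - f (H j))) telescope_sumr //.
  by rewrite H0 Hn.
by apply: eq_bigr => j _; have [] := hxi j.
Qed.

End RowVectors.

Section ChainRule.
Context {R : realType} {n : nat} {W : normedModType R}.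
Local Notation e_ i := (delta_mx 0 i : 'rV[R]_n).

Lemma cvg_row (T : Type) (F : set_system T) {FF : Filter F}
    (f : T -> 'rV[R]_n) (l : 'rV[R]_n) :
  (forall j, f x 0 j @[x --> F] --> l 0 j) -> f @ F --> l.
Proof.
move=> h; apply/cvgrPdist_le => e e0.
have : \forall x \near F, forall j, `|l 0 j - f x 0 j| <= e.
  by apply: filter_forall => j; move/cvgrPdist_le: (h j); apply.
apply: filterS => x hx; apply: normr_row_le; first exact: ltW.
by move=> i; rewrite !mxE.
Qed.

Lemma continuous_row (T : topologicalType) (f : T -> 'rV[R]_n) (x : T) :
  (forall j, {for x, continuous (fun y => f y 0 j)}) -> {for x, continuous f}.
Proof. by move=> h; apply: cvg_row => j; exact: h. Qed.

Lemma cvg_sumr (T I : Type) (F : set_system T) {FF : Filter F} (s : seq I)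
    (f : I -> T -> R) (l : I -> R) : (forall i, f i @ F --> l i) ->
  (fun x => \sum_(i <- s) f i x) @ F --> \sum_(i <- s) l i.
Proof.
move=> h; elim: s => [|i s IH].
  by rewrite big_nil; under eq_fun do rewrite big_nil; exact: cvg_cst.
by rewrite big_cons; under eq_fun do rewrite big_cons; apply: cvgD.
Qed.

(** Total differentiability of f is not at hand. The difference quotient is expanded by
    [finite_increments] into quotients of the components of phi times partial derivatives of f at
    intermediate points; these points tend to phi z, and continuity of the partial derivatives gives
    the limit. *)
Lemma is_derive_chain (phi : W -> 'rV[R]_n) (z v : W) (d : 'I_n -> R)
    (V : set 'rV[R]_n) (f : 'rV[R]_n -> R) :
  (forall j, is_derive z v (fun y => phi y 0 j) (d j)) ->
  open V -> V (phi z) -> is_Ck 1 V f ->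
  is_derive z v (f \o phi) (\sum_j d j * 'D_(e_ j) f (phi z)).
Proof.
move=> hphi oV Vz [cf hf].
have cphi : phi (h *: v + z) @[h --> 0^'] --> phi z.
  apply: cvg_row => j; have [dj _] := hphi j.
  have /derivable1P/derivable1_diffP/differentiable_continuous := dj.
  rewrite /prop_for /continuous_at scale0r add0r.
  by move=> c; apply: cvg_trans c; apply: cvg_app; exact: cvg_within.
have [r /= r0 rV] : exists2 r : R, 0 < r & forall y, `|y - phi z| < r -> V y.
  have /nbhs_ballP[r r0 hr] := open_nbhs_nbhs (conj oV Vz).
  by exists r => // y hy; apply: hr; rewrite -ball_normE /= distrC.
have ex (h : R) : exists xi : 'I_n -> 'rV[R]_n, `|phi (h *: v + z) - phi z| < r ->
    (forall j, `|xi j - phi z| <= `|phi (h *: v + z) - phi z|) /\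
    f (phi (h *: v + z)) - f (phi z) =
    \sum_j (phi (h *: v + z) 0 j - phi z 0 j) * 'D_(e_ j) f (xi j).
  have [lt|] := pselect (`|phi (h *: v + z) - phi z| < r); last by exists (fun=> 0).
  have [y hy j|xi ?] := @finite_increments _ _ f (phi z) (phi (h *: v + z)).
    by have [+ _] := hf j; apply; apply: rV; apply: le_lt_trans lt.
  by exists xi.
have [xi hxi] := choice ex.
have near_r : \forall h \near (0:R)^', `|phi (h *: v + z) - phi z| < r.
  by move/cvgrPdist_lt: cphi => /(_ _ r0); apply: filterS => h; rewrite distrC.
have cxi j : xi h j @[h --> 0^'] --> phi z.
  apply/cvgrPdist_lt => e e0.
  move/cvgrPdist_lt: cphi => /(_ _ e0).
  apply: filterS2 near_r => h hr; rewrite distrC => he.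
  by rewrite distrC; apply: le_lt_trans he; apply: (hxi h hr).1.
have lim : (fun h => h^-1 *: (((f \o phi) \o shift z) (h *: v) - (f \o phi) z)) @ 0^' -->
    \sum_j d j * 'D_(e_ j) f (phi z).
  have : (fun h => \sum_j (h^-1 *: (phi (h *: v + z) 0 j - phi z 0 j)) * 'D_(e_ j) f (xi h j)) @ 0^'
     --> \sum_j d j * 'D_(e_ j) f (phi z).
    apply: cvg_sumr => j; apply: cvgM.
      by have [hd <-] := hphi j; exact: hd.
    have [_ [c1 _]] := hf j.
    exact: (cvg_comp _ _ (cxi j) (c1 _ Vz)).
  apply: cvg_trans; apply: near_eq_cvg; apply: filterS near_r => h hr /=.
  rewrite (hxi h hr).2 scaler_sumr; apply: eq_bigr => j _.
  by rewrite scalerAl.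
by split; [apply/cvg_ex; eexists; exact: lim|exact/cvg_lim].
Qed.

End ChainRule.

Lemma near_open (T : topologicalType) (U : set T) (x : T) (P : T -> Prop) :
  open U -> U x -> (forall y, U y -> P y) -> \forall y \near x, P y.
Proof. by move=> oU Ux h; exact: filterS (open_nbhs_nbhs (conj oU Ux)). Qed.
Lemma near_eq_continuous (T S : topologicalType) (f h : T -> S) (x : T) :
  (\forall y \near x, f y = h y) -> {for x, continuous f} -> {for x, continuous h}.
Proof.
move=> fh cf; rewrite /prop_for /continuous_at -(nbhs_singleton fh).
by apply: cvg_trans cf; exact: near_eq_cvg.
Qed.

(** * Functions of class C^k on subsets of R^n *)

Section SmoothOpenSets.
Context {R : realType} {n : nat}.
Implicit Types (f h : 'rV[R]_n -> R) (U V : set 'rV[R]_n).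
Local Notation e_ i := (delta_mx 0 i : 'rV[R]_n).

Lemma is_Ck_sub k U V f : V `<=` U -> is_Ck k U f -> is_Ck k V f.
Proof.
move=> VU; elim: k f => [|k IH] f [cf hf]; (split; first by move=> z /VU; exact: cf) => // i.
by have [d c] := hf i; split=> [z /VU/d|]; [|exact: IH].
Qed.

(** [is_Ck] is a condition at each point of U on a total function, so it can be checked on any V
    containing the point, open or not. *)
Lemma is_Ck_local k U f :
  (forall z, U z -> exists V, V z /\ is_Ck k V f) -> is_Ck k U f.
Proof.
elim: k f => [|k IH] f h;
  (split; first by move=> z /h [V [Vz [c _]]]; exact: c) => // i.
split=> [z Uz|]; first by have [V [Vz [_ /(_ i)[d _]]]] := h _ Uz; exact: d.
  by apply: IH => z Uz; have [V [Vz [_ /(_ i)[_ d]]]] := h _ Uz; exists V.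
Qed.

Lemma is_CkS k U f : is_Ck k.+1 U f -> is_Ck k U f.
Proof.
elim: k f => [|k IH] f [cf hf]; split=> // i.
by have [d c] := hf i; split=> //; apply: IH.
Qed.

Lemma is_Ck_eq k U f h : open U -> (forall z, U z -> f z = h z) ->
  is_Ck k U f -> is_Ck k U h.
Proof.
move=> oU; elim: k f h => [|k IH] f h fh [cf hf].
- by split=> // z Uz; apply: near_eq_continuous (cf z Uz); exact: (near_open oU Uz).
have nfh z : U z -> \forall y \near z, f y = h y by move=> Uz; exact: (near_open oU Uz).
split; first by move=> z Uz; apply: near_eq_continuous (cf z Uz); exact: nfh.
move=> i; have [d c] := hf i; split=> [z Uz|].
  by apply: near_eq_derivable (d z Uz); exact: nfh.
by apply: IH c => z Uz; apply: near_eq_derive; exact: nfh.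
Qed.

Lemma is_Ck_cst k U (c : R) : is_Ck k U (fun=> c).
Proof.
elim: k c => [|k IH] c; (split; first by move=> z _; exact: cst_continuous) => // i.
split=> [z _|]; first exact: derivable_cst.
have -> : (fun z => 'D_(e_ i) (fun=> c) z) = fun=> 0.
  by apply/funext => z; exact: derive_cst.
exact: IH.
Qed.

Lemma is_CkD k U f h : open U -> is_Ck k U f -> is_Ck k U h ->
  is_Ck k U (fun z => f z + h z).
Proof.
move=> oU; elim: k f h => [|k IH] f h [cf hf] [ch hh]; 
  (split; first by move=> z Uz; exact: (continuousD (cf z Uz) (ch z Uz))) => // i.
have [df Df] := hf i; have [dh Dh] := hh i.
split=> [z Uz|]; first by apply: derivableD; [exact: df|exact: dh].
apply: is_Ck_eq (IH _ _ Df Dh) => // z Uz.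
exact: esym (deriveD (df z Uz) (dh z Uz)).
Qed.

Lemma is_CkM k U f h : open U -> is_Ck k U f -> is_Ck k U h ->
  is_Ck k U (fun z => f z * h z).
Proof.
move=> oU; elim: k f h => [|k IH] f h Cf Ch; have [cf hf] := Cf; have [ch hh] := Ch;
  (split; first by move=> z Uz; exact: (continuousM (cf z Uz) (ch z Uz))) => // i.
have [df Df] := hf i; have [dh Dh] := hh i.
split=> [z Uz|]; first by apply: derivableM; [exact: df|exact: dh].
apply: is_Ck_eq (is_CkD oU (IH _ _ (is_CkS Cf) Dh) (IH _ _ (is_CkS Ch) Df)) => // z Uz.
exact: esym (deriveM (df z Uz) (dh z Uz)).
Qed.

Lemma is_Ck_sum (I : Type) (s : seq I) (F : I -> 'rV[R]_n -> R) k U : open U ->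
  (forall i, is_Ck k U (F i)) -> is_Ck k U (fun z => \sum_(i <- s) F i z).
Proof.
move=> oU hF; elim: s => [|i s IH].
  by apply: is_Ck_eq (is_Ck_cst k U 0) => // z _; rewrite big_nil.
by apply: is_Ck_eq (is_CkD oU (hF i) IH) => // z _; rewrite big_cons.
Qed.

Lemma is_Ck_prod (I : Type) (s : seq I) (F : I -> 'rV[R]_n -> R) k U : open U ->
  (forall i, is_Ck k U (F i)) -> is_Ck k U (fun z => \prod_(i <- s) F i z).
Proof.
move=> oU hF; elim: s => [|i s IH].
  by apply: is_Ck_eq (is_Ck_cst k U 1) => // z _; rewrite big_nil.
by apply: is_Ck_eq (is_CkM oU (hF i) IH) => // z _; rewrite big_cons.
Qed.

Lemma is_derive_coord (z v : 'rV[R]_n) (j : 'I_n) :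
  is_derive z v (fun y : 'rV[R]_n => y 0 j) (v 0 j).
Proof.
have d : derivable (id : 'rV[R]_n -> 'rV[R]_n) z v by apply: derivable_id.
have := derive_mx d; rewrite derive_id => /matrixP/(_ 0 j); rewrite mxE => ->.
by apply/derivableP; move/derivable_mxP: d; exact.
Qed.

Lemma is_Ck_coord k U (j : 'I_n) : is_Ck k U (fun z => z 0 j).
Proof.
case: k => [|k]; (split; first by move=> z _; exact: matrix_normedtype.coord_continuous) => // i.
split=> [z _|]; first by have [] := is_derive_coord z (e_ i) j.
have -> : (fun z => 'D_(e_ i) (fun y : 'rV[R]_n => y 0 j) z) = fun=> (e_ i) 0 j.
  by apply/funext => z; have [_] := is_derive_coord z (e_ i) j.
exact: is_Ck_cst.
Qed.

Lemma is_Coo_derive U f i : is_Coo U f -> is_Coo U (fun z => 'D_(e_ i) f z).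
Proof. by move=> hf k; have [_ /(_ i)[]] := hf k.+1. Qed.

Lemma is_Coo_derivable U f i z : is_Coo U f -> U z -> derivable f z (e_ i).
Proof. by move=> /(_ 1%N)[_ /(_ i)[+ _]]; apply. Qed.

Lemma is_derive_comp1 (F : R -> R) f z v (d d' : R) :
  is_derive z v f d -> is_derive (f z) 1 F d' ->
  is_derive z v (fun y => F (f y)) (d * d').
Proof.
move=> dz h2.
have h1 : is_derive (0 : R) 1 (fun t : R => f (t *: v + z)) d.
  by apply: is_derive_line; rewrite scale0r add0r.
have d1 : derivable (fun t : R => f (t *: v + z)) 0 1 by have [] := h1.
have d2 : derivable F (f ((0 : R) *: v + z)) 1.
  by rewrite scale0r add0r; have [] := h2.
split.
  apply/derivable1P; apply/derivable1_diffP.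
  move/derivable1_diffP: d1 => d1; move/derivable1_diffP: d2 => d2.
  exact: (differentiable_comp d1 d2).
transitivity (derive1 (F \o (fun t : R => f (t *: v + z))) 0).
  have e : (fun h : R => h^-1 *: (((fun y => F (f y)) \o shift z) (h *: v) - F (f z)))
    = (fun h : R => h^-1 *: (((F \o (fun t : R => f (t *: v + z))) \o shift 0) (h *: 1)
       - (F \o (fun t : R => f (t *: v + z))) 0)).
    by apply/funext => h /=; rewrite [h *: 1]mulr1 addr0 scale0r add0r.
  by rewrite derive1E /derive e.
rewrite (derive1_comp d1 d2) !derive1E.
by have [_ ->] := h1; rewrite scale0r add0r; have [_ ->] := h2; rewrite mulrC.
Qed.

(** F lists the successive derivatives of a function of one variable; each differentiation of F j (f
    z) moves one place along this list, which is why the conclusion is for all j. *)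
Lemma is_Ck_comp1 k U (F : nat -> R -> R) (V : set R) f : open U ->
  (forall j x, V x -> is_derive x 1 (F j) (F j.+1 x)) ->
  (forall z, U z -> V (f z)) -> is_Ck k U f ->
  forall j, is_Ck k U (fun z => F j (f z)).
Proof.
move=> oU hF fV.
have cF j x : V x -> {for x, continuous (F j)}.
  by move=> /(hF j) [/derivable1_diffP/differentiable_continuous].
elim: k => [|k IH] Cf j; have [cf hf] := Cf;
  (split; first by move=> z Uz; apply: continuous_comp; [exact: cf|exact/cF/fV]) => //.
have D z i : U z -> is_derive z (e_ i) (fun y => F j (f y)) ('D_(e_ i) f z * F j.+1 (f z)).
  move=> Uz; apply: (is_derive_comp1 (d := 'D_(e_ i) f z) (d' := F j.+1 (f z))).
    by apply/derivableP; exact: ((hf i).1 z Uz).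
  by apply: hF; exact: fV.
move=> i; split=> [z Uz|]; first by have [] := D z i Uz.
apply: is_Ck_eq (is_CkM oU (hf i).2 (IH (is_CkS Cf) j.+1)) => // z Uz.
by have [_ ->] := D z i Uz.
Qed.

End SmoothOpenSets.

Section Composition.
Context {R : realType} {m n : nat}.

Lemma is_Ck_comp k (U : set 'rV[R]_m) (V : set 'rV[R]_n)
    (phi : 'rV[R]_m -> 'rV[R]_n) (f : 'rV[R]_n -> R) :
  open U -> open V -> (forall z, U z -> V (phi z)) ->
  (forall j, is_Ck k U (fun z => phi z 0 j)) -> is_Ck k V f ->
  is_Ck k U (f \o phi).
Proof.
move=> oU oV UV; elim: k f => [|k IH] f hphi Cf; have [cf hf] := Cf;
  (split; first (move=> z Uz; apply: continuous_comp; [|exact/cf/UV];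
    by apply: continuous_row => j; have [+ _] := hphi j; exact)) => //.
have C1 : is_Ck 1 V f by elim: (k) Cf => // k' IH' /is_CkS.
have D i z : U z -> is_derive z (delta_mx 0 i) (f \o phi)
    (\sum_j 'D_(delta_mx 0 i) (fun y => phi y 0 j) z * 'D_(delta_mx 0 j) f (phi z)).
  move=> Uz; apply: (is_derive_chain _ oV (UV _ Uz) C1) => j.
  by apply/derivableP; have [_ /(_ i)[+ _]] := hphi j; exact.
move=> i; split=> [z Uz|]; first by have [] := D i z Uz.
have : is_Ck k U (fun z => \sum_j 'D_(delta_mx 0 i) (fun y => phi y 0 j) z *
    'D_(delta_mx 0 j) f (phi z)).
  apply: is_Ck_sum => // j; apply: is_CkM => //.
    by have [_ /(_ i)[]] := hphi j.
  apply: (IH (fun z => 'D_(delta_mx 0 j) f z)) (hf j).2.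
  by move=> l; apply: is_CkS.
by apply: is_Ck_eq => // z Uz; have [_ ->] := D i z Uz.
Qed.

Lemma is_Coo_comp (U : set 'rV[R]_m) (V : set 'rV[R]_n)
    (phi : 'rV[R]_m -> 'rV[R]_n) (f : 'rV[R]_n -> R) :
  open U -> open V -> (forall z, U z -> V (phi z)) ->
  (forall j, is_Coo U (fun z => phi z 0 j)) -> is_Coo V f ->
  is_Coo U (f \o phi).
Proof.
by move=> oU oV UV hphi hf k; apply: (is_Ck_comp oU oV) => // j; exact: hphi.
Qed.

End Composition.

(** * Symmetry of second partial derivatives *)

Section Schwarz.
Context {R : realType} {n : nat}.
Local Notation e_ i := (delta_mx 0 i : 'rV[R]_n).

Lemma dist_half (e a b d : R) :
  `|a - d| < e / 2 -> `|b - d| < e / 2 -> `|a - b| <= e.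
Proof.
move=> /ltW ha /ltW hb; rewrite (le_trans (ler_distD d _ _)) //.
by rewrite (splitr e) lerD // distrC.
Qed.

Lemma schwarz (U : set 'rV[R]_n) f (z : 'rV[R]_n) i j : open U -> U z -> is_Ck 2 U f ->
  'D_(e_ i) (fun y => 'D_(e_ j) f y) z = 'D_(e_ j) (fun y => 'D_(e_ i) f y) z.
Proof.
move=> oU Uz [_ hf].
have [r r0 rU] : exists2 r : R, 0 < r & forall y, `|y - z| < r -> U y.
  have /nbhs_ballP[r r0 hr] := open_nbhs_nbhs (conj oU Uz).
  by exists r => // y hy; apply: hr; rewrite -ball_normE /= distrC.
(* The mixed difference over a square of side [c] is [c ^ 2] times a mixed
   partial derivative, in either order. *)
have mixed i' j' (c : R) : 0 < c -> c + c < r -> exists2 y, `|y - z| <= c + c &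
    f (c *: e_ i' + (c *: e_ j' + z)) - f (c *: e_ i' + z) - (f (c *: e_ j' + z) - f z) =
    c * (c * 'D_(e_ j') (fun y => 'D_(e_ i') f y) y).
  move=> c0 cr.
  have bnd (s t : R) : 0 <= s <= 1 -> 0 <= t <= 1 ->
      `|(s * c) *: e_ i' + ((t * c) *: e_ j' + z) - z| <= c + c.
    move=> hs ht; rewrite addrA addrK (le_trans (ler_normD _ _)) // lerD //.
    - apply: normr_row_le => [|l]; first exact: ltW.
      have /andP[s0 s1] := hs.
      rewrite !mxE; case: eqP => _; case: eqP => _ /=;
        rewrite ?mulr1 ?mulr0 ?normr0 ?(ltW c0) //.
      by rewrite ger0_norm ?mulr_ge0 ?(ltW c0) // ler_piMl // ltW.
    - apply: normr_row_le => [|l]; first exact: ltW.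
      have /andP[s0 s1] := ht.
      rewrite !mxE; case: eqP => _; case: eqP => _ /=;
        rewrite ?mulr1 ?mulr0 ?normr0 ?(ltW c0) //.
      by rewrite ger0_norm ?mulr_ge0 ?(ltW c0) // ler_piMl // ltW.
  have inU (s t : R) : 0 <= s <= 1 -> 0 <= t <= 1 ->
      U ((s * c) *: e_ i' + ((t * c) *: e_ j' + z)).
    by move=> hs ht; apply: rU; apply: le_lt_trans (bnd _ _ hs ht) cr.
  have I0 : 0 <= (0 : R) <= 1 by rewrite lexx ler01.
  have I1 : 0 <= (1 : R) <= 1 by rewrite lexx ler01.
  (* The mean value theorem is applied first to the increment phi along i', then to the i'-th
     partial derivative of f along j'. *)
  pose phi y := f (c *: e_ j' + y) - f y.
  have shiftd y : U (c *: e_ j' + y) ->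
      is_derive y (e_ i') (fun y => f (c *: e_ j' + y)) ('D_(e_ i') f (c *: e_ j' + y)).
    move=> Uy; have [/(_ _ Uy)/derivableP d _] := hf i'.
    have e : (fun h : R => h^-1 *: (((fun y => f (c *: e_ j' + y)) \o shift y) (h *: e_ i') -
        f (c *: e_ j' + y)))
      = (fun h => h^-1 *: ((f \o shift (c *: e_ j' + y)) (h *: e_ i') - f (c *: e_ j' + y))).
      by apply/funext => h /=; rewrite addrCA.
    by case: d => h1 <-; split; rewrite /derivable /derive e.
  have dphi (s : R) : 0 <= s <= 1 -> is_derive ((s * c) *: e_ i' + z) (e_ i') phi
     ('D_(e_ i') f (c *: e_ j' + ((s * c) *: e_ i' + z)) - 'D_(e_ i') f ((s * c) *: e_ i' + z)).
    move=> hs; apply: is_deriveB.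
      by apply: shiftd; rewrite addrCA; have := inU s 1 hs I1; rewrite mul1r.
    apply/derivableP; apply: (hf i').1.
    by have := inU s 0 hs I0; rewrite mul0r scale0r add0r.
  have [s hs e1] := @MVT_coord _ _ phi z c i' (fun s hs => @ex_derive _ _ _ _ _ _ _ (dphi s hs)).
  have dt (t : R) : 0 <= t <= 1 ->
      derivable (fun y => 'D_(e_ i') f y) ((t * c) *: e_ j' + ((s * c) *: e_ i' + z)) (e_ j').
    move=> ht; have [_ [_ /(_ j')[+ _]]] := hf i'; apply.
    by rewrite addrCA; exact: inU.
  have [t ht e2] := @MVT_coord _ _ (fun y => 'D_(e_ i') f y) ((s * c) *: e_ i' + z) c j' dt.
  exists ((t * c) *: e_ j' + ((s * c) *: e_ i' + z)).
    by rewrite addrCA; exact: bnd.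
  rewrite -e2; have [_ e3] := dphi s hs; rewrite -e3 -e1 /phi.
  by rewrite (addrCA (c *: e_ j')); lra.
have lim i' j' : (fun y => 'D_(e_ j') (fun y => 'D_(e_ i') f y) y) y @[y --> z] -->
    'D_(e_ j') (fun y => 'D_(e_ i') f y) z.
  by have [_ [_ /(_ j')[_ [+ _]]]] := hf i'; exact.
apply/eqP; rewrite -subr_eq0 -normr_le0; apply/ler_addgt0Pl => e e0; rewrite addr0.
have h0 : 0 < e / 2 by rewrite divr_gt0.
have : \forall y \near z, `|'D_(e_ j) (fun y => 'D_(e_ i) f y) z -
    'D_(e_ j) (fun y => 'D_(e_ i) f y) y| < e / 2.
  by move/cvgrPdist_lt: (lim i j); exact.
move=> /nbhs_ballP[r1 r10 hr1].
have : \forall y \near z, `|'D_(e_ i) (fun y => 'D_(e_ j) f y) z -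
    'D_(e_ i) (fun y => 'D_(e_ j) f y) y| < e / 2.
  by move/cvgrPdist_lt: (lim j i); exact.
move=> /nbhs_ballP[r2 r20 hr2].
(* The points supplied by [mixed] are at distance at most 2c from z; the divisor 4 puts them inside
   all three balls. *)
pose c := Num.min (Num.min r1 r2) r / 4.
have c0 : 0 < c by rewrite divr_gt0 // !lt_min r10 r20 r0.
have [cr cr1 cr2] : [/\ c + c < r, c + c < r1 & c + c < r2].
  have : Num.min (Num.min r1 r2) r = 4 * c by rewrite mulrC divfK.
  have : Num.min (Num.min r1 r2) r <= r by rewrite ge_min lexx orbT.
  have : Num.min (Num.min r1 r2) r <= r1 by rewrite !ge_min lexx.
  have : Num.min (Num.min r1 r2) r <= r2 by rewrite !ge_min lexx ?orbT.
  by move=> ? ? ? ?; split; lra.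
have [y1 b1 E1] := mixed i j c c0 cr.
have [y2 b2 E2] := mixed j i c c0 cr.
have E : 'D_(e_ j) (fun y => 'D_(e_ i) f y) y1 = 'D_(e_ i) (fun y => 'D_(e_ j) f y) y2.
  have cn0 : c != 0 by rewrite gt_eqF.
  have EE : forall a b : R, c * (c * a) = c * (c * b) -> a = b.
    by move=> a b /(mulfI cn0)/(mulfI cn0).
  apply: EE; apply: (etrans (esym E1)); apply: (etrans _ E2).
  by rewrite (addrCA (c *: e_ i)); clear; lra.
have {hr1}n1 : `|'D_(e_ j) (fun y => 'D_(e_ i) f y) z -
    'D_(e_ j) (fun y => 'D_(e_ i) f y) y1| < e / 2.
  by apply: hr1; rewrite -ball_normE /= distrC; apply: le_lt_trans b1 cr1.
have {hr2}n2 : `|'D_(e_ i) (fun y => 'D_(e_ j) f y) z -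
    'D_(e_ i) (fun y => 'D_(e_ j) f y) y2| < e / 2.
  by apply: hr2; rewrite -ball_normE /= distrC; apply: le_lt_trans b2 cr2.
rewrite E in n1.
exact: dist_half n2 n1.
Qed.

End Schwarz.

(** * A flat function and bump functions on R^n *)

Section FlatFunction.
Context {R : realType}.

(** For p = 1 this is the classical exp(-1/x), extended by 0. The polynomial is a parameter because
    the family p(1/x) exp(-1/x) is closed under differentiation, with p replaced by
    [flat_next p]. *)
Definition flat (p : {poly R}) (x : R) : R :=
  if 0 < x then p.[x^-1] * expR (- x^-1) else 0.

Definition flat_next (p : {poly R}) : {poly R} := (p - p^`()) * 'X^2.

(** With N the size of q, exp y is at least y^(N+1)/(N+1)!, one power more than the bound on |q(y)|.
    The estimate gives differentiability of [flat] at 0. *)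
Lemma horner_expR_bound (q : {poly R}) :
  exists2 C : R, 0 <= C & forall y, 1 <= y -> `|q.[y]| * expR (- y) <= C * y^-1.
Proof.
pose N := size q; pose S := \sum_(i < N) `|q`_i|.
have S0 : 0 <= S by apply: sumr_ge0.
exists (S * (N.+1)`!%:R) => [|y y1]; first by rewrite mulr_ge0.
have y0 : 0 < y by apply: lt_le_trans y1.
have qb : `|q.[y]| <= S * y ^+ N.
  rewrite horner_coef (le_trans (ler_norm_sum _ _ _)) // mulr_suml ler_sum // => i _.
  rewrite normrM ler_wpM2l // normrX ger0_norm ?(ltW y0) //.
  by apply: ler_weXn2l => //; exact: ltnW.
have eb : y ^+ N.+1 / N.+1`!%:R <= expR y.
  by apply: le_trans (expR_ge1Dxn N (ltW y0)); rewrite lerDr.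
rewrite expRN ler_pdivrMr ?expR_gt0 //.
apply: (le_trans qb); rewrite -!mulrA ler_wpM2l //.
have f0 : 0 < N.+1`!%:R :> R by rewrite ltr0n fact_gt0.
move: eb; rewrite ler_pdivrMr // => eb.
by rewrite mulrCA ler_pdivlMl // -exprS mulrC.
Qed.

Lemma is_derive_flat (p : {poly R}) (x : R) :
  is_derive x 1 (flat p) (flat (flat_next p) x).
Proof.
have [x0|x0|->] := ltgtP x 0.
- have near0 : \forall y \near x, cst 0 y = flat p y.
    have oL : open [set y : R | y < 0] by exact: open_lt.
    apply: (near_open oL) => // y /= y0.
    by rewrite /flat ltNge ltW.
  have -> : flat (flat_next p) x = 0 by rewrite /flat ltNge ltW.
  exact: near_eq_is_derive near0 (is_derive_cst _ _ _).
- have xn0 : x != 0 by rewrite gt_eqF.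
  have near0 : \forall y \near x, (fun y => p.[y^-1] * expR (- y^-1)) y = flat p y.
    have oL : open [set y : R | 0 < y] by exact: open_gt.
    by apply: (near_open oL) => // y /= y0; rewrite /flat y0.
  apply: near_eq_is_derive near0 _.
  have di : is_derive x 1 (fun y : R => y^-1) (- x^-1 ^+ 2).
    apply: (is_derive_eq (@is_deriveV R id x 1 1 xn0 (is_derive_id _ _))).
    by rewrite [_ *: 1]mulr1 exprVn.
  have d1 : is_derive x 1 (fun y : R => p.[y^-1]) (p^`().[x^-1] * (- x^-1 ^+ 2)).
    exact: (@is_derive1_comp _ (horner p) (fun y : R => y^-1) x _ _
      (is_derive_poly p x^-1) di).
  have dn : is_derive x 1 (fun y : R => - y^-1) (- - x^-1 ^+ 2) by exact: is_deriveN.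
  have d2 : is_derive x 1 (fun y : R => expR (- y^-1)) (expR (- x^-1) * (- - x^-1 ^+ 2)).
    exact: (@is_derive1_comp _ expR (fun y : R => - y^-1) x _ _ (is_derive_expR (- x^-1)) dn).
  have d3 := is_deriveM d1 d2.
  apply: (is_derive_eq d3).
  rewrite /flat x0 /flat_next !hornerE /GRing.scale /=; ring.
- have -> : flat (flat_next p) 0 = 0 by rewrite /flat ltxx.
  (* The factor 'X absorbs the h^-1 of the difference quotient at 0; the bound is used at y =
     h^-1. *)
  have [C C0 hC] := horner_expR_bound (p * 'X).
  have lim : h^-1 *: ((flat p \o shift 0) (h *: 1) - flat p 0) @[h --> 0^'] --> (0 : R).
    have c1 : 0 < C + 1 by rewrite ltr_wpDl.
    apply/cvgrPdist_le => e e0; near=> h.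
    rewrite /= [h *: 1]mulr1 addr0 sub0r normrN {2}/flat ltxx subr0 /flat.
    case: ifPn => [h0|_]; last by rewrite scaler0 normr0 ltW.
    have h1 : 1 <= h^-1.
      rewrite invr_ge1 ?unitfE ?gt_eqF //.
      by rewrite ltW // -[ltLHS]gtr0_norm //; near: h; exact: dnbhs0_lt.
    have := hC _ h1; rewrite hornerMX invrK => hb.
    rewrite [_ *: _]mulrA [h^-1 * _]mulrC normrM (ger0_norm (expR_ge0 _)).
    apply: (le_trans hb).
    apply: (@le_trans _ _ ((C + 1) * h)).
      by rewrite ler_wpM2r ?(ltW h0) // lerDl.
    rewrite mulrC -ler_pdivlMr // ltW // -[ltLHS]gtr0_norm //.
    by near: h; apply: dnbhs0_lt; exact: divr_gt0.
  split; last exact: (cvg_lim _ lim).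
  apply/cvg_ex; exists 0; exact: lim.
Unshelve. all: by end_near. Qed.

End FlatFunction.

Section Bump.
Context {R : realType} {n : nat}.

Lemma is_Coo_flat (U : set 'rV[R]_n) (f : 'rV[R]_n -> R) :
  open U -> is_Coo U f -> is_Coo U (fun z => flat 1 (f z)).
Proof.
move=> oU hf k.
apply: (@is_Ck_comp1 R n k U (fun j => flat (iter j flat_next 1)) setT f oU
  _ _ (hf k) 0%N) => //.
by move=> j x _; exact: is_derive_flat.
Qed.

Lemma is_CooV (U : set 'rV[R]_n) (f : 'rV[R]_n -> R) :
  open U -> (forall z, U z -> f z != 0) -> is_Coo U f -> is_Coo U (fun z => (f z)^-1).
Proof.
move=> oU f0 hf k.
(* F j is the j-th derivative of x |-> 1/x. *)
pose F j (x : R) := (-1) ^+ j * j`!%:R * x^-1 ^+ j.+1.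
have dF j (x : R) : x != 0 -> is_derive x 1 (F j) (F j.+1 x).
  move=> x0.
  have dV := @is_deriveV R id x 1 1 x0 (is_derive_id _ _).
  have dX : is_derive (x^-1) 1 (fun y : R => y ^+ j.+1) (j.+1%:R * x^-1 ^+ j).
    split; first exact: exprn_derivable.
    by rewrite exp_derive [_ *: 1]mulr1.
  have dC := @is_derive1_comp _ (fun y : R => y ^+ j.+1) (fun y : R => y^-1) x _ _ dX dV.
  have dZ := @is_deriveZ R R R _ ((-1) ^+ j * j`!%:R) x 1 _ dC.
  apply: (is_derive_eq dZ).
  rewrite /F /GRing.scale /= -exprVn factS natrM !exprS expr0; ring.
have := @is_Ck_comp1 R n k U F [set x | x != 0] f oU dF f0 (hf k) 0%N.
by apply: is_Ck_eq => // z _; rewrite /F expr0 expr1 fact0 !mul1r.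
Qed.

Lemma is_CooD (U : set 'rV[R]_n) f h : open U -> is_Coo U f -> is_Coo U h ->
  is_Coo U (fun z => f z + h z).
Proof. by move=> oU hf hh k; apply: is_CkD. Qed.

Lemma is_CooM (U : set 'rV[R]_n) f h : open U -> is_Coo U f -> is_Coo U h ->
  is_Coo U (fun z => f z * h z).
Proof. by move=> oU hf hh k; apply: is_CkM. Qed.

Lemma is_Coo_cst (U : set 'rV[R]_n) (c : R) : is_Coo U (fun=> c).
Proof. by move=> k; apply: is_Ck_cst. Qed.

Lemma is_Coo_coord (U : set 'rV[R]_n) j : is_Coo U (fun z => z 0 j).
Proof. by move=> k; apply: is_Ck_coord. Qed.

Lemma is_Coo_eq (U : set 'rV[R]_n) f h : open U -> (forall z, U z -> f z = h z) ->
  is_Coo U f -> is_Coo U h.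
Proof. by move=> oU fh hf k; apply: is_Ck_eq (hf k). Qed.

Lemma is_Coo_sub (U V : set 'rV[R]_n) f : V `<=` U -> is_Coo U f -> is_Coo V f.
Proof. by move=> VU hf k; apply: is_Ck_sub (hf k). Qed.

Lemma is_Coo_local (U : set 'rV[R]_n) f :
  (forall z, U z -> exists V, V z /\ is_Coo V f) -> is_Coo U f.
Proof.
by move=> h k; apply: is_Ck_local => z /h [V [Vz hV]]; exists V.
Qed.

Lemma flat_gt0 (x : R) : 0 < x -> 0 < flat 1 x.
Proof. by move=> x0; rewrite /flat x0 hornerC mul1r expR_gt0. Qed.

Lemma flat_le0 (x : R) : x <= 0 -> flat 1 x = 0.
Proof. by move=> x0; rewrite /flat ltNge x0. Qed.

Lemma flat_ge0 (x : R) : 0 <= flat 1 x.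
Proof. by have [/flat_le0 ->|/flat_gt0/ltW] := lerP x 0. Qed.

(** In each coordinate, u is positive exactly for |z_i - z0_i| < r and w exactly for |z_i - z0_i| >
    r/2, so u + w never vanishes and u/(u + w) passes from 1 to 0. Since the norm is the maximum
    norm, the product over the coordinates is the required function. *)
Lemma bump (z0 : 'rV[R]_n) (r : R) : 0 < r -> exists b : 'rV[R]_n -> R,
  [/\ is_Coo setT b, forall z, `|z - z0| <= r / 2 -> b z = 1 &
      forall z, r <= `|z - z0| -> b z = 0].
Proof.
move=> r0.
pose q (i : 'I_n) (z : 'rV[R]_n) := (z 0 i - z0 0 i) * (z 0 i - z0 0 i).
have Cq i (a c : R) : is_Coo setT (fun z => a + c * q i z).
  have c1 : is_Coo setT (fun z : 'rV[R]_n => z 0 i - z0 0 i).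
    by apply: is_CooD; [exact: openT|exact: is_Coo_coord|exact: is_Coo_cst].
  apply: is_CooD; [exact: openT|exact: is_Coo_cst|].
  apply: is_CooM; [exact: openT|exact: is_Coo_cst|].
  by apply: is_CooM => //; exact: openT.
pose u i z := flat 1 (r * r + (-1) * q i z).
pose w i z := flat 1 (- (r / 2 * (r / 2)) + 1 * q i z).
have uw0 i z : u i z + w i z != 0.
  rewrite gt_eqF //; have [h|h] := ltrP 0 (r * r + -1 * q i z).
    by rewrite ltr_pwDl ?flat_gt0 ?flat_ge0.
  rewrite ltr_wpDl ?flat_ge0 // flat_gt0 //.
  have : 0 < r * r by rewrite mulr_gt0.
  have -> : r / 2 * (r / 2) = r * r / 4 by field.
  by move: h; move: (q i z) (r * r) => /= s' s; lra.
exists (fun z => \prod_i (u i z * (u i z + w i z)^-1)); split.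
- move=> k; apply: is_Ck_prod => [|i]; first exact: openT.
  have Cu : is_Coo setT (u i) by apply: is_Coo_flat => //; exact: openT.
  have Cw : is_Coo setT (w i) by apply: is_Coo_flat => //; exact: openT.
  apply: is_CooM => //; first exact: openT.
  by apply: is_CooV => //; [exact: openT|apply: is_CooD => //; exact: openT].
- move=> z hz; apply: big1 => i _.
  have /(le_trans (normr_coord _ i)) := hz; rewrite !mxE => hi.
  have qi : q i z <= r / 2 * (r / 2).
    rewrite /q -!expr2 -[leLHS]real_normK ?num_real //.
    by rewrite lerXn2r ?nnegrE // divr_ge0 // ltW.
  have -> : w i z = 0.
    by rewrite /w flat_le0 // mul1r addrC subr_le0.
  rewrite addr0 divff // gt_eqF // flat_gt0 //.
  have : 0 < r * r by rewrite mulr_gt0.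
  have -> : r * r = 4 * (r / 2 * (r / 2)) by field.
  by move: qi; move: (q i z) (r / 2 * (r / 2)) => s' s; lra.
- move=> z hz; have [i hi] : exists i, r <= `|(z - z0) 0 i|.
    apply: contrapT => /forallNP h; move: hz; apply/negP; rewrite -ltNge.
    rewrite [ltLHS]/Num.Def.normr/= mx_normrE; apply: bigmax_lt => // -[i j] _ /=.
    by rewrite (ord1 i) ltNge; apply/negP.
  rewrite (bigD1 i) //= [u i z]flat_le0 ?mul0r //.
  rewrite mulN1r subr_le0 /q -!expr2 -[leRHS]real_normK ?num_real //.
  by move: hi; rewrite !mxE => hi; rewrite lerXn2r ?nnegrE // ltW.
Qed.

End Bump.

(** * Charts, smooth functions and tensor fields *)

Section Charts.
Context {R : realType} {n : nat} {M : manifold R n}.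
Implicit Types (a b c : chart R n M) (U V : set M) (f h : M -> R) (x y : M).
Local Notation e_ i := (delta_mx 0 i : 'rV[R]_n).

Lemma img_open a U : open U -> open (coord a @` (U `&` cdom a)).
Proof.
move=> oU; rewrite openE => z [x [Ux ax] <-]; rewrite /interior.
have ox : (coord a @` cdom a) (coord a x) by exists x.
have n1 : nbhs (coord a x) (coord a @` cdom a).
  exact: open_nbhs_nbhs (conj (cimg_open (c := a)) ox).
have n2 : nbhs (coord a x) (param a @^-1` U).
  have nU : nbhs (param a (coord a x)) U.
    by rewrite (coordK ax); exact: open_nbhs_nbhs (conj oU Ux).
  exact: (param_continuous ox nU).
apply: filterS2 n1 n2 => w [y ay <-] /=; rewrite (coordK ay) => Uy.
by exists y.
Qed.

Lemma near_param a U x (P : M -> Prop) : open U -> U x -> cdom a x ->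
  (forall y, U y -> cdom a y -> P y) -> \forall z \near coord a x, P (param a z).
Proof.
move=> oU Ux ax h.
have ox : (coord a @` (U `&` cdom a)) (coord a x) by exists x.
apply: (near_open (img_open oU) ox).
by move=> z [y [Uy ay] <-]; rewrite (coordK ay); exact: h.
Qed.

Lemma smooth_on_sub U V f : V `<=` U -> smooth_on U f -> smooth_on V f.
Proof.
move=> VU hf a ha; apply: is_Coo_sub (hf a ha).
by move=> z [x [Vx ax] <-]; exists x => //; split=> //; exact: VU.
Qed.

Lemma smooth_on_local U f :
  (forall x, U x -> exists V, V x /\ smooth_on V f) -> smooth_on U f.
Proof.
move=> h a ha; apply: is_Coo_local => z [x [Ux ax] <-].
have [V [Vx hV]] := h x Ux; exists (coord a @` (V `&` cdom a)).
by split; [exists x|exact: hV].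
Qed.

Lemma smooth_on_eq U f h : open U -> (forall x, U x -> f x = h x) ->
  smooth_on U f -> smooth_on U h.
Proof.
move=> oU fh hf a ha; apply: is_Coo_eq (hf a ha); first exact: img_open.
by move=> z [x [Ux ax] <-] /=; rewrite (coordK ax) fh.
Qed.

Lemma smooth_on_cst U (c : R) : smooth_on U (fun=> c : R).
Proof. by move=> a ha; exact: is_Coo_cst. Qed.

Lemma smooth_onD U f h : open U -> smooth_on U f -> smooth_on U h ->
  smooth_on U (fun x => f x + h x).
Proof.
by move=> oU hf hh a ha; apply: is_CooD (hf a ha) (hh a ha); exact: img_open.
Qed.

Lemma smooth_onM U f h : open U -> smooth_on U f -> smooth_on U h ->
  smooth_on U (fun x => f x * h x).
Proof.
by move=> oU hf hh a ha; apply: is_CooM (hf a ha) (hh a ha); exact: img_open.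
Qed.

Lemma smooth_onB U f h : open U -> smooth_on U f -> smooth_on U h ->
  smooth_on U (fun x => f x - h x).
Proof.
move=> oU hf hh; apply: smooth_onD => //.
apply: (smooth_on_eq (f := fun x => -1 * h x)) => // [x _|]; first by rewrite mulN1r.
by apply: smooth_onM => //; exact: smooth_on_cst.
Qed.

Lemma smooth_on_sum (I : Type) (s : seq I) (F : I -> M -> R) U : open U ->
  (forall i, smooth_on U (F i)) -> smooth_on U (fun x => \sum_(i <- s) F i x).
Proof.
move=> oU hF; elim: s => [|i s IH].
  apply: (smooth_on_eq (f := fun=> 0)) => // [x _|]; first by rewrite big_nil.
  exact: smooth_on_cst.
apply: (smooth_on_eq (f := fun x => F i x + \sum_(i <- s) F i x)) => // [x _|].
  by rewrite big_cons.
exact: smooth_onD.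
Qed.

Lemma smooth_on_prod (I : Type) (s : seq I) (F : I -> M -> R) U : open U ->
  (forall i, smooth_on U (F i)) -> smooth_on U (fun x => \prod_(i <- s) F i x).
Proof.
move=> oU hF; elim: s => [|i s IH].
  apply: (smooth_on_eq (f := fun=> 1)) => // [x _|]; first by rewrite big_nil.
  exact: smooth_on_cst.
apply: (smooth_on_eq (f := fun x => F i x * \prod_(i <- s) F i x)) => // [x _|].
  by rewrite big_cons.
exact: smooth_onM.
Qed.

Lemma smooth_onV U f : open U -> (forall x, U x -> f x != 0) -> smooth_on U f ->
  smooth_on U (fun x => (f x)^-1).
Proof.
move=> oU f0 hf a ha; apply: (is_CooV (f := f \o param a)) (hf a ha).
  exact: img_open.
by move=> z [x [Ux ax] <-] /=; rewrite (coordK ax) f0.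
Qed.

(** In any other chart the representative is the given one composed with a transition map, so a
    single chart whose domain contains V decides smoothness. *)
Lemma smooth_on_chart a V f : atlas a -> open V -> V `<=` cdom a ->
  is_Coo (coord a @` V) (f \o param a) -> smooth_on V f.
Proof.
move=> ha oV Va hf b hb.
have eV : V = V `&` cdom a by apply/seteqP; split=> [x Vx|x []] //; split=> //; exact: Va.
have oaV : open (coord a @` V) by rewrite eV; exact: img_open.
have obV : open (coord b @` (V `&` cdom b)) by exact: img_open.
have : is_Coo (coord b @` (V `&` cdom b)) ((f \o param a) \o (fun z => coord a (param b z))).
  apply: (is_Coo_comp obV oaV _ _ hf) => [z [x [Vx bx] <-]|j].
    by exists x => //; rewrite (coordK bx).
  apply: is_Coo_sub (atlas_smooth hb ha j) => z [x [Vx bx] <-].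
  by exists x => //; split=> //; exact: Va.
apply: is_Coo_eq => // z [x [Vx bx] <-] /=.
by rewrite (coordK bx) (coordK (Va _ Vx)).
Qed.

Lemma smooth_on_coord a j : atlas a -> smooth_on (cdom a) (fun y => coord a y 0 j).
Proof.
move=> ha; apply: (smooth_on_chart ha (cdom_open a)) => //.
have o : open (coord a @` cdom a) by exact: cimg_open.
apply: (is_Coo_eq o _ (is_Coo_coord _ j)) => z [x ax <-] /=.
by rewrite (coordK ax).
Qed.

Lemma is_pd a i f U x : atlas a -> U x -> cdom a x -> smooth_on U f ->
  is_derive (coord a x) (e_ i) (f \o param a) (pd a i f x).
Proof.
move=> ha Ux ax hf; apply/derivableP.
by apply: is_Coo_derivable (hf a ha) _; exists x.
Qed.

Lemma pd_eq a i f h U x : open U -> U x -> cdom a x ->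
  (forall y, U y -> f y = h y) -> pd a i f x = pd a i h x.
Proof.
move=> oU Ux ax fh; apply: near_eq_derive.
by apply: (near_param (P := fun y => f y = h y) oU Ux ax) => y Uy _; exact: fh.
Qed.

Lemma pd_cst a i (c : R) x : pd a i (fun=> c) x = 0.
Proof. exact: derive_cst. Qed.

Lemma pdD a i f h U x : atlas a -> U x -> cdom a x -> smooth_on U f -> smooth_on U h ->
  pd a i (fun y => f y + h y) x = pd a i f x + pd a i h x.
Proof.
move=> ha Ux ax hf hh.
have [_ <-] := is_deriveD (is_pd i ha Ux ax hf) (is_pd i ha Ux ax hh).
by [].
Qed.

Lemma pdM a i f h U x : atlas a -> U x -> cdom a x -> smooth_on U f -> smooth_on U h ->
  pd a i (fun y => f y * h y) x = f x * pd a i h x + h x * pd a i f x.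
Proof.
move=> ha Ux ax hf hh.
have := is_deriveM (is_pd i ha Ux ax hf) (is_pd i ha Ux ax hh).
by rewrite /= (coordK ax) => -[_ <-].
Qed.

Lemma pd_sum a i (I : Type) (s : seq I) (F : I -> M -> R) U x : open U ->
  atlas a -> U x -> cdom a x -> (forall k, smooth_on U (F k)) ->
  pd a i (fun y => \sum_(k <- s) F k y) x = \sum_(k <- s) pd a i (F k) x.
Proof.
move=> oU ha Ux ax hF; elim: s => [|k s IH].
  have -> : (fun y => \sum_(k <- [::]) F k y) = fun=> 0.
    by apply/funext => y; rewrite big_nil.
  by rewrite big_nil pd_cst.
rewrite big_cons -IH -(pdD i ha Ux ax (hF k) (smooth_on_sum s oU hF)).
suff -> : (fun y => \sum_(l <- k :: s) F l y) = fun y => F k y + \sum_(l <- s) F l y by [].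
by apply/funext => y; rewrite big_cons.
Qed.

Lemma pd_coord a i j x : cdom a x -> pd a i (fun y => coord a y 0 j) x = (i == j)%:R.
Proof.
move=> ax.
have nr : \forall z \near coord a x, (fun z : 'rV[R]_n => z 0 j) z = coord a (param a z) 0 j.
  have oz : (coord a @` cdom a) (coord a x) by exists x.
  apply: (near_open (cimg_open (c := a)) oz).
  by move=> z [y ay <-]; rewrite (coordK ay).
have [_] := near_eq_is_derive nr (is_derive_coord (coord a x) (e_ i) j).
move=> h; rewrite -[LHS]/('D_(e_ i) (fun z => coord a (param a z) 0 j) (coord a x)).
by rewrite h mxE eq_sym eqxx.
Qed.

Lemma jac_id a x : cdom a x -> jac a a x = 1%:M.
Proof. by move=> ax; apply/matrixP => i j; rewrite !mxE pd_coord. Qed.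

Lemma pd_chain a b i f U x : atlas a -> atlas b -> open U -> U x ->
  cdom a x -> cdom b x -> smooth_on U f ->
  pd a i f x = \sum_j jac a b x i j * pd b j f x.
Proof.
move=> ha hb oU Ux ax bx hf.
pose phi z := coord b (param a z).
have dphi j : is_derive (coord a x) (e_ i) (fun z => phi z 0 j) (jac a b x i j).
  by rewrite mxE; apply: (is_pd i ha bx ax); exact: smooth_on_coord.
have ephi : phi (coord a x) = coord b x by rewrite /phi (coordK ax).
have Vz : (coord b @` (U `&` cdom b)) (phi (coord a x)) by rewrite ephi; exists x.
have := is_derive_chain dphi (img_open oU) Vz (hf b hb 1%N).
rewrite ephi => d.
have nr : \forall z \near coord a x, ((f \o param b) \o phi) z = (f \o param a) z.
  apply: (near_param (P := fun y => (f \o param b) (coord b y) = f y) (cdom_open b) bx ax).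
  by move=> y by_ _ /=; rewrite (coordK by_).
by have [_ <-] := near_eq_is_derive nr d.
Qed.

Lemma jac_mul a b c x : atlas a -> atlas b -> atlas c ->
  cdom a x -> cdom b x -> cdom c x -> jac a b x *m jac b c x = jac a c x.
Proof.
move=> ha hb hc ax bx cx; apply/matrixP => i j; rewrite !mxE.
rewrite (pd_chain i ha hb (cdom_open c) cx ax bx (smooth_on_coord j hc)).
by apply: eq_bigr => k _; rewrite [jac b c x k j]mxE.
Qed.

Lemma smooth_on_pd a i f U : atlas a -> open U -> smooth_on U f ->
  smooth_on (U `&` cdom a) (pd a i f).
Proof.
move=> ha oU hf.
have oV : open (U `&` cdom a) by apply: openI => //; exact: cdom_open.
apply: (smooth_on_chart ha oV) => [x []//|].
have h := is_Coo_derive i (hf a ha).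
apply: (is_Coo_eq (img_open oU) _ h) => z [x [Ux ax] <-] /=.
by rewrite /pd (coordK ax).
Qed.

Lemma smooth_on_jac a b i j : atlas a -> atlas b ->
  smooth_on (cdom b `&` cdom a) (fun x => jac a b x i j).
Proof.
move=> ha hb.
have h := smooth_on_pd i ha (cdom_open b) (smooth_on_coord j hb).
have oV : open (cdom b `&` cdom a) by apply: openI; exact: cdom_open.
by apply: (smooth_on_eq oV _ h) => x _; rewrite mxE.
Qed.

Lemma pd_schwarz a i j f U x : atlas a -> open U -> U x -> cdom a x -> smooth_on U f ->
  pd a i (pd a j f) x = pd a j (pd a i f) x.
Proof.
move=> ha oU Ux ax hf.
have oV := img_open (a := a) oU.
have Vx : (coord a @` (U `&` cdom a)) (coord a x) by exists x.
have e k l : pd a k (pd a l f) x = 'D_(e_ k) (fun z => 'D_(e_ l) (f \o param a) z) (coord a x).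
  have nr : \forall z \near coord a x, pd a l f (param a z) = 'D_(e_ l) (f \o param a) z.
    apply: (near_open oV Vx) => z [y [Uy ay] <-].
    by rewrite /pd (coordK ay).
  exact: (near_eq_derive (e_ k) nr).
by rewrite (e i j) (e j i); exact: schwarz oV Vx (hf a ha 2%N).
Qed.

End Charts.

(** * Components of vector fields and one-forms *)

Section Components.
Context {R : realType} {n : nat} {M : manifold R n}.
Implicit Types (a b c : chart R n M) (U V : set M) (f h : M -> R) (x y : M)
  (X Y : M -> 'rV[R]_n) (al be : M -> 'cV[R]_n).

Lemma chart_atP x : atlas (chart_at x) /\ cdom (chart_at x) x.
Proof. by split; [exact: chart_at_atlas|exact: chart_at_dom]. Qed.

Lemma jacK a b x : atlas a -> atlas b -> cdom a x -> cdom b x ->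
  jac a b x *m jac b a x = 1%:M.
Proof. by move=> ha hb ax bx; rewrite jac_mul // jac_id. Qed.

Lemma vec_in_change a b x v : atlas a -> atlas b -> cdom a x -> cdom b x ->
  vec_in b x v = vec_in a x v *m jac a b x.
Proof.
move=> ha hb ax bx; have [hx dx] := chart_atP x.
by rewrite /vec_in -mulmxA jac_mul.
Qed.

Lemma covec_in_change a b x xi : atlas a -> atlas b -> cdom a x -> cdom b x ->
  covec_in b x xi = jac b a x *m covec_in a x xi.
Proof.
move=> ha hb ax bx; have [hx dx] := chart_atP x.
by rewrite /covec_in mulmxA jac_mul.
Qed.

Lemma vec_in_chart_at x v : vec_in (chart_at x) x v = v.
Proof. by have [hx dx] := chart_atP x; rewrite /vec_in jac_id ?mulmx1. Qed.

Lemma covec_in_chart_at x xi : covec_in (chart_at x) x xi = xi.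
Proof. by have [hx dx] := chart_atP x; rewrite /covec_in jac_id ?mul1mx. Qed.

Lemma covec_ofK a x p : atlas a -> cdom a x -> covec_in a x (covec_of a x p) = p.
Proof.
move=> ha ax; have [hx dx] := chart_atP x.
by rewrite /covec_in /covec_of mulmxA jacK ?mul1mx.
Qed.

Lemma covec_inK a x xi : atlas a -> cdom a x -> covec_of a x (covec_in a x xi) = xi.
Proof.
move=> ha ax; have [hx dx] := chart_atP x.
by rewrite /covec_in /covec_of mulmxA jacK ?mul1mx.
Qed.

Lemma pairing_in a x xi v : atlas a -> cdom a x ->
  pairing xi v = \sum_i vec_in a x v 0 i * covec_in a x xi i 0.
Proof.
move=> ha ax; have [hx dx] := chart_atP x.
transitivity ((vec_in a x v *m covec_in a x xi) 0 0); last by rewrite mxE.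
by rewrite /pairing /vec_in /covec_in mulmxA -(mulmxA v) jacK ?mulmx1.
Qed.

Lemma pairingE (xi : 'cV[R]_n) (v : 'rV[R]_n) : pairing xi v = \sum_i v 0 i * xi i 0.
Proof. by rewrite /pairing mxE. Qed.

Lemma pairingDl xi eta v : pairing (xi + eta : 'cV[R]_n) v = pairing xi v + pairing eta v.
Proof. by rewrite /pairing mulmxDr mxE. Qed.
Lemma pairingZl (c : R) xi v : pairing (c *: xi : 'cV[R]_n) v = c * pairing xi v.
Proof. by rewrite /pairing -scalemxAr mxE. Qed.
Lemma pairingNl xi v : pairing (- xi : 'cV[R]_n) v = - pairing xi v.
Proof. by rewrite /pairing mulmxN mxE. Qed.
Lemma pairingBl xi eta v : pairing (xi - eta : 'cV[R]_n) v = pairing xi v - pairing eta v.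
Proof. by rewrite pairingDl pairingNl. Qed.
Lemma pairingDr (xi : 'cV[R]_n) v w : pairing xi (v + w) = pairing xi v + pairing xi w.
Proof. by rewrite /pairing mulmxDl mxE. Qed.
Lemma pairingZr (c : R) (xi : 'cV[R]_n) v : pairing xi (c *: v) = c * pairing xi v.
Proof. by rewrite /pairing -scalemxAl mxE. Qed.
Lemma pairing0r (xi : 'cV[R]_n) : pairing xi 0 = 0.
Proof. by rewrite /pairing mul0mx mxE. Qed.

Lemma pairing_ext (xi eta : 'cV[R]_n) :
  (forall v, pairing xi v = pairing eta v) -> xi = eta.
Proof.
move=> h; apply/colP => i; have := h (delta_mx 0 i).
by rewrite /pairing -!rowE !mxE.
Qed.

Lemma vf_onP U X a i : atlas a -> open U -> vf_on U X ->
  smooth_on (U `&` cdom a) (fun y => vec_in a y (X y) 0 i).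
Proof.
move=> ha oU hX.
have oV : open (U `&` cdom a) by apply: openI => //; exact: cdom_open.
by apply: (smooth_on_chart ha oV) => [x []//|]; exact: hX.
Qed.

Lemma form_onP U al a i : atlas a -> open U -> form_on U al ->
  smooth_on (U `&` cdom a) (fun y => covec_in a y (al y) i 0).
Proof.
move=> ha oU hal.
have oV : open (U `&` cdom a) by apply: openI => //; exact: cdom_open.
by apply: (smooth_on_chart ha oV) => [x []//|]; exact: hal.
Qed.

Lemma vf_on_local U X : (forall x, U x -> exists a V,
    [/\ atlas a, open V, V x, V `<=` cdom a &
        forall i, smooth_on V (fun y => vec_in a y (X y) 0 i)]) -> vf_on U X.
Proof.
move=> h b hb i; apply: is_Coo_local => z [x [Ux bx] <-].
have [a [V [ha oV Vx Va hV]]] := h x Ux.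
have oW : open (V `&` cdom b) by apply: openI => //; exact: cdom_open.
exists (coord b @` (V `&` cdom b)); split; first by exists x.
have hW : smooth_on (V `&` cdom b) (fun y => vec_in b y (X y) 0 i).
  apply: (smooth_on_eq (f := fun y => \sum_k vec_in a y (X y) 0 k * jac a b y k i) oW).
    by move=> y [Vy by_]; rewrite (vec_in_change _ ha hb (Va _ Vy) by_) [RHS]mxE.
  apply: smooth_on_sum => // k; apply: smooth_onM => //.
    by apply: smooth_on_sub (hV k) => y [].
  by apply: smooth_on_sub (smooth_on_jac k i ha hb) => y [/Va].
by apply: is_Coo_sub (hW b hb) => _ [y [Vy by_] <-]; exists y.
Qed.

Lemma form_on_local U al : (forall x, U x -> exists a V,
    [/\ atlas a, open V, V x, V `<=` cdom a &
        forall i, smooth_on V (fun y => covec_in a y (al y) i 0)]) -> form_on U al.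
Proof.
move=> h b hb i; apply: is_Coo_local => z [x [Ux bx] <-].
have [a [V [ha oV Vx Va hV]]] := h x Ux.
have oW : open (V `&` cdom b) by apply: openI => //; exact: cdom_open.
exists (coord b @` (V `&` cdom b)); split; first by exists x.
have hW : smooth_on (V `&` cdom b) (fun y => covec_in b y (al y) i 0).
  apply: (smooth_on_eq (f := fun y => \sum_k jac b a y i k * covec_in a y (al y) k 0) oW).
    by move=> y [Vy by_]; rewrite (covec_in_change _ ha hb (Va _ Vy) by_) [RHS]mxE.
  apply: smooth_on_sum => // k; apply: smooth_onM => //.
    by apply: smooth_on_sub (smooth_on_jac i k hb ha) => y [/Va].
  by apply: smooth_on_sub (hV k) => y [].
by apply: is_Coo_sub (hW b hb) => _ [y [Vy by_] <-]; exists y.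
Qed.

Lemma vf_on_sub U V X : V `<=` U -> vf_on U X -> vf_on V X.
Proof.
move=> VU hX a ha i; apply: is_Coo_sub (hX a ha i).
by move=> z [x [Vx ax] <-]; exists x => //; split=> //; exact: VU.
Qed.

Lemma form_on_sub U V al : V `<=` U -> form_on U al -> form_on V al.
Proof.
move=> VU hX a ha i; apply: is_Coo_sub (hX a ha i).
by move=> z [x [Vx ax] <-]; exists x => //; split=> //; exact: VU.
Qed.

Lemma chart_nbhs U x : open U -> U x -> exists a V,
  [/\ atlas a, open V, V x, V `<=` cdom a & V = U `&` cdom a].
Proof.
move=> oU Ux; have [hx dx] := chart_atP x.
exists (chart_at x), (U `&` cdom (chart_at x)); split=> [//||//|y [_ ay]|//] //.
by apply: openI => //; exact: cdom_open.
Qed.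

Lemma smooth_on_cover U f : open U ->
  (forall a, atlas a -> smooth_on (U `&` cdom a) f) -> smooth_on U f.
Proof.
move=> oU h; apply: smooth_on_local => x Ux; have [hx dx] := chart_atP x.
by exists (U `&` cdom (chart_at x)); split=> //; exact: h.
Qed.

Lemma vf_on_cover U X : open U -> (forall a i, atlas a ->
    smooth_on (U `&` cdom a) (fun y => vec_in a y (X y) 0 i)) -> vf_on U X.
Proof.
move=> oU h; apply: vf_on_local => x Ux.
have [a [V [ha oV Vx Va eV]]] := chart_nbhs oU Ux.
by exists a, V; split=> // i; rewrite eV; exact: h.
Qed.

Lemma form_on_cover U al : open U -> (forall a i, atlas a ->
    smooth_on (U `&` cdom a) (fun y => covec_in a y (al y) i 0)) -> form_on U al.
Proof.
move=> oU h; apply: form_on_local => x Ux.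
have [a [V [ha oV Vx Va eV]]] := chart_nbhs oU Ux.
by exists a, V; split=> // i; rewrite eV; exact: h.
Qed.

Lemma smooth_on_pairing U al X : open U -> form_on U al -> vf_on U X ->
  smooth_on U (pairing_fun al X).
Proof.
move=> oU hal hX; apply: smooth_on_cover => // a ha.
have oV : open (U `&` cdom a) by apply: openI => //; exact: cdom_open.
apply: (smooth_on_eq (f := fun y => \sum_i vec_in a y (X y) 0 i * covec_in a y (al y) i 0) oV).
  by move=> x [Ux ax]; rewrite /pairing_fun (pairing_in _ _ ha ax).
by apply: smooth_on_sum => // i; apply: smooth_onM => //; [exact: vf_onP|exact: form_onP].
Qed.

Lemma df_in a f U x i : atlas a -> open U -> U x -> cdom a x -> smooth_on U f ->
  covec_in a x (df f x) i 0 = pd a i f x.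
Proof.
move=> ha oU Ux ax hf; have [hx dx] := chart_atP x.
rewrite (pd_chain i ha hx oU Ux ax dx hf) mxE.
by apply: eq_bigr => j _; rewrite [df f x j 0]mxE.
Qed.

Lemma form_on_df U f : open U -> smooth_on U f -> form_on U (df f).
Proof.
move=> oU hf; apply: form_on_cover => // a i ha.
have oV : open (U `&` cdom a) by apply: openI => //; exact: cdom_open.
apply: (smooth_on_eq oV _ (smooth_on_pd i ha oU hf)) => x [Ux ax].
by rewrite (df_in i ha oU Ux ax hf).
Qed.

Lemma actE X f x : act X f x = \sum_i X x 0 i * pd (chart_at x) i f x.
Proof.
by rewrite /act /pairing_fun pairingE; apply: eq_bigr => i _; rewrite mxE.
Qed.

Lemma act_in a X f U x : atlas a -> open U -> U x -> cdom a x -> smooth_on U f ->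
  act X f x = \sum_i vec_in a x (X x) 0 i * pd a i f x.
Proof.
move=> ha oU Ux ax hf; rewrite /act /pairing_fun (pairing_in _ _ ha ax).
by apply: eq_bigr => i _; rewrite (df_in i ha oU Ux ax hf).
Qed.

Lemma smooth_on_act U X f : open U -> vf_on U X -> smooth_on U f ->
  smooth_on U (act X f).
Proof. by move=> oU hX hf; apply: smooth_on_pairing => //; exact: form_on_df. Qed.

Lemma dfM f h U x : open U -> U x -> smooth_on U f -> smooth_on U h ->
  df (fun y => f y * h y) x = f x *: df h x + h x *: df f x.
Proof.
move=> oU Ux hf hh; have [hx dx] := chart_atP x; apply/colP => i; rewrite !mxE.
exact: pdM hx Ux dx hf hh.
Qed.

Lemma dfD f h U x : open U -> U x -> smooth_on U f -> smooth_on U h ->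
  df (fun y => f y + h y) x = df f x + df h x.
Proof.
move=> oU Ux hf hh; have [hx dx] := chart_atP x; apply/colP => i; rewrite !mxE.
exact: pdD hx Ux dx hf hh.
Qed.

Lemma df_eq f h U x : open U -> U x -> (forall y, U y -> f y = h y) -> df f x = df h x.
Proof.
move=> oU Ux fh; have [hx dx] := chart_atP x; apply/colP => i; rewrite !mxE.
exact: pd_eq oU Ux dx fh.
Qed.

Lemma df_cst (c : R) x : df (fun=> c) x = 0.
Proof. by apply/colP => i; rewrite !mxE pd_cst. Qed.

Lemma form_onD U al be : open U -> form_on U al -> form_on U be ->
  form_on U (fun y => al y + be y).
Proof.
move=> oU hal hbe; apply: form_on_cover => // a i ha.
have oV : open (U `&` cdom a) by apply: openI => //; exact: cdom_open.
apply: (smooth_on_eq oV _ (smooth_onD oV (form_onP i ha oU hal) (form_onP i ha oU hbe))).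
by move=> x _; rewrite /covec_in mulmxDr [RHS]mxE.
Qed.

Lemma form_onZ U f al : open U -> smooth_on U f -> form_on U al ->
  form_on U (fun y => f y *: al y).
Proof.
move=> oU hf hal; apply: form_on_cover => // a i ha.
have oV : open (U `&` cdom a) by apply: openI => //; exact: cdom_open.
have hf' : smooth_on (U `&` cdom a) f by apply: smooth_on_sub hf => x [].
apply: (smooth_on_eq oV _ (smooth_onM oV hf' (form_onP i ha oU hal))).
by move=> x _; rewrite /covec_in -scalemxAr [RHS]mxE.
Qed.

Lemma vf_onZ U f X : open U -> smooth_on U f -> vf_on U X ->
  vf_on U (fun y => f y *: X y).
Proof.
move=> oU hf hal; apply: vf_on_cover => // a i ha.
have oV : open (U `&` cdom a) by apply: openI => //; exact: cdom_open.
have hf' : smooth_on (U `&` cdom a) f by apply: smooth_on_sub hf => x [].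
apply: (smooth_on_eq oV _ (smooth_onM oV hf' (vf_onP i ha oU hal))).
by move=> x _; rewrite /vec_in -scalemxAl [RHS]mxE.
Qed.

Lemma form_on0 U : form_on U (fun=> 0 : 'cV[R]_n).
Proof.
move=> a ha i; have -> : (fun x => covec_in a x (0 : 'cV[R]_n) i 0) = fun=> 0.
  by apply/funext => x; rewrite /covec_in mulmx0 mxE.
exact: is_Coo_cst.
Qed.

Lemma form_on_sum (I : Type) (s : seq I) (F : I -> M -> 'cV[R]_n) U : open U ->
  (forall i, form_on U (F i)) -> form_on U (fun y => \sum_(i <- s) F i y).
Proof.
move=> oU hF; elim: s => [|i s IH].
  have -> : (fun y => \sum_(i <- [::]) F i y) = fun=> 0.
    by apply/funext => y; rewrite big_nil.
  exact: form_on0.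
have -> : (fun y => \sum_(k <- i :: s) F k y) = fun y => F i y + \sum_(k <- s) F k y.
  by apply/funext => y; rewrite big_cons.
exact: form_onD.
Qed.

Lemma form_on_dcoord a i : atlas a -> form_on (cdom a) (dcoord a i).
Proof.
move=> ha; apply: form_on_local => x ax; exists a, (cdom a).
split=> // [|j]; first exact: cdom_open.
apply: (smooth_on_eq (f := fun=> (delta_mx i 0 : 'cV[R]_n) j 0) (cdom_open a)).
  by move=> y ay; rewrite /dcoord covec_ofK.
exact: smooth_on_cst.
Qed.

Definition vec_of a x (v : 'rV[R]_n) : 'rV[R]_n := v *m jac a (chart_at x) x.

Lemma vec_ofK a x v : atlas a -> cdom a x -> vec_in a x (vec_of a x v) = v.
Proof.
move=> ha ax; have [hx dx] := chart_atP x.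
by rewrite /vec_in /vec_of -mulmxA jacK ?mulmx1.
Qed.

Lemma vf_on_vec_of a v : atlas a -> vf_on (cdom a) (fun y => vec_of a y v).
Proof.
move=> ha; apply: vf_on_local => x ax; exists a, (cdom a).
split=> // [|j]; first exact: cdom_open.
apply: (smooth_on_eq (f := fun=> v 0 j) (cdom_open a)).
  by move=> y ay; rewrite vec_ofK.
exact: smooth_on_cst.
Qed.

Lemma form_on_covec_of a p : atlas a -> form_on (cdom a) (fun y => covec_of a y p).
Proof.
move=> ha; apply: form_on_local => x ax; exists a, (cdom a).
split=> // [|j]; first exact: cdom_open.
apply: (smooth_on_eq (f := fun=> p j 0) (cdom_open a)).
  by move=> y ay; rewrite covec_ofK.
exact: smooth_on_cst.
Qed.

Lemma covec_of_dcoord a x p : covec_of a x p = \sum_i p i 0 *: dcoord a i x.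
Proof.
rewrite {1}(matrix_sum_delta p) /covec_of mulmx_sumr; apply: eq_bigr => i _.
by rewrite big_ord1 -scalemxAr.
Qed.

End Components.

(** * Bump functions on M and localization of global forms *)

Section Bump.
Context {R : realType} {n : nat} {M : manifold R n}.
Implicit Types (a b c : chart R n M) (U V : set M) (f h : M -> R) (x y : M)
  (X Y : M -> 'rV[R]_n) (al be : M -> 'cV[R]_n).

(** The set C is the image under [param] of a closed ball inside the image of the chart. It is
    compact, hence closed because M is Hausdorff, and this makes the extension by 0 smooth across
    the boundary of the chart domain. *)
Lemma manifold_bump U x : open U -> U x -> exists (f : M -> R) (C : set M),
  [/\ smooth f, closed C, C `<=` U, forall y, ~ C y -> f y = 0 &
      exists V, [/\ open V, V x, V `<=` U & forall y, V y -> f y = 1]].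
Proof.
move=> oU Ux; pose a := chart_at x; have [ha ax] := chart_atP x.
pose z0 := coord a x.
have Vz : (coord a @` (U `&` cdom a)) z0 by exists x.
have [r r0 rV] : exists2 r : R, 0 < r &
    forall z, `|z - z0| <= r -> (coord a @` (U `&` cdom a)) z.
  have /nbhs_ballP[r r0 hr] := open_nbhs_nbhs (conj (img_open oU) Vz).
  exists (r / 2); first exact: divr_gt0.
  move=> z hz; apply: hr; rewrite -ball_normE /= distrC.
  by apply: le_lt_trans hz _; rewrite ltr_pdivrMr // mulr2n mulrDr mulr1 ltrDl.
have [b [sb b1 b0]] := bump z0 r0.
pose K : set 'rV[R]_n := [set z | `|z - z0| <= r].
have cK : closed K.
  have -> : K = closed_ball z0 r.
    by rewrite closed_ballE //; apply/seteqP; split=> z; rewrite /K /closed_ball_ /= distrC.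
  exact: closed_ball_closed.
have bK : bounded_set K.
  exists (`|z0| + r); split; first exact: num_real.
  move=> s hs z Kz; rewrite -(subrK z0 z); apply: le_trans (ler_normD _ _) _.
  by rewrite addrC; apply: le_trans (ltW hs); rewrite lerD2l.
have kK : compact K by exact: bounded_closed_compact.
pose C := param a @` K.
have kC : compact C.
  apply: continuous_compact => //; apply: continuous_in_subspaceT => z.
  rewrite inE => Kz; apply: param_continuous.
  by have [y [_ ay] <-] := rV z Kz; exists y.
have cC : closed C by apply: compact_closed => //; exact: m_hausdorff.
have CU : C `<=` U `&` cdom a.
  by move=> _ [z Kz <-]; have [y [Uy ay] <-] := rV z Kz; rewrite (coordK ay).
pose f y := if `[< cdom a y >] then b (coord a y) else 0.
have fa y : cdom a y -> f y = b (coord a y) by move=> ay; rewrite /f asboolT.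
have f0 y : ~ C y -> f y = 0.
  move=> nC; rewrite /f; case: asboolP => // ay; apply: b0.
  rewrite leNgt; apply/negP => lt; apply: nC; exists (coord a y); first exact: ltW.
  by rewrite (coordK ay).
exists f, C; split=> //.
- apply: smooth_on_local => y _; have [ay|nay] := pselect (cdom a y).
    exists (cdom a); split=> //; apply: (smooth_on_chart ha (cdom_open a)) => //.
    have hs : is_Coo (coord a @` cdom a) b by apply: is_Coo_sub sb.
    apply: (is_Coo_eq (cimg_open (c := a)) _ hs) => z [y' ay' <-] /=.
    by rewrite (coordK ay') (fa _ ay').
  exists (~` C); split; first by move=> /CU [].
  apply: (smooth_on_eq (f := fun=> 0)) => [|y' nC|].
  + exact: closed_openC.
  + by rewrite f0.
  + exact: smooth_on_cst.
- by move=> y /CU [].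
- have oB : open [set z : 'rV[R]_n | `|z - z0| < r / 2].
    have -> : [set z : 'rV[R]_n | `|z - z0| < r / 2] = ball z0 (r / 2).
      by apply/seteqP; rewrite -ball_normE; split=> z /=; rewrite distrC.
    by apply: ball_open; exact: divr_gt0.
  exists (U `&` cdom a `&` (coord a @^-1` [set z : 'rV[R]_n | `|z - z0| < r / 2])).
  split.
  + rewrite openE => y [[Uy ay] hy]; rewrite /interior.
    have n1 : nbhs y (U `&` cdom a).
      by apply: open_nbhs_nbhs; split=> //; apply: openI => //; exact: cdom_open.
    have nB : nbhs (coord a y) [set z : 'rV[R]_n | `|z - z0| < r / 2].
      exact: open_nbhs_nbhs (conj oB hy).
    have n2 := coord_continuous ay nB.
    exact: filterI n1 n2.
  + by split=> //=; rewrite subrr normr0; exact: divr_gt0.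
  + by move=> y [[]].
  + by move=> y [[Uy ay] hy]; rewrite (fa _ ay) b1 //; exact: ltW.
Qed.

Lemma smooth_extend f C U h : open U -> smooth f -> closed C -> C `<=` U ->
  (forall y, ~ C y -> f y = 0) -> smooth_on U h -> smooth (fun y => f y * h y).
Proof.
move=> oU sf cC CU f0 sh; apply: smooth_on_local => x _.
have [Ux|nUx] := pselect (U x).
  by exists U; split=> //; apply: smooth_onM => //; exact: smooth_on_sub sf.
exists (~` C); split; first by move=> /CU.
apply: (smooth_on_eq (f := fun=> 0)) => [|y nC|].
- exact: closed_openC.
- by rewrite f0 // mul0r.
- exact: smooth_on_cst.
Qed.

Lemma form_extend f C U al : open U -> smooth f -> closed C -> C `<=` U ->
  (forall y, ~ C y -> f y = 0) -> form_on U al -> one_form (fun y => f y *: al y).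
Proof.
move=> oU sf cC CU f0 sal; apply: form_on_cover => [|a i ha]; first exact: openT.
rewrite setTI; apply: smooth_on_local => x ax.
have [Ux|nUx] := pselect (U x).
  exists (U `&` cdom a); split=> //.
  have h : form_on U (fun y => f y *: al y).
    by apply: form_onZ => //; exact: smooth_on_sub sf.
  exact: form_onP.
exists (~` C); split; first by move=> /CU.
apply: (smooth_on_eq (f := fun=> 0)) => [|y nC|].
- exact: closed_openC.
- by rewrite f0 // scale0r /covec_in mulmx0 mxE.
- exact: smooth_on_cst.
Qed.

Lemma vf_extend f C U X : open U -> smooth f -> closed C -> C `<=` U ->
  (forall y, ~ C y -> f y = 0) -> vf_on U X -> vector_field (fun y => f y *: X y).
Proof.
move=> oU sf cC CU f0 sal; apply: vf_on_cover => [|a i ha]; first exact: openT.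
rewrite setTI; apply: smooth_on_local => x ax.
have [Ux|nUx] := pselect (U x).
  exists (U `&` cdom a); split=> //.
  have h : vf_on U (fun y => f y *: X y).
    by apply: vf_onZ => //; exact: smooth_on_sub sf.
  exact: vf_onP.
exists (~` C); split; first by move=> /CU.
apply: (smooth_on_eq (f := fun=> 0)) => [|y nC|].
- exact: closed_openC.
- by rewrite f0 // scale0r /vec_in mul0mx mxE.
- exact: smooth_on_cst.
Qed.

(** Identities tested on global vector fields can thereby be read at a point, for an arbitrary
    tangent vector there. *)
Lemma vector_field_through x v : exists2 X : M -> 'rV[R]_n, vector_field X & X x = v.
Proof.
have [ha ax] := chart_atP x.
have [f [C [sf cC CU f0 [V [oV Vx _ fV]]]]] := manifold_bump (cdom_open (chart_at x)) ax.
exists (fun y => f y *: vec_of (chart_at x) y v).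
  exact: vf_extend (cdom_open _) sf cC CU f0 (vf_on_vec_of v ha).
by rewrite fV // scale1r /vec_of jac_id ?mulmx1.
Qed.

(** A bump function times dx^i shows that the set from which [dcoord_ext] is chosen is nonempty, so
    the default 0 does not occur at points of the chart domain. *)
Lemma dcoord_extP a i x : atlas a -> cdom a x ->
  one_form (dcoord_ext a i x) /\ exists V, [/\ open V, V x, V `<=` cdom a &
    forall y, V y -> dcoord_ext a i x y = dcoord a i y].
Proof.
move=> ha ax; rewrite /dcoord_ext.
have [f [C [sf cC CU f0 [V [oV Vx VU fV]]]]] := manifold_bump (cdom_open a) ax.
case: xgetP => [A _ [hA nA]|/(_ (fun y => f y *: dcoord a i y))]; last first.
  case; split; first exact: form_extend (cdom_open _) sf cC CU f0 (form_on_dcoord i ha).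
  by apply: (near_open oV) => // y Vy; rewrite fV // scale1r.
split=> //; move: nA => /nbhs_interior nA.
exists ([set y | A y = dcoord a i y]^° `&` cdom a); split.
- by apply: openI; [exact: open_interior|exact: cdom_open].
- by split=> //; exact: nbhs_singleton nA.
- by move=> y [].
- by move=> y [/interior_subset].
Qed.

Definition form_additive (L : (M -> 'cV[R]_n) -> R) :=
  forall al be, one_form al -> one_form be -> L (fun y => al y + be y) = L al + L be.

Definition form_homogeneous (L : (M -> 'cV[R]_n) -> R) x :=
  forall f al, smooth f -> one_form al -> L (fun y => f y *: al y) = f x * L al.

(* Near x, [al] is a combination of the dx^i; multiplying by a bump function makes
   this an identity between global forms. *)
Lemma form_tensorial (L : (M -> 'cV[R]_n) -> R) a x al :
  form_additive L -> form_homogeneous L x -> atlas a -> cdom a x -> one_form al ->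
  L al = \sum_i covec_in a x (al x) i 0 * L (dcoord_ext a i x).
Proof.
move=> La Lh ha ax hal.
have exW := fun i : 'I_n => (dcoord_extP i ha ax).2.
pose W i := sval (cid (exW i)).
have hW i : [/\ open (W i), W i x, W i `<=` cdom a &
    forall y, W i y -> dcoord_ext a i x y = dcoord a i y].
  by rewrite /W; case: cid.
have : nbhs x [set y | cdom a y /\ forall i, W i y].
  have n1 : nbhs x (cdom a) by exact: open_nbhs_nbhs (conj (cdom_open a) ax).
  have n2 : \forall y \near x, forall i, W i y.
    by apply: filter_forall => i; have [oW wx _ _] := hW i; exact: open_nbhs_nbhs.
  exact: filterI n1 n2.
move=> /nbhs_interior nU; set U := _^° in nU.
have oU : open U by exact: open_interior.
have Ux : U x by exact: nbhs_singleton nU.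
have UW y : U y -> cdom a y /\ forall i, W i y by move=> /interior_subset.
have [f [C [sf cC CU f0 [V [oV Vx VU fV]]]]] := manifold_bump oU Ux.
have L0 : L (fun=> 0) = 0.
  have := Lh (fun=> 0) al (smooth_on_cst setT 0) hal; rewrite mul0r.
  have -> : (fun y => (0 : R) *: al y) = fun=> 0 by apply/funext => y; rewrite scale0r.
  by [].
have Lsum (s : seq 'I_n) (F : 'I_n -> M -> 'cV[R]_n) : (forall i, one_form (F i)) ->
    L (fun y => \sum_(i <- s) F i y) = \sum_(i <- s) L (F i).
  move=> hF; elim: s => [|i s IH].
    rewrite big_nil -[RHS]L0; congr L.
    by apply/funext => y; rewrite big_nil.
  rewrite big_cons -IH -La //; last exact: form_on_sum openT _.
  by congr L; apply/funext => y; rewrite big_cons.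
have fx1 : f x = 1 by apply: fV.
have sc i : smooth (fun y => f y * covec_in a y (al y) i 0).
  apply: (smooth_extend oU sf cC CU f0).
  by apply: smooth_on_sub (form_onP i ha openT hal) => y /UW [].
have e : (fun y => f y *: al y) =
    fun y => \sum_i (f y * covec_in a y (al y) i 0) *: dcoord_ext a i x y.
  apply/funext => y; have [Cy|nC] := pselect (C y); last first.
    by rewrite f0 // scale0r big1 // => i _; rewrite mul0r scale0r.
  have [ay Wy] := UW _ (CU _ Cy).
  rewrite -{1}(covec_inK (al y) ha ay) covec_of_dcoord scaler_sumr.
  apply: eq_bigr => i _; have [_ _ _ ->] := hW i; last exact: Wy.
  by rewrite scalerA.
have eL : L (fun y => f y *: al y) = L al by rewrite Lh // fx1 mul1r.
rewrite -eL e (Lsum _ (fun i y => (f y * covec_in a y (al y) i 0) *: dcoord_ext a i x y)).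
  apply: eq_bigr => i _; rewrite Lh // ?fx1 ?mul1r //.
  exact: (dcoord_extP i ha ax).1.
move=> i; apply: form_onZ => //; [exact: openT|exact: sc|].
exact: (dcoord_extP i ha ax).1.
Qed.

End Bump.

(** * The bundle map g *)

Section SmoothMatrices.
Context {R : realType} {n : nat} {M : manifold R n}.

Lemma smooth_on_det k (V : set M) (A : M -> 'M[R]_k) : open V ->
  (forall i j, smooth_on V (fun y => A y i j)) -> smooth_on V (fun y => \det (A y)).
Proof.
move=> oV hA; rewrite /determinant; apply: smooth_on_sum => // s.
by apply: smooth_onM => //; [exact: smooth_on_cst|exact: smooth_on_prod].
Qed.

(** By Cramer's rule the entries are cofactors divided by the determinant, hence polynomials in
    smooth functions over a nowhere vanishing smooth function. *)
Lemma smooth_on_invmx k (V : set M) (A : M -> 'M[R]_k) : open V ->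
  (forall y, V y -> A y \in unitmx) ->
  (forall i j, smooth_on V (fun y => A y i j)) ->
  forall i j, smooth_on V (fun y => invmx (A y) i j).
Proof.
move=> oV uA hA i j.
apply: (smooth_on_eq (f := fun y => (\det (A y))^-1 *
    ((-1) ^+ (j + i) * \det (row' j (col' i (A y)))))) => //.
  by move=> y Vy; rewrite /invmx uA // !mxE /cofactor.
apply: smooth_onM => //.
  apply: smooth_onV => //; last exact: smooth_on_det.
  by move=> y /uA; rewrite unitmxE unitfE.
apply: smooth_onM => //; first exact: smooth_on_cst.
apply: (smooth_on_det (A := fun y => row' j (col' i (A y)))) => // i' j'.
by apply: (smooth_on_eq oV _ (hA (lift j i') (lift i j'))) => y _; rewrite !mxE.
Qed.

End SmoothMatrices.

Section Sharp.
Context {R : realType} {n : nat} {M : manifold R n} (S : sub_riemannian M).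
Implicit Types (x y : M) (xi eta : 'cV[R]_n) (v w : 'rV[R]_n).
Local Notation Q := (sr_Q S).
Local Notation h := (sr_h S).

Let hm := h_metric S.

Lemma Q_frame x : exists (U : set M) (F : M -> 'M[R]_(sr_rank S, n)),
  [/\ open U, U x, forall i, vf_on U (fun y => row i (F y)),
      forall y, U y -> row_free (F y) &
      forall y v, U y -> Q y v <-> (v <= F y)%MS].
Proof.
have [U [F [oU Ux hF hQ]]] := @Q_distribution _ _ _ S x.
exists U, F; split=> // [y Uy|y v Uy]; first by have [] := hQ y Uy.
by have [_ ->] := hQ y Uy.
Qed.

Lemma Q_lin x c v w : Q x v -> Q x w -> Q x (c *: v + w).
Proof.
have [U [F [_ Ux _ _ hQ]]] := Q_frame x.
by rewrite !hQ // => hv hw; rewrite addmx_sub ?scalemx_sub.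
Qed.

Lemma Q0 x : Q x 0.
Proof. by have [U [F [_ Ux _ _ hQ]]] := Q_frame x; rewrite hQ // sub0mx. Qed.

Lemma QB x v w : Q x v -> Q x w -> Q x (v - w).
Proof. by move=> hv hw; rewrite addrC -scaleN1r; exact: Q_lin. Qed.

Lemma h0l x w : Q x w -> h x 0 w = 0.
Proof.
move=> hw; have := metric_lin hm 1 (Q0 x) (Q0 x) hw.
by rewrite scaler0 addr0 mul1r => /eqP; rewrite -subr_eq subrr => /eqP <-.
Qed.

Lemma hBl x u v w : Q x u -> Q x v -> Q x w -> h x (u - v) w = h x u w - h x v w.
Proof.
move=> hu hv hw; have := metric_lin hm (-1) hv hu hw.
by rewrite scaleN1r mulN1r addrC [RHS]addrC.
Qed.

Lemma h_eq0 x v : Q x v -> h x v v = 0 -> v = 0.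
Proof.
move=> hv h0; apply/eqP/negPn/negP => v0.
by have := metric_pos hm hv v0; rewrite h0 ltxx.
Qed.

Definition gram k (F : M -> 'M[R]_(k, n)) x : 'M[R]_k :=
  \matrix_(i, j) h x (row i (F x)) (row j (F x)).

Lemma h_gram k (F : M -> 'M[R]_(k, n)) x (c d : 'rV[R]_k) :
  (forall v, Q x v <-> (v <= F x)%MS) ->
  h x (c *m F x) (d *m F x) = (c *m gram F x *m d^T) 0 0.
Proof.
move=> hQ.
have rQ i : Q x (row i (F x)) by apply/hQ; exact: row_sub.
have sQ (s : seq 'I_k) (e : 'rV[R]_k) : Q x (\sum_(i <- s) e 0 i *: row i (F x)).
  elim: s => [|i s IH]; first by rewrite big_nil; exact: Q0.
  by rewrite big_cons; exact: Q_lin.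
have l1 (s : seq 'I_k) (e : 'rV[R]_k) w : Q x w ->
    h x (\sum_(i <- s) e 0 i *: row i (F x)) w = \sum_(i <- s) e 0 i * h x (row i (F x)) w.
  move=> hw; elim: s => [|i s IH]; first by rewrite !big_nil h0l.
  by rewrite !big_cons (metric_lin hm) // IH.
rewrite (mulmx_sum_row c (F x)) (mulmx_sum_row d (F x)) l1 // -mulmxA mxE.
apply: eq_bigr => i _; congr (_ * _).
rewrite (metric_sym hm) // l1 // mxE; apply: eq_bigr => j _.
by rewrite !mxE mulrC (metric_sym hm).
Qed.

Lemma gram_unit k (F : M -> 'M[R]_(k, n)) x : row_free (F x) ->
  (forall v, Q x v <-> (v <= F x)%MS) -> gram F x \in unitmx.
Proof.
move=> fF hQ; rewrite -row_free_unit; apply: inj_row_free => v v0.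
have hv : Q x (v *m F x) by apply/hQ; exact: submxMl.
have : v *m F x = 0.
  by apply: (h_eq0 hv); rewrite h_gram // v0 mul0mx mxE.
by move=> /eqP; rewrite mulmx_free_eq0 // => /eqP.
Qed.

(** In a frame F, raising an index amounts to solving a linear system with the Gram matrix. The
    closed formula serves twice: it shows that [g] is not a default value, and that [g] maps smooth
    forms to smooth fields. *)
Lemma sharp_exists x xi k (F : M -> 'M[R]_(k, n)) : row_free (F x) ->
  (forall v, Q x v <-> (v <= F x)%MS) ->
  let v := (F x *m xi)^T *m invmx (gram F x) *m F x in
  Q x v /\ forall w, Q x w -> h x v w = pairing xi w.
Proof.
move=> fF hQ v; have uG := gram_unit fF hQ.
split; first by apply/hQ; exact: submxMl.
move=> w /hQ/submxP[d ->]; rewrite h_gram // mulmxKV // /pairing -trmx_mul mxE.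
by rewrite mulmxA.
Qed.

Lemma gP x xi : Q x (g S x xi) /\ forall w, Q x w -> h x (g S x xi) w = pairing xi w.
Proof.
have [U [F [_ Ux _ fF hQ]]] := Q_frame x.
have := sharp_exists xi (fF x Ux) (fun v => hQ x v Ux); rewrite /g.
by case: xgetP => // + /= hv; move/(_ _ hv).
Qed.

Lemma g_in x xi : Q x (g S x xi). Proof. exact: (gP x xi).1. Qed.

Lemma h_g x xi w : Q x w -> h x (g S x xi) w = pairing xi w.
Proof. exact: (gP x xi).2. Qed.

Lemma g_unique x xi v : Q x v -> (forall w, Q x w -> h x v w = pairing xi w) ->
  g S x xi = v.
Proof.
move=> hv hw; apply/eqP; rewrite -subr_eq0; apply/eqP.
have hd : Q x (g S x xi - v) by apply: QB => //; exact: g_in.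
by apply: (h_eq0 hd); rewrite hBl // ?h_g ?hw ?subrr //; exact: g_in.
Qed.

Lemma g_lin x c xi eta : g S x (c *: xi + eta) = c *: g S x xi + g S x eta.
Proof.
apply: g_unique => [|w hw]; first by apply: Q_lin; exact: g_in.
by rewrite (metric_lin hm) ?h_g ?pairingDl ?pairingZl //; exact: g_in.
Qed.

Lemma gD x xi eta : g S x (xi + eta) = g S x xi + g S x eta.
Proof. by have := g_lin x 1 xi eta; rewrite !scale1r. Qed.

Lemma g0 x : g S x 0 = 0.
Proof. by apply: g_unique => [|w hw]; [exact: Q0|rewrite h0l // /pairing mulmx0 mxE]. Qed.

Lemma gZ x c xi : g S x (c *: xi) = c *: g S x xi.
Proof. by have := g_lin x c xi 0; rewrite g0 !addr0. Qed.

Lemma gbar_h x xi eta : gbar S x xi eta = h x (g S x eta) (g S x xi).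
Proof. by rewrite /gbar h_g //; exact: g_in. Qed.

Lemma gbarC x xi eta : gbar S x xi eta = gbar S x eta xi.
Proof. by rewrite !gbar_h (metric_sym hm) //; exact: g_in. Qed.

Lemma gbar_ge0 x xi : 0 <= gbar S x xi xi.
Proof.
rewrite gbar_h; have [->|n0] := eqVneq (g S x xi) 0.
  by rewrite h0l //; exact: Q0.
by apply: ltW; apply: (metric_pos hm) => //; exact: g_in.
Qed.

Lemma gbarDl x xi xi' eta : gbar S x (xi + xi') eta = gbar S x xi eta + gbar S x xi' eta.
Proof. by rewrite /gbar gD pairingDr. Qed.

Lemma gbarDr x xi eta eta' : gbar S x xi (eta + eta') = gbar S x xi eta + gbar S x xi eta'.
Proof. by rewrite /gbar pairingDl. Qed.

Lemma gbarZl x c xi eta : gbar S x (c *: xi) eta = c * gbar S x xi eta.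
Proof. by rewrite /gbar gZ pairingZr. Qed.

Lemma gbarZr x c xi eta : gbar S x xi (c *: eta) = c * gbar S x xi eta.
Proof. by rewrite /gbar pairingZl. Qed.

Lemma annihilator_g x xi : annihilator (Q x) xi <-> g S x xi = 0.
Proof.
split=> [hxi|g0' w hw]; last by rewrite -(h_g xi hw) g0' h0l.
by apply: g_unique => [|w hw]; [exact: Q0|rewrite h0l // hxi].
Qed.

Lemma vf_on_gf U al : open U -> form_on U al -> vf_on U (gf S al).
Proof.
move=> oU hal; apply: vf_on_local => x Ux.
have [W [F [oW Wx hF fF hQ]]] := Q_frame x.
have oUW : open (U `&` W) by exact: openI.
have UWx : (U `&` W) x by [].
have [a [V [ha oV Vx Va eV]]] := chart_nbhs oUW UWx.
exists a, V; split=> // i.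
have VU : V `<=` U by rewrite eV => y [[]].
have VW : V `<=` W by rewrite eV => y [[]].
have sF j : vf_on V (fun y => row j (F y)) by exact: vf_on_sub (hF j).
have sxi l : smooth_on V (fun y => (F y *m al y) l 0).
  have halV : form_on V al by exact: form_on_sub hal.
  apply: (smooth_on_eq oV _ (smooth_on_pairing oV halV (sF l))) => y _.
  by rewrite /pairing_fun /pairing -row_mul mxE.
have sgram j l : smooth_on V (fun y => gram F y j l).
  have hmet := metric_smooth hm oV (sF j) (sF l).
  apply: (smooth_on_eq oV (f := fun y => h y (row j (F y)) (row l (F y)))).
    by move=> y _; rewrite mxE.
  by apply: hmet => y /VW Wy; split; apply/(hQ y _ Wy); exact: row_sub.
have uG y (Vy : V y) := gram_unit (fF y (VW _ Vy)) (fun v => hQ y v (VW _ Vy)).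
have sinv := smooth_on_invmx oV uG sgram.
apply: (smooth_on_eq (f := fun y => \sum_j (\sum_l (F y *m al y) l 0 * invmx (gram F y) l j) *
    vec_in a y (row j (F y)) 0 i)) => //.
  move=> y Vy; have Wy := VW _ Vy.
  have [q1 q2] := sharp_exists (al y) (fF y Wy) (fun v => hQ y v Wy).
  rewrite /gf (g_unique q1 q2) /vec_in (mulmx_sum_row _ (F y)) mulmx_suml summxE.
  apply: eq_bigr => j _; rewrite -scalemxAl [RHS]mxE; congr (_ * _).
  by rewrite mxE; apply: eq_bigr => l _; rewrite [X in _ = X * _]mxE.
apply: smooth_on_sum => // j; apply: smooth_onM => //.
  by apply: smooth_on_sum => // l; apply: smooth_onM.
have := vf_onP i ha oV (sF j); apply: smooth_on_sub => y Vy.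
by split=> //; exact: Va.
Qed.

End Sharp.

(** * Lie derivatives and the symmetric bracket *)

Section LieCalculus.
Context {R : realType} {n : nat} {M : manifold R n}.
Implicit Types (a b c : chart R n M) (U V : set M) (f h : M -> R) (x y : M)
  (X Y : M -> 'rV[R]_n) (al be : M -> 'cV[R]_n).

Lemma act_eq X U f h x : open U -> U x -> (forall y, U y -> f y = h y) ->
  act X f x = act X h x.
Proof. by move=> oU Ux fh; rewrite /act /pairing_fun (df_eq oU Ux fh). Qed.

Lemma actM X U f h x : open U -> U x -> smooth_on U f -> smooth_on U h ->
  act X (fun y => f y * h y) x = f x * act X h x + h x * act X f x.
Proof.
by move=> oU Ux hf hh; rewrite /act /pairing_fun (dfM oU Ux hf hh) pairingDl !pairingZl.
Qed.

Lemma actD X U f h x : open U -> U x -> smooth_on U f -> smooth_on U h ->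
  act X (fun y => f y + h y) x = act X f x + act X h x.
Proof.
by move=> oU Ux hf hh; rewrite /act /pairing_fun (dfD oU Ux hf hh) pairingDl.
Qed.

Lemma act_cst X (c : R) x : act X (fun=> c) x = 0.
Proof. by rewrite /act /pairing_fun df_cst /pairing mulmx0 mxE. Qed.

Lemma act_sum X U (I : Type) (s : seq I) (F : I -> M -> R) x : open U -> U x ->
  (forall k, smooth_on U (F k)) ->
  act X (fun y => \sum_(k <- s) F k y) x = \sum_(k <- s) act X (F k) x.
Proof.
move=> oU Ux hF; elim: s => [|k s IH].
  have -> : (fun y => \sum_(k <- [::]) F k y) = fun=> 0.
    by apply/funext => y; rewrite big_nil.
  by rewrite act_cst big_nil.
rewrite big_cons -IH -(actD X oU Ux (hF k) (smooth_on_sum s oU hF)).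
suff -> : (fun y => \sum_(l <- k :: s) F l y) = fun y => F k y + \sum_(l <- s) F l y by [].
by apply/funext => y; rewrite big_cons.
Qed.

Lemma act_coord a X x i : atlas a -> cdom a x ->
  act X (fun y => coord a y 0 i) x = vec_in a x (X x) 0 i.
Proof.
move=> ha ax; rewrite (act_in _ ha (cdom_open a) ax ax (smooth_on_coord i ha)).
rewrite (bigD1 i) //= pd_coord // eqxx mulr1 big1 ?addr0 // => j ji.
by rewrite pd_coord // (negbTE ji) mulr0.
Qed.

Lemma dcoord_df a i y : atlas a -> cdom a y -> dcoord a i y = df (fun z => coord a z 0 i) y.
Proof.
move=> ha ay; rewrite -[RHS](covec_inK _ ha ay) /dcoord; congr covec_of.
apply/colP => j; rewrite (df_in j ha (cdom_open a) ay ay (smooth_on_coord i ha)).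
by rewrite pd_coord // mxE eqxx andbT.
Qed.

(** This Leibniz rule characterizes the Lie derivative invariantly and links the coordinate formulas
    of [lie_form] and [lie_bracket]: the terms be_i Y(X^i) that they contain cancel. *)
Lemma act_pairing U X Y be x : open U -> U x -> vf_on U X -> vf_on U Y -> form_on U be ->
  act X (pairing_fun be Y) x =
  pairing (lie_form X be x) (Y x) + pairing (be x) (lie_bracket X Y x).
Proof.
move=> oU Ux hX hY hbe; set a := chart_at x; have [ha ax] := chart_atP x.
have oV : open (U `&` cdom a) by apply: openI => //; exact: cdom_open.
have Vx : (U `&` cdom a) x by [].
have sY i := vf_onP i ha oU hY; have sX i := vf_onP i ha oU hX.
have sb i := form_onP i ha oU hbe.
have e y : (U `&` cdom a) y -> pairing_fun be Y y =
    \sum_i vec_in a y (Y y) 0 i * covec_in a y (be y) i 0.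
  by move=> [Uy ay]; rewrite /pairing_fun (pairing_in _ _ ha ay).
rewrite (act_eq X oV Vx e) (act_sum X _ oV Vx (fun i => smooth_onM oV (sY i) (sb i))).
rewrite !pairingE.
under eq_bigr => i _ do rewrite (actM X oV Vx (sY i) (sb i)) vec_in_chart_at covec_in_chart_at.
rewrite big_split /=.
under [X in _ = X + _]eq_bigr => i _ do rewrite mxE mulrDr.
under [X in _ = _ + X]eq_bigr => i _ do rewrite mxE mulrBl.
rewrite [X in _ = X + _]big_split [X in _ = _ + X]big_split /= sumrN.
rewrite addrACA -[LHS]addr0; congr (_ + _).
  by congr (_ + _); apply: eq_bigr => i _; rewrite mulrC.
apply/esym/eqP; rewrite subr_eq0; apply/eqP.
under eq_bigr => i _ do rewrite mulr_sumr.
rewrite exchange_big; apply: eq_bigr => i _; rewrite actE mulr_suml.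
by apply: eq_bigr => j _; rewrite mulrCA [LHS]mulrC.
Qed.

Lemma act_act U X Y f x : let a := chart_at x in
  open U -> U x -> vf_on U X -> vf_on U Y -> smooth_on U f ->
  act X (act Y f) x = \sum_j (Y x 0 j * (\sum_k X x 0 k * pd a k (pd a j f) x) +
    pd a j f x * act X (fun y => vec_in a y (Y y) 0 j) x).
Proof.
move=> a oU Ux hX hY hf; have [ha ax] := chart_atP x.
have oV : open (U `&` cdom a) by apply: openI => //; exact: cdom_open.
have Vx : (U `&` cdom a) x by [].
have sY i := vf_onP i ha oU hY; have sp i := smooth_on_pd i ha oU hf.
have e y : (U `&` cdom a) y -> act Y f y = \sum_i vec_in a y (Y y) 0 i * pd a i f y.
  by move=> [Uy ay]; rewrite (act_in _ ha oU Uy ay hf).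
rewrite (act_eq X oV Vx e) (act_sum X _ oV Vx (fun i => smooth_onM oV (sY i) (sp i))).
apply: eq_bigr => i _; rewrite (actM X oV Vx (sY i) (sp i)) vec_in_chart_at.
by rewrite [act X (pd a i f) x]actE.
Qed.

(** The second-order terms of X(Y f) and Y(X f), isolated in [act_act], cancel by the symmetry of
    second derivatives. *)
Lemma act_lie_bracket U X Y f x : open U -> U x -> vf_on U X -> vf_on U Y -> smooth_on U f ->
  act (lie_bracket X Y) f x = act X (act Y f) x - act Y (act X f) x.
Proof.
move=> oU Ux hX hY hf; have [ha ax] := chart_atP x.
rewrite (act_act oU Ux hX hY hf) (act_act oU Ux hY hX hf) -sumrB actE.
under [RHS]eq_bigr => j _ do rewrite opprD addrACA.
rewrite big_split /= -[LHS]add0r; congr (_ + _).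
  apply/esym/eqP; rewrite sumrB subr_eq0; apply/eqP.
  under eq_bigr => j _ do rewrite mulr_sumr.
  rewrite exchange_big; apply: eq_bigr => k _; rewrite mulr_sumr.
  apply: eq_bigr => j _; rewrite mulrCA.
  by rewrite (pd_schwarz j k ha oU Ux ax hf).
by apply: eq_bigr => j _; rewrite mxE -mulrBr mulrC.
Qed.

(** The bracket is computed at y in the chart chosen at y, so its smoothness is not visible from the
    definition. Its i-th component in a fixed chart is its action on the coordinate x^i, a
    difference of iterated derivatives along smooth fields. *)
Lemma vf_on_lie_bracket U X Y : open U -> vf_on U X -> vf_on U Y ->
  vf_on U (lie_bracket X Y).
Proof.
move=> oU hX hY; apply: vf_on_cover => // a i ha.
have oV : open (U `&` cdom a) by apply: openI => //; exact: cdom_open.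
have hX' : vf_on (U `&` cdom a) X by apply: vf_on_sub hX => y [].
have hY' : vf_on (U `&` cdom a) Y by apply: vf_on_sub hY => y [].
have sc : smooth_on (U `&` cdom a) (fun y => coord a y 0 i).
  by apply: smooth_on_sub (smooth_on_coord i ha) => y [].
have s1 := smooth_on_act oV hX' (smooth_on_act oV hY' sc).
have s2 := smooth_on_act oV hY' (smooth_on_act oV hX' sc).
apply: (smooth_on_eq oV _ (smooth_onB oV s1 s2)) => y Vy; have [Uy ay] := Vy.
by rewrite -(act_coord _ _ ha ay) (act_lie_bracket oV Vy hX' hY' sc).
Qed.

Lemma lie_form_df U X f x : open U -> U x -> vf_on U X -> smooth_on U f ->
  lie_form X (df f) x = df (act X f) x.
Proof.
move=> oU Ux hX hf; set a := chart_at x; have [ha ax] := chart_atP x.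
have oV : open (U `&` cdom a) by apply: openI => //; exact: cdom_open.
have Vx : (U `&` cdom a) x by [].
have sX i := vf_onP i ha oU hX; have sp i := smooth_on_pd i ha oU hf.
apply/colP => j; rewrite !mxE -/a.
have e1 y : (U `&` cdom a) y -> covec_in a y (df f y) j 0 = pd a j f y.
  by move=> [Uy ay]; rewrite (df_in j ha oU Uy ay hf).
rewrite (act_eq X oV Vx e1) actE -/a.
have e2 y : (U `&` cdom a) y -> act X f y = \sum_i vec_in a y (X y) 0 i * pd a i f y.
  by move=> [Uy ay]; rewrite (act_in _ ha oU Uy ay hf).
rewrite (pd_eq j oV Vx ax e2).
rewrite (pd_sum j _ oV ha Vx ax (fun i => smooth_onM oV (sX i) (sp i))) -big_split /=.
apply: eq_bigr => i _; rewrite (pdM j ha Vx ax (sX i) (sp i)) vec_in_chart_at mxE -/a.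
by rewrite (pd_schwarz i j ha oU Ux ax hf).
Qed.

Lemma lie_form_eq U X X' be be' x : open U -> U x -> (forall y, U y -> X y = X' y) ->
  (forall y, U y -> be y = be' y) -> lie_form X be x = lie_form X' be' x.
Proof.
move=> oU Ux eX eb; have [ha ax] := chart_atP x; apply/colP => j; rewrite !mxE.
rewrite (eb x Ux); congr (_ + _).
  rewrite (act_eq X oU Ux (h := fun y => covec_in (chart_at x) y (be' y) j 0)) => [|y /eb ->//].
  by rewrite !actE eX.
apply: eq_bigr => i _; congr (_ * _).
by apply: (pd_eq _ oU Ux ax) => y /eX ->.
Qed.

Lemma lie_formZl U f X be x : open U -> U x -> smooth_on U f -> vf_on U X ->
  lie_form (fun y => f y *: X y) be x =
  f x *: lie_form X be x + pairing (be x) (X x) *: df f x.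
Proof.
move=> oU Ux hf hX; set a := chart_at x; have [ha ax] := chart_atP x.
have Vx : (U `&` cdom a) x by [].
have sX i := vf_onP i ha oU hX.
have sf : smooth_on (U `&` cdom a) f by apply: smooth_on_sub hf => y [].
apply/colP => j; rewrite !mxE -/a mulrDr -addrA; congr (_ + _).
  by rewrite !actE mulr_sumr; apply: eq_bigr => i _; rewrite mxE mulrA.
rewrite pairingE mulr_sumr mulr_suml -big_split /=; apply: eq_bigr => i _.
have -> : (fun y => vec_in a y (f y *: X y) 0 i) = fun y => f y * vec_in a y (X y) 0 i.
  by apply/funext => y; rewrite /vec_in -scalemxAl mxE.
rewrite (pdM j ha Vx ax sf (sX i)) vec_in_chart_at; ring.
Qed.

Lemma lie_formZr U f X be x : open U -> U x -> smooth_on U f -> form_on U be ->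
  lie_form X (fun y => f y *: be y) x = f x *: lie_form X be x + act X f x *: be x.
Proof.
move=> oU Ux hf hb; set a := chart_at x; have [ha ax] := chart_atP x.
have oV : open (U `&` cdom a) by apply: openI => //; exact: cdom_open.
have Vx : (U `&` cdom a) x by [].
have sb i := form_onP i ha oU hb.
have sf : smooth_on (U `&` cdom a) f by apply: smooth_on_sub hf => y [].
apply/colP => j; rewrite !mxE -/a.
have -> : (fun y => covec_in a y (f y *: be y) j 0) = fun y => f y * covec_in a y (be y) j 0.
  by apply/funext => y; rewrite /covec_in -scalemxAr mxE.
rewrite (actM X oV Vx sf (sb j)) covec_in_chart_at mulrDr addrAC [be x j 0 * _]mulrC.
congr (_ + _ + _); rewrite mulr_sumr; apply: eq_bigr => i _.
by rewrite mxE mulrA.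
Qed.

Lemma lie_formDl U X X' be x : open U -> U x -> vf_on U X -> vf_on U X' ->
  lie_form (fun y => X y + X' y) be x = lie_form X be x + lie_form X' be x.
Proof.
move=> oU Ux hX hX'; set a := chart_at x; have [ha ax] := chart_atP x.
have Vx : (U `&` cdom a) x by [].
have sX i := vf_onP i ha oU hX; have sX' i := vf_onP i ha oU hX'.
apply/colP => j; rewrite !mxE -/a addrACA; congr (_ + _).
  by rewrite !actE -big_split /=; apply: eq_bigr => i _; rewrite mxE mulrDl.
rewrite -big_split /=; apply: eq_bigr => i _.
have -> : (fun y => vec_in a y (X y + X' y) 0 i) =
    fun y => vec_in a y (X y) 0 i + vec_in a y (X' y) 0 i.
  by apply/funext => y; rewrite /vec_in mulmxDl mxE.
by rewrite (pdD j ha Vx ax (sX i) (sX' i)) mulrDr.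
Qed.

Lemma lie_formDr U X be be' x : open U -> U x -> form_on U be -> form_on U be' ->
  lie_form X (fun y => be y + be' y) x = lie_form X be x + lie_form X be' x.
Proof.
move=> oU Ux hb hb'; set a := chart_at x; have [ha ax] := chart_atP x.
have oV : open (U `&` cdom a) by apply: openI => //; exact: cdom_open.
have Vx : (U `&` cdom a) x by [].
have sb i := form_onP i ha oU hb; have sb' i := form_onP i ha oU hb'.
apply/colP => j; rewrite !mxE -/a addrACA.
have -> : (fun y => covec_in a y (be y + be' y) j 0) =
    fun y => covec_in a y (be y) j 0 + covec_in a y (be' y) j 0.
  by apply/funext => y; rewrite /covec_in mulmxDr mxE.
rewrite (actD X oV Vx (sb j) (sb' j)); congr (_ + _).
by rewrite -big_split /=; apply: eq_bigr => i _; rewrite mxE mulrDl.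
Qed.

Lemma lie_form_cartan U X eta x : open U -> U x -> vf_on U X -> form_on U eta ->
  lie_form X eta x = interior X (dform eta) x + df (pairing_fun eta X) x.
Proof.
move=> oU Ux hX he; set a := chart_at x; have [ha ax] := chart_atP x.
have oV : open (U `&` cdom a) by apply: openI => //; exact: cdom_open.
have Vx : (U `&` cdom a) x by [].
have sX i := vf_onP i ha oU hX; have se i := form_onP i ha oU he.
have e y : (U `&` cdom a) y -> pairing_fun eta X y =
    \sum_i vec_in a y (X y) 0 i * covec_in a y (eta y) i 0.
  by move=> [Uy ay]; rewrite /pairing_fun (pairing_in _ _ ha ay).
apply/colP => j; rewrite !mxE -/a (pd_eq j oV Vx ax e).
rewrite (pd_sum j _ oV ha Vx ax (fun i => smooth_onM oV (sX i) (se i))) actE -/a.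
rewrite -!big_split /=; apply: eq_bigr => i _.
rewrite (pdM j ha Vx ax (sX i) (se i)) vec_in_chart_at covec_in_chart_at mxE -/a; ring.
Qed.

End LieCalculus.

Section SymmetricBracket.
Context {R : realType} {n : nat} {M : manifold R n} (S : sub_riemannian M).
Implicit Types (a : chart R n M) (f : M -> R) (x : M) (al be : M -> 'cV[R]_n).

(** In its use below, p is the value of gbar(al, be) and d is df: the extra term of the Lie
    derivative along f g(al) is cancelled by that of the differential of f gbar(al, be), and only
    the derivation term with c survives. *)
Lemma leibniz_termsE (f p c : R) (u v d w e : 'cV[R]_n) :
  f *: u + p *: d + (f *: v + c *: w) - (f *: e + p *: d) = f *: (u + v - e) + c *: w.
Proof. by apply/colP => i; rewrite !mxE; ring. Qed.

Lemma additive_termsE (u u' v v' w w' : 'cV[R]_n) :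
  u + u' + (v + v') - (w + w') = (u + v - w) + (u' + v' - w').
Proof. by apply/colP => i; rewrite !mxE; ring. Qed.

Lemma smooth_on_gbarf U al be : open U -> form_on U al -> form_on U be ->
  smooth_on U (gbarf S al be).
Proof.
move=> oU hal hbe.
exact: (smooth_on_pairing oU hbe (vf_on_gf S oU hal)).
Qed.

Lemma sym_bracketC al be x : sym_bracket S al be x = sym_bracket S be al x.
Proof.
rewrite /sym_bracket (addrC (lie_form (gf S al) be x)).
suff -> : gbarf S al be = gbarf S be al by [].
by apply/funext => y; rewrite /gbarf gbarC.
Qed.

Lemma sym_bracketZl f al be x : smooth f -> one_form al -> one_form be ->
  sym_bracket S (fun y => f y *: al y) be x =
  f x *: sym_bracket S al be x + act (gf S be) f x *: al x.
Proof.
move=> hf hal hbe; rewrite /sym_bracket.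
have oT : open (setT : set M) by exact: openT.
have hg := vf_on_gf S oT hal.
have -> : gf S (fun y => f y *: al y) = fun y => f y *: gf S al y.
  by apply/funext => y; rewrite /gf gZ.
have -> : gbarf S (fun y => f y *: al y) be = fun y => f y * gbarf S al be y.
  by apply/funext => y; rewrite /gbarf gbarZl.
rewrite (lie_formZl be oT _ hf hg) // (lie_formZr _ oT _ hf hal) //.
rewrite (dfM oT _ hf (smooth_on_gbarf oT hal hbe)) //.
exact: leibniz_termsE.
Qed.

Lemma sym_bracketDl al al' be x : one_form al -> one_form al' -> one_form be ->
  sym_bracket S (fun y => al y + al' y) be x =
  sym_bracket S al be x + sym_bracket S al' be x.
Proof.
move=> hal hal' hbe; rewrite /sym_bracket.
have oT : open (setT : set M) by exact: openT.
have -> : gf S (fun y => al y + al' y) = fun y => gf S al y + gf S al' y.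
  by apply/funext => y; rewrite /gf gD.
have -> : gbarf S (fun y => al y + al' y) be = fun y => gbarf S al be y + gbarf S al' be y.
  by apply/funext => y; rewrite /gbarf gbarDl.
rewrite (lie_formDl be oT _ (vf_on_gf S oT hal) (vf_on_gf S oT hal')) //.
rewrite (lie_formDr _ oT _ hal hal') //.
rewrite (dfD oT (I : setT x) (smooth_on_gbarf oT hal hbe) (smooth_on_gbarf oT hal' hbe)).
exact: additive_termsE.
Qed.

Lemma sym_bracket_dcoord a i k x : atlas a -> cdom a x ->
  sym_bracket S (dcoord_ext a i x) (dcoord_ext a k x) x =
  df (fun y => g_coef S a y i k) x.
Proof.
move=> ha ax.
have [hA [V [oV Vx Va eA]]] := dcoord_extP i ha ax.
have [hB [W [oW Wx Wa eB]]] := dcoord_extP k ha ax.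
have oU : open (V `&` W) by exact: openI.
have Ux : (V `&` W) x by [].
have term j l (A B : M -> 'cV[R]_n) : one_form A -> one_form B ->
    (forall y, (V `&` W) y -> A y = dcoord a j y) ->
    (forall y, (V `&` W) y -> B y = dcoord a l y) ->
    lie_form (gf S A) B x = df (fun y => g_coef S a y j l) x.
  move=> sA sB hA' hB'.
  have e1 y : (V `&` W) y -> B y = df (fun z => coord a z 0 l) y.
    by move=> Uy; rewrite hB' // dcoord_df //; apply: Va; case: Uy.
  have sc : smooth_on (V `&` W) (fun z => coord a z 0 l).
    by apply: smooth_on_sub (smooth_on_coord l ha) => y [/Va].
  have sg : vf_on (V `&` W) (gf S A).
    by apply: vf_on_gf => //; exact: form_on_sub sA.
  rewrite (lie_form_eq oU Ux (fun y _ => erefl (gf S A y)) e1).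
  rewrite (lie_form_df oU Ux sg sc); apply: (df_eq oU Ux) => y Uy.
  by rewrite /act /pairing_fun -e1 // hB' // /gf hA'.
have eA' y : (V `&` W) y -> dcoord_ext a i x y = dcoord a i y by move=> [/eA].
have eB' y : (V `&` W) y -> dcoord_ext a k x y = dcoord a k y by move=> [_ /eB].
rewrite /sym_bracket (term _ _ _ _ hA hB eA' eB') (term _ _ _ _ hB hA eB' eA').
have -> : (fun y => g_coef S a y k i) = fun y => g_coef S a y i k.
  by apply/funext => y; rewrite /g_coef gbarC.
(* Each of the two Lie derivatives and the differential of gbar equals d g^ik at x, so one copy
   remains. *)
rewrite -addrA [X in _ + X](_ : _ = 0) ?addr0 //; apply/eqP; rewrite subr_eq0; apply/eqP.
by apply: (df_eq oU Ux) => y Uy; rewrite /gbarf eA' // eB'.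
Qed.

End SymmetricBracket.

(** * Normal connections *)

Section QuadraticForms.
Context {R : realType} {n : nat}.

Lemma quad_sum (B : 'M[R]_n) (p : 'cV[R]_n) :
  (p^T *m B *m p) 0 0 = \sum_i \sum_k B i k * p i 0 * p k 0.
Proof.
rewrite mxE exchange_big; apply: eq_bigr => k _; rewrite mxE mulr_suml.
by apply: eq_bigr => i _; rewrite mxE [p i 0 * _]mulrC.
Qed.

(** Christoffel symbols need not be symmetric in their upper indices, and both normality and the
    geodesic field see only the symmetric part. Evaluation at sums of basis vectors is the
    polarization. *)
Lemma quad_eq0 (B : 'M[R]_n) :
  (forall p : 'cV[R]_n, (p^T *m B *m p) 0 0 = 0) <-> B + B^T = 0.
Proof.
split=> [h|h p].
  apply/matrixP => i k.
  have b j l : ((delta_mx j 0 : 'cV[R]_n)^T *m B *m (delta_mx l 0 : 'cV[R]_n)) 0 0 = B j l.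
    by rewrite trmx_delta -rowE -colE !mxE.
  have := h (delta_mx i 0 + delta_mx k 0).
  have -> : (delta_mx i 0 + delta_mx k 0 : 'cV[R]_n)^T =
      (delta_mx i 0 : 'cV[R]_n)^T + (delta_mx k 0 : 'cV[R]_n)^T.
    by apply/matrixP => ? ?; rewrite !mxE.
  have ad (u w : 'M[R]_1) : (u + w) 0 0 = u 0 0 + w 0 0 by rewrite mxE.
  rewrite !mulmxDl !mulmxDr !ad !b.
  have := h (delta_mx i 0); have := h (delta_mx k 0); rewrite !b => -> ->.
  by rewrite add0r addr0 !mxE.
have : (p^T *m (B + B^T) *m p) 0 0 = 0 by rewrite h mulmx0 mul0mx mxE.
rewrite mulmxDr mulmxDl mxE.
have -> : (p^T *m B^T *m p) 0 0 = (p^T *m B *m p) 0 0.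
  have -> : p^T *m B^T *m p = (p^T *m B *m p)^T.
    by rewrite !trmx_mul trmxK mulmxA.
  by rewrite mxE.
by move=> /eqP; rewrite -mulr2n mulrn_eq0 /= => /eqP.
Qed.

Lemma is_derive_quadratic m k (f : 'M[R]_(m, k) -> R) z v (l c : R) :
  (forall t : R, f (t *: v + z) = f z + t * l + t * t * c) -> is_derive z v f l.
Proof.
move=> h.
have lim : (fun t : R => t^-1 *: ((f \o shift z) (t *: v) - f z)) @ 0^' --> l.
  have lim0 : (fun t : R => l + t * c) @ 0^' --> l.
    have e : l = l + 0 * c by rewrite mul0r addr0.
    rewrite {2}e; apply: cvgD; first exact: cvg_cst.
    by apply: cvgM; [exact: nbhs_dnbhs|exact: cvg_cst].
  apply: cvg_trans lim0; apply: near_eq_cvg; near=> t.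
  have t0 : t != 0 by near: t; exact: nbhs_dnbhs_neq.
  rewrite /= h -[t^-1 *: _]/(t^-1 * _); field.
  exact: t0.
by split; [apply/cvg_ex; eexists; exact: lim|exact: (cvg_lim _ lim)].
Unshelve. all: by end_near. Qed.

End QuadraticForms.

(** * The Hamiltonian vector field in coordinates *)

Section Fields.
Context {R : realType} {n : nat} {M : manifold R n} (S : sub_riemannian M).
Implicit Types (a : chart R n M) (x : M) (p : 'cV[R]_n).

Lemma gbar_covec_of a x p q : gbar S x (covec_of a x p) (covec_of a x q) =
  \sum_i \sum_k g_coef S a x i k * p i 0 * q k 0.
Proof.
have r (s : seq 'I_n) xi : gbar S x xi (\sum_(k <- s) q k 0 *: dcoord a k x) =
    \sum_(k <- s) q k 0 * gbar S x xi (dcoord a k x).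
  elim: s => [|k s IH]; first by rewrite !big_nil gbarC /gbar g0 pairing0r.
  by rewrite !big_cons gbarDr gbarZr IH.
have l (s : seq 'I_n) eta : gbar S x (\sum_(k <- s) p k 0 *: dcoord a k x) eta =
    \sum_(k <- s) p k 0 * gbar S x (dcoord a k x) eta.
  elim: s => [|k s IH]; first by rewrite !big_nil /gbar g0 pairing0r.
  by rewrite !big_cons gbarDl gbarZl IH.
rewrite !covec_of_dcoord l; apply: eq_bigr => i _; rewrite r mulr_sumr.
by apply: eq_bigr => k _; rewrite /g_coef; set G := gbar _ _ _ _; ring.
Qed.

Lemma g_coefC a x i k : g_coef S a x i k = g_coef S a x k i.
Proof. exact: gbarC. Qed.

Lemma smooth_on_g_coef a i k : atlas a -> smooth_on (cdom a) (fun y => g_coef S a y i k).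
Proof.
move=> ha; apply: smooth_on_gbarf; first exact: cdom_open.
  exact: form_on_dcoord.
exact: form_on_dcoord.
Qed.

Lemma X_H_fst a x p : (X_H S a x p).1 = \row_i \sum_j g_coef S a x i j * p j 0.
Proof.
apply/rowP => i; rewrite !mxE; apply: derive_val.
apply: (@is_derive_quadratic _ _ _ _ _ _ _ (2^-1 * g_coef S a x i i)) => t.
rewrite /sr_hamiltonian.
have -> : covec_of a x (t *: delta_mx i 0 + p) = t *: dcoord a i x + covec_of a x p.
  by rewrite /dcoord /covec_of mulmxDr -scalemxAr.
rewrite gbarDl !gbarDr !gbarZl !gbarZr (gbarC _ _ (dcoord a i x)).
have -> : gbar S x (covec_of a x p) (dcoord a i x) = \sum_j g_coef S a x i j * p j 0.
  rewrite /dcoord gbar_covec_of; apply: eq_bigr => j _.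
  rewrite (bigD1 i) //= mxE !eqxx mulr1 big1 ?addr0 1?g_coefC // => l li.
  by rewrite mxE (negbTE li) mulr0.
rewrite /g_coef; set s := \sum_j _; set u := gbar _ _ _ _; set w := gbar _ _ _ _.
by field.
Qed.

Lemma X_H_snd a x p j : atlas a -> cdom a x -> (X_H S a x p).2 j 0 =
  - (2^-1 * \sum_i \sum_k pd a j (fun y => g_coef S a y i k) x * p i 0 * p k 0).
Proof.
move=> ha ax; rewrite mxE; congr (- _).
have oV := cdom_open a.
have sg i k := smooth_on_g_coef i k ha.
have sc c := smooth_on_cst (M := M) (cdom a) c.
have st i k : smooth_on (cdom a) (fun y => g_coef S a y i k * p i 0 * p k 0).
  exact: smooth_onM oV (smooth_onM oV (sg i k) (sc _)) (sc _).
have -> : (fun y => sr_hamiltonian S y (covec_of a y p)) =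
    fun y => 2^-1 * \sum_i \sum_k g_coef S a y i k * p i 0 * p k 0.
  by apply/funext => y; rewrite /sr_hamiltonian gbar_covec_of.
have ss i : smooth_on (cdom a) (fun y => \sum_k g_coef S a y i k * p i 0 * p k 0).
  exact: smooth_on_sum oV (st i).
rewrite (pdM j ha ax ax (sc 2^-1) (smooth_on_sum _ oV ss)) pd_cst mulr0 addr0.
congr (_ * _); rewrite (pd_sum j _ oV ha ax ax ss); apply: eq_bigr => i _.
rewrite (pd_sum j _ oV ha ax ax (st i)); apply: eq_bigr => k _.
rewrite (pdM j ha ax ax (smooth_onM oV (sg i k) (sc _)) (sc _)) pd_cst mulr0 add0r.
by rewrite (pdM j ha ax ax (sg i k) (sc _)) pd_cst mulr0 add0r mulrC [p i 0 * _]mulrC.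
Qed.

End Fields.

(** * Normality as the vanishing of a tensor *)

Section Defect.
Context {R : realType} {n : nat} {M : manifold R n} (S : sub_riemannian M)
  (nabla : (M -> 'cV[R]_n) -> (M -> 'cV[R]_n) -> M -> 'cV[R]_n)
  (hnabla : g_connection S nabla).
Implicit Types (a : chart R n M) (f : M -> R) (x : M) (al be : M -> 'cV[R]_n)
  (X : M -> 'rV[R]_n).

(* The tensor T. *)
Definition defect al be x : 'cV[R]_n :=
  nabla al be x + nabla be al x - sym_bracket S al be x.

Lemma nabla0 be x : one_form be -> nabla (fun=> 0) be x = 0.
Proof.
move=> hbe.
have := gc_linear hnabla (smooth_on_cst setT 1) (form_on0 setT) (form_on0 setT) hbe x.
have -> : (fun _ : M => (1 : R) *: (0 : 'cV[R]_n) + 0) = fun=> 0.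
  by apply/funext => y; rewrite scaler0 addr0.
by rewrite scale1r => /eqP; rewrite -subr_eq subrr => /eqP <-.
Qed.

Lemma nablaZ f al be x : smooth f -> one_form al -> one_form be ->
  nabla (fun y => f y *: al y) be x = f x *: nabla al be x.
Proof.
move=> hf hal hbe; have := gc_linear hnabla hf hal (form_on0 setT) hbe x.
have -> : (fun y => f y *: al y + 0) = fun y => f y *: al y.
  by apply/funext => y; rewrite addr0.
by rewrite nabla0 // addr0.
Qed.

Lemma nablaD al al' be x : one_form al -> one_form al' -> one_form be ->
  nabla (fun y => al y + al' y) be x = nabla al be x + nabla al' be x.
Proof.
move=> hal hal' hbe; have := gc_linear hnabla (smooth_on_cst setT 1) hal hal' hbe x.
have -> : (fun y => (1 : R) *: al y + al' y) = fun y => al y + al' y.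
  by apply/funext => y; rewrite scale1r.
by rewrite scale1r.
Qed.

Lemma defectC al be x : defect al be x = defect be al x.
Proof. by rewrite /defect sym_bracketC (addrC (nabla al be x)). Qed.

Lemma defectD al al' be x : one_form al -> one_form al' -> one_form be ->
  defect (fun y => al y + al' y) be x = defect al be x + defect al' be x.
Proof.
move=> hal hal' hbe; rewrite /defect nablaD // (gc_additive hnabla) //.
by rewrite sym_bracketDl // additive_termsE.
Qed.

Lemma defectZ f al be x : smooth f -> one_form al -> one_form be ->
  defect (fun y => f y *: al y) be x = f x *: defect al be x.
Proof.
move=> hf hal hbe; rewrite /defect nablaZ // (gc_leibniz hnabla) // sym_bracketZl //.
have sh (u v w z : 'cV[R]_n) (s c : R) :
    s *: u + (s *: v + c *: z) - (s *: w + c *: z) = s *: (u + v - w).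
  by apply/colP => i; rewrite !mxE; ring.
exact: sh.
Qed.

Lemma defect_local a x : atlas a -> cdom a x ->
  (forall i k, defect (dcoord_ext a i x) (dcoord_ext a k x) x = 0) ->
  forall al be, one_form al -> one_form be -> defect al be x = 0.
Proof.
move=> ha ax h al be hal hbe.
have hA i := (dcoord_extP i ha ax).1.
have tens be' : one_form be' -> (forall i, defect (dcoord_ext a i x) be' x = 0) ->
    forall al', one_form al' -> defect al' be' x = 0.
  move=> hbe' h' al' hal'; apply/colP => j.
  have La : form_additive (fun al => defect al be' x j 0).
    by move=> ga ga' ? ?; rewrite defectD // mxE.
  have Lh : form_homogeneous (fun al => defect al be' x j 0) x.
    by move=> f ga ? ?; rewrite defectZ // mxE.
  rewrite [RHS]mxE (form_tensorial La Lh ha ax hal'); apply: big1 => i _.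
  by rewrite h' [X in _ * X]mxE mulr0.
apply: (tens) => // i; rewrite defectC; apply: (tens) => // k; exact: h.
Qed.

(** Tensoriality lets normality be treated one point at a time, which suits curves through covectors
    at a given point. *)
Definition normal_at x :=
  forall al be, one_form al -> one_form be -> defect al be x = 0.

(** Let B j be the matrix with entries Gamma^ik_j - 1/2 d_j g^ik. The j-th components of the defect
    on coordinate forms are the entries of B j plus its transpose, while the momentum components of
    the two fields differ by the quadratic form of B j; [quad_eq0] compares the two. The position
    components always agree. *)
Lemma normal_at_geodesic_field a x : atlas a -> cdom a x ->
  (normal_at x <-> forall p, geodesic_field S nabla a x p = X_H S a x p).
Proof.
move=> ha ax.
have hA i := (dcoord_extP i ha ax).1.
pose B (j : 'I_n) : 'M[R]_n := \matrix_(i, k) (christoffel nabla a x i k j -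
   2^-1 * pd a j (fun y => g_coef S a y i k) x).
have eB i k j : covec_in a x (defect (dcoord_ext a i x) (dcoord_ext a k x) x) j 0 =
    (B j + (B j)^T) i k.
  have cB (u v w : 'cV[R]_n) : covec_in a x (u + v - w) j 0 =
      covec_in a x u j 0 + covec_in a x v j 0 - covec_in a x w j 0.
    by rewrite /covec_in mulmxBr mulmxDr [LHS]mxE [X in X + _]mxE [X in _ + X]mxE.
  have eg : (fun y => g_coef S a y k i) = fun y => g_coef S a y i k.
    by apply/funext => y; rewrite g_coefC.
  rewrite /defect sym_bracket_dcoord // cB.
  rewrite (df_in j ha (cdom_open a) ax ax (smooth_on_g_coef S i k ha)).
  have -> : (B j + (B j)^T) i k = B j i k + B j k i by rewrite mxE [X in _ + X]mxE.
  have BE l m : B j l m = christoffel nabla a x l m j -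
      2^-1 * pd a j (fun y => g_coef S a y l m) x by rewrite mxE.
  rewrite !BE eg -/(christoffel nabla a x i k j) -/(christoffel nabla a x k i j).
  set s1 := christoffel _ _ _ _ _ _; set s2 := christoffel _ _ _ _ _ _; set s3 := pd _ _ _ _.
  by field.
have eN : normal_at x <-> forall j, B j + (B j)^T = 0.
  split=> [h j|h].
    by apply/matrixP => i k; rewrite -eB h // /covec_in mulmx0 !mxE.
  apply: (defect_local ha ax) => i k.
  rewrite -[LHS](covec_inK _ ha ax).
  have -> : covec_in a x (defect (dcoord_ext a i x) (dcoord_ext a k x) x) = 0.
    by apply/colP => j; rewrite eB h !mxE.
  by rewrite /covec_of mulmx0.
have eF p j : (X_H S a x p).2 j 0 - (geodesic_field S nabla a x p).2 j 0 =
    (p^T *m B j *m p) 0 0.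
  rewrite X_H_snd // mxE quad_sum opprK mulr_sumr addrC -sumrB; apply: eq_bigr => i _.
  rewrite mulr_sumr -sumrB; apply: eq_bigr => k _; rewrite mxE.
  by rewrite !mulrBl !mulrA.
rewrite eN; split=> h.
  move=> p; rewrite [LHS]surjective_pairing [RHS]surjective_pairing; congr (_, _).
    by rewrite X_H_fst.
  apply/colP => j; apply/eqP; rewrite eq_sym -subr_eq0 eF; apply/eqP.
  exact: (quad_eq0 (B j)).2 (h j) p.
by move=> j; apply/quad_eq0 => p; rewrite -eF h subrr.
Qed.

Lemma normalP : normal_connection S nabla <-> forall x, normal_at x.
Proof.
split=> h.
  by move=> x al be hal hbe; rewrite /defect h // subrr.
move=> al be hal hbe x; apply/eqP; rewrite -subr_eq0; apply/eqP; exact: h.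
Qed.

Lemma normal_diag : normal_connection S nabla <->
  forall al, one_form al -> forall x, nabla al al x = 2^-1 *: sym_bracket S al al x.
Proof.
have two : (2 : R) != 0 by [].
rewrite normalP; split=> h.
  move=> al hal x; have /eqP := h x al al hal hal; rewrite subr_eq0 => /eqP <-.
  have half (u : 'cV[R]_n) : u = 2^-1 *: (u + u).
    by apply/colP => i; rewrite !mxE; field.
  exact: half.
have d0 al x : one_form al -> defect al al x = 0.
  move=> hal; rewrite /defect h //.
  have half (u : 'cV[R]_n) : 2^-1 *: u + 2^-1 *: u - u = 0.
    by apply/colP => i; rewrite !mxE; field.
  exact: half.
move=> x al be hal hbe.
have oT : open (setT : set M) by exact: openT.
have hs := form_onD oT hal hbe.
have := d0 _ x hs; rewrite defectD // ![defect _ (fun y => _ + _) x]defectC !defectD //.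
have half (A B C D : 'cV[R]_n) : A = 0 -> D = 0 -> B = C -> A + B + (C + D) = 0 -> C = 0.
  move=> -> -> ->; rewrite add0r addr0 -mulr2n => /eqP.
  by rewrite -scaler_nat scaler_eq0 (negbTE two) /= => /eqP.
exact: half (d0 al x hal) (d0 be x hbe) (defectC be al x).
Qed.

(** The right-hand side is linear over functions in be, since the term g(al)(f) <be, X> arises twice
    with opposite signs. By [form_tensorial] it is therefore the pairing of be with a vector at each
    point, and this witness justifies the choice made in [nabla_vf]. *)
Lemma nabla_vfP al be X x : one_form al -> one_form be -> vector_field X ->
  pairing_fun be (nabla_vf S nabla al X) x =
  act (gf S al) (pairing_fun be X) x - pairing_fun (nabla al be) X x.
Proof.
move=> hal hbe hX; rewrite /nabla_vf.
have oT : open (setT : set M) by exact: openT.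
case: xgetP => [Z _ hZ|]; first exact: hZ.
pose L be' y := act (gf S al) (pairing_fun be' X) y - pairing_fun (nabla al be') X y.
pose Z y := vec_of (chart_at y) y (\row_i L (dcoord_ext (chart_at y) i y) y).
move/(_ Z); case=> be' hbe' y; have [ha ay] := chart_atP y.
have La : form_additive (L^~ y).
  move=> b1 b2 h1 h2; rewrite /L.
  have -> : pairing_fun (fun z => b1 z + b2 z) X =
      fun z => pairing_fun b1 X z + pairing_fun b2 X z.
    by apply/funext => z; rewrite /pairing_fun pairingDl.
  rewrite (actD _ oT (I : setT y) (smooth_on_pairing oT h1 hX) (smooth_on_pairing oT h2 hX)).
  by rewrite /pairing_fun (gc_additive hnabla) // pairingDl opprD addrACA.
have Lh : form_homogeneous (L^~ y) y.
  move=> f b hf hb; rewrite /L.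
  have -> : pairing_fun (fun z => f z *: b z) X = fun z => f z * pairing_fun b X z.
    by apply/funext => z; rewrite /pairing_fun pairingZl.
  rewrite (actM _ oT (I : setT y) hf (smooth_on_pairing oT hb hX)).
  rewrite /pairing_fun (gc_leibniz hnabla) // pairingDl !pairingZl.
  set s := act _ f y; set u := pairing (b y) _; set w := pairing (nabla al b y) _.
  set v := act _ _ y; ring.
rewrite -[RHS]/(L be' y) (form_tensorial La Lh ha ay hbe') /pairing_fun.
rewrite (pairing_in _ _ ha ay) vec_ofK //.
by apply: eq_bigr => i _; rewrite mxE mulrC.
Qed.

(** Rewriting g(al)<be, X> and g(be)<al, X> by [act_pairing] produces exactly the two bracket terms;
    what remains is the defect paired with X. *)
Lemma nabla_vf_defect al be X x : one_form al -> one_form be -> vector_field X ->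
  pairing_fun be (nabla_vf S nabla al X) x + pairing_fun al (nabla_vf S nabla be X) x -
  (pairing_fun be (lie_bracket (gf S al) X) x + pairing_fun al (lie_bracket (gf S be) X) x +
   act X (gbarf S al be) x) = - pairing (defect al be x) (X x).
Proof.
move=> hal hbe hX.
have oT : open (setT : set M) by exact: openT.
have ga := vf_on_gf S oT hal; have gb := vf_on_gf S oT hbe.
rewrite !nabla_vfP // (act_pairing oT (I : setT x) ga hX hbe).
rewrite (act_pairing oT (I : setT x) gb hX hal) /pairing_fun.
have pE (u v l l' d : 'cV[R]_n) w : pairing (u + v - (l + l' - d)) w =
    pairing u w + pairing v w - (pairing l w + pairing l' w - pairing d w).
  by rewrite (pairingBl (u + v)) pairingBl !pairingDl.
rewrite /defect /sym_bracket pE /act /pairing_fun.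
have sh (b1 b2 l1 l2 n1 n2 d : R) :
  l1 + b1 - n1 + (l2 + b2 - n2) - (b1 + b2 + d) = - (n1 + n2 - (l1 + l2 - d)) by ring.
exact: sh.
Qed.

Lemma normal_nabla_vf : normal_connection S nabla <->
  forall al be X, one_form al -> one_form be -> vector_field X -> forall x,
    pairing_fun be (nabla_vf S nabla al X) x + pairing_fun al (nabla_vf S nabla be X) x =
    pairing_fun be (lie_bracket (gf S al) X) x + pairing_fun al (lie_bracket (gf S be) X) x +
    act X (gbarf S al be) x.
Proof.
rewrite normalP; split=> h.
  move=> al be X hal hbe hX x; apply/eqP; rewrite -subr_eq0 nabla_vf_defect //.
  by rewrite h // /pairing mulmx0 mxE oppr0.
move=> x al be hal hbe; apply: pairing_ext => v.
have [X hX <-] := vector_field_through x v.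
transitivity (0 : R); last by rewrite /pairing mulmx0 mxE.
by apply: oppr_inj; rewrite oppr0 -nabla_vf_defect // h // subrr.
Qed.

Lemma normal_geodesic_field : normal_connection S nabla <->
  eq_cot_field (geodesic_field S nabla) (X_H S).
Proof.
rewrite normalP; split=> h.
  by move=> a x p ha ax; apply: (normal_at_geodesic_field ha ax).1 (h x) p.
move=> x; have [ha ax] := chart_atP x.
by apply/(normal_at_geodesic_field ha ax) => p; exact: h.
Qed.

End Defect.

(** * Normality in terms of a Levi-Civita connection *)

Section LeviCivita.
Context {R : realType} {n : nat} {M : manifold R n} (S : sub_riemannian M)
  (G : M -> 'rV[R]_n -> 'rV[R]_n -> R)
  (D : (M -> 'rV[R]_n) -> (M -> 'rV[R]_n) -> M -> 'rV[R]_n)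
  (hG : riemannian_metric G) (hGS : restricts_to_h S G).
Implicit Types (x : M) (u v w : 'rV[R]_n) (al : M -> 'cV[R]_n) (X Y : M -> 'rV[R]_n).

Lemma GC x v w : G x v w = G x w v.
Proof. by apply: (metric_sym hG). Qed.

Lemma G_linl x c u v w : G x (c *: u + v) w = c * G x u w + G x v w.
Proof. by apply: (metric_lin hG). Qed.

Lemma G0l x w : G x 0 w = 0.
Proof.
have := G_linl x 1 0 0 w.
by rewrite scaler0 addr0 mul1r => /eqP; rewrite -subr_eq subrr => /eqP <-.
Qed.

Lemma GBl x u v w : G x (u - v) w = G x u w - G x v w.
Proof. by rewrite addrC -scaleN1r G_linl mulN1r addrC. Qed.

Lemma GBr x u v w : G x u (v - w) = G x u v - G x u w.
Proof. by rewrite GC GBl !(GC x u). Qed.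

Definition flat_form x v : 'cV[R]_n := \col_j G x v (delta_mx 0 j).

Lemma pairing_flat x v w : pairing (flat_form x v) w = G x v w.
Proof.
have l (s : seq 'I_n) (F : 'I_n -> 'rV[R]_n) :
    G x v (\sum_(i <- s) w 0 i *: F i) = \sum_(i <- s) w 0 i * G x v (F i).
  elim: s => [|i s IH]; first by rewrite !big_nil GC G0l.
  by rewrite !big_cons GC G_linl !(GC x _ v) IH.
rewrite {2}(row_sum_delta w) l pairingE.
by apply: eq_bigr => i _; rewrite mxE.
Qed.

Lemma tauE al x : tau S G al x = flat_form x (gf S al x).
Proof.
pose P zeta := annihilator (Qperp S G x) zeta /\ annihilator (sr_Q S x) (al x - zeta).
have P0 : P (flat_form x (gf S al x)).
  split=> v /= hv.
    by rewrite pairing_flat GC hv //; exact: g_in.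
  rewrite pairingBl pairing_flat hGS //; last exact: g_in.
  by rewrite h_g // subrr.
have Pu z : P z -> z = flat_form x (gf S al x).
  move=> [h1 h2]; have [k1 k2] := P0.
  (* q is the G-orthogonal projection of v to Q, obtained from [g] because G and h agree on Q. Both
     forms vanish on v - q and agree with al on q. *)
  apply: pairing_ext => v; pose q := g S x (flat_form x v).
  have hq : sr_Q S x q by exact: g_in.
  have hp : Qperp S G x (v - q).
    move=> w hw; rewrite GBl [G x q w]hGS // h_g // pairing_flat subrr //.
  rewrite -(subrK q v) (pairingDr z) (pairingDr (flat_form _ _)) (h1 _ hp) (k1 _ hp).
  congr (_ + _).
  have := h2 _ hq; have := k2 _ hq; rewrite !pairingBl => /eqP e1 /eqP e2.
  by move: e1 e2; rewrite !subr_eq0 => /eqP <- /eqP <-.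
rewrite /tau; case: xgetP => [z _ /Pu //|/(_ _ P0)//].
Qed.

Lemma pairing_tau al x w : pairing (tau S G al x) w = G x (gf S al x) w.
Proof. by rewrite tauE pairing_flat. Qed.

Lemma one_form_tau al : one_form al -> one_form (tau S G al).
Proof.
move=> hal; have oT : open (setT : set M) by exact: openT.
have hX := vf_on_gf S oT hal.
apply: form_on_cover => // a i ha; rewrite setTI.
have sG : smooth_on (cdom a) (fun y => G y (gf S al y) (vec_of a y (delta_mx 0 i))).
  apply: (metric_smooth hG (cdom_open a)) => //; first exact: vf_on_sub hX.
  exact: vf_on_vec_of.
apply: (smooth_on_eq (cdom_open a) _ sG) => y ay.
rewrite -pairing_tau (pairing_in _ _ ha ay) vec_ofK // (bigD1 i) //= mxE !eqxx mul1r.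
by rewrite big1 ?addr0 // => j ji; rewrite mxE (negbTE ji) andbF mul0r.
Qed.

Hypothesis hD : levi_civita G D.

Lemma half_sym_bracket al x : one_form al -> 2^-1 *: sym_bracket S al al x =
  dual_form D (gf S al) (tau S G al) x + deltaB (gf S al) (tau_perp S G al) x.
Proof.
move=> hal; have oT : open (setT : set M) by exact: openT.
have hX := vf_on_gf S oT hal; have ht := one_form_tau hal.
set X := gf S al in hX *; set t := tau S G al in ht *; set e := tau_perp S G al.
have he : one_form e.
  have -> : e = fun y => al y + (-1) *: t y.
    by apply/funext => y; rewrite /e /tau_perp scaleN1r.
  by apply: form_onD => //; apply: form_onZ => //; exact: smooth_on_cst.
have tY Y y : pairing_fun t Y y = G y (X y) (Y y) by exact: pairing_tau.
have metricX Y : vector_field Y -> act X (pairing_fun t Y) x =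
    G x (D X X x) (Y x) + G x (X x) (D X Y x).
  move=> hY; rewrite -(lc_metric hD hX hX hY); congr act.
  by apply/funext => y; exact: tY.
(* Metric compatibility makes the derivative of the G-dual of X along X equal to the G-dual of
   [D X X], which is also the witness for the choice in [dual_form]. *)
have hdual Y : vector_field Y -> pairing (dual_form D X t x) (Y x) = G x (D X X x) (Y x).
  move=> hY; rewrite /dual_form; case: xgetP => [ga _ hga|].
    rewrite -[LHS]/(pairing_fun ga Y x) hga // metricX //.
    by rewrite [pairing_fun t _ x]pairing_tau addrK.
  move/(_ (fun y => flat_form y (D X X y))); case=> Z hZ y.
  rewrite [LHS]pairing_flat [pairing_fun t _ y]pairing_tau -/X.
  have -> : pairing_fun t Z = fun y => G y (X y) (Z y) by apply/funext => z; exact: tY.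
  by rewrite (lc_metric hD hX hX hZ) addrK.
apply: pairing_ext => v; have [Y hY <-] := vector_field_through x v.
rewrite pairingDl hdual // pairingZl /sym_bracket pairingBl pairingDl -/X.
have -> : lie_form X al x = lie_form X t x + deltaB X e x.
  have -> : al = fun y => t y + e y.
    by apply/funext => y; rewrite /e /tau_perp addrC subrK.
  rewrite (lie_formDr X oT (I : setT x) ht he); congr (_ + _).
  rewrite (lie_form_cartan oT (I : setT x) hX he) -[RHS]addr0; congr (_ + _).
  have -> : pairing_fun e X = fun=> 0; last exact: df_cst.
  apply/funext => y; rewrite /pairing_fun /e /tau_perp pairingBl pairing_tau.
  by rewrite hGS ?h_g ?subrr //; exact: g_in.
rewrite !pairingDl.
have -> : pairing (df (gbarf S al al) x) (Y x) = 2 * G x (D Y X x) (X x).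
  rewrite -[LHS]/(act Y (gbarf S al al) x).
  have -> : gbarf S al al = fun y => G y (X y) (X y).
    apply/funext => y; rewrite /gbarf gbar_h hGS //; exact: g_in.
  rewrite (lc_metric hD hY hX hX) (GC x (X x)); set s := G _ _ _; ring.
(* Metric compatibility and absence of torsion give <L_X t, Y> = G(D_X X, Y) + G(D_Y X, X). The
   second term is cancelled by half of Y(G(X, X)). *)
have := act_pairing oT (I : setT x) hX hY ht; rewrite metricX //.
rewrite -(lc_torsion hD hX hY) [pairing (t x) _]pairing_tau -/X GBr [G x (X x) (D Y X x)]GC.
set l := pairing (lie_form _ _ _) _; set d := pairing (deltaB _ _ _) _.
set g1 := G _ _ _; set g2 := G _ _ _; set g3 := G _ _ _ => hl.
have -> : l = g1 + g3 by move: hl => /= hl; rewrite -[l](addrK (g2 - g3)) -hl; ring.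
by field.
Qed.

Lemma normal_levi_civita nabla : g_connection S nabla ->
  (normal_connection S nabla <-> forall al, one_form al -> forall x,
    nabla al al x =
    dual_form D (gf S al) (tau S G al) x + deltaB (gf S al) (tau_perp S G al) x).
Proof.
move=> hn; rewrite (normal_diag hn).
by split=> h al hal x; have := h al hal x; rewrite half_sym_bracket.
Qed.

End LeviCivita.

(** * Change of charts for the Hamiltonian field *)

Section Curves.
Context {R : realType} {n : nat} {M : manifold R n} (S : sub_riemannian M).
Implicit Types (a b : chart R n M) (x : M) (xi : 'cV[R]_n) (c : R -> M)
  (p : R -> 'cV[R]_n) (t : R).

Lemma near_curve U c t (P : M -> Prop) : {for t, continuous c} -> open U -> U (c t) ->
  (forall y, U y -> P y) -> \forall s \near t, P (c s).
Proof.
move=> cc oU Uc h; have nU : nbhs (c t) U by exact: open_nbhs_nbhs (conj oU Uc).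
by have := cc U nU; apply: filterS => s /= /h.
Qed.

(** Continuity of c keeps c s in the chart for s near t, where f equals its representative composed
    with the coordinates. *)
Lemma is_derive_curve a U (f : M -> R) c t (xd : 'rV[R]_n) :
  atlas a -> open U -> U (c t) -> cdom a (c t) -> smooth_on U f ->
  {for t, continuous c} ->
  (forall i, is_derive t (1 : R) (fun s => coord a (c s) 0 i) (xd 0 i)) ->
  is_derive t (1 : R) (fun s => f (c s)) (\sum_j xd 0 j * pd a j f (c t)).
Proof.
move=> ha oU Uc ac hf cc dc.
have Vc : (coord a @` (U `&` cdom a)) (coord a (c t)) by exists (c t).
have := is_derive_chain (phi := fun s => coord a (c s)) dc (img_open oU) Vc (hf a ha 1%N).
apply: near_eq_is_derive.
apply: (near_curve (P := fun y => (f \o param a) (coord a y) = f y) cc (cdom_open a) ac).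
by move=> y ay /=; rewrite (coordK ay).
Qed.

Lemma X_H_fst_g a x xi : atlas a -> cdom a x ->
  (X_H S a x (covec_in a x xi)).1 = vec_in a x (g S x xi).
Proof.
move=> ha ax; rewrite X_H_fst; apply/rowP => i; rewrite mxE.
have -> : vec_in a x (g S x xi) 0 i = pairing (dcoord a i x) (g S x xi).
  rewrite (pairing_in _ _ ha ax) /dcoord covec_ofK // (bigD1 i) //= [delta_mx _ _ i 0]mxE.
  rewrite !eqxx mulr1 big1 ?addr0 // => j ji.
  by rewrite [delta_mx _ _ _ _]mxE (negbTE ji) mulr0.
rewrite -[RHS]/(gbar S x xi (dcoord a i x)) -{2}(covec_inK xi ha ax).
rewrite /dcoord gbar_covec_of; apply: eq_bigr => j _.
rewrite (bigD1 i) //= [delta_mx _ _ i 0]mxE !eqxx mulr1 big1 ?addr0 1?g_coefC // => l li.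
by rewrite [delta_mx _ _ _ _]mxE (negbTE li) mulr0.
Qed.

(* Differentiating jac a b *m jac b a = 1 along a coordinate of b. *)
Lemma pd_jac_inv a b x (P : 'cV[R]_n) (k i : 'I_n) : atlas a -> atlas b ->
  cdom a x -> cdom b x ->
  \sum_l pd b i (fun y => jac a b y k l) x * (jac b a x *m P) l 0 =
  - \sum_m pd a k (fun y => jac b a y i m) x * P m 0.
Proof.
move=> ha hb ax bx.
have oV : open (cdom a `&` cdom b) by apply: openI; exact: cdom_open.
have Vx : (cdom a `&` cdom b) x by [].
have sK k' l : smooth_on (cdom a `&` cdom b) (fun y => jac a b y k' l).
  by apply: smooth_on_sub (smooth_on_jac k' l ha hb) => y [].
have sJ k' l : smooth_on (cdom a `&` cdom b) (fun y => jac b a y k' l).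
  by apply: smooth_on_sub (smooth_on_jac k' l hb ha) => y [].
have sp l : smooth_on (cdom a `&` cdom b) (fun y => (jac b a y *m P) l 0).
  apply: (smooth_on_eq oV (f := fun y => \sum_m jac b a y l m * P m 0)).
    by move=> y _; rewrite [RHS]mxE.
  by apply: smooth_on_sum => // m; apply: smooth_onM => //; exact: smooth_on_cst.
have cst : pd b i (fun y => \sum_l jac a b y k l * (jac b a y *m P) l 0) x = 0.
  transitivity (pd b i (fun _ : M => P k 0) x); last exact: pd_cst.
  apply: (pd_eq i oV Vx bx) => y [ay by_].
  transitivity ((jac a b y *m (jac b a y *m P)) k 0); first by rewrite mxE.
  by rewrite mulmxA jacK // mul1mx.
(* Entries of the Jacobian matrix are first derivatives, so this is the symmetry of second
   derivatives of the transition map; it exchanges i and l. *)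
have dJ l m : pd b i (fun y => jac b a y l m) x = pd b l (fun y => jac b a y i m) x.
  have e k' : (fun y => jac b a y k' m) = pd b k' (fun y => coord a y 0 m).
    by apply/funext => y; rewrite mxE.
  by rewrite !e; apply: (pd_schwarz i l hb (cdom_open a) ax bx (smooth_on_coord m ha)).
have dp l : pd b i (fun y => (jac b a y *m P) l 0) x =
    \sum_m pd b l (fun y => jac b a y i m) x * P m 0.
  have -> : (fun y => (jac b a y *m P) l 0) = fun y => \sum_m jac b a y l m * P m 0.
    by apply/funext => y; rewrite mxE.
  have sc m := smooth_on_cst (M := M) (cdom a `&` cdom b) (P m 0).
  rewrite (pd_sum i _ oV hb Vx bx (fun m => smooth_onM oV (sJ l m) (sc m))).
  apply: eq_bigr => m _; rewrite (pdM i hb Vx bx (sJ l m) (sc m)) pd_cst mulr0 add0r.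
  by rewrite dJ mulrC.
move: cst; rewrite (pd_sum i _ oV hb Vx bx (fun l => smooth_onM oV (sK k l) (sp l))).
under eq_bigr => l _ do rewrite (pdM i hb Vx bx (sK k l) (sp l)) dp.
rewrite big_split /= => /eqP; rewrite addrC addr_eq0 => /eqP e.
transitivity (\sum_l (jac b a x *m P) l 0 * pd b i (fun y => jac a b y k l) x).
  by apply: eq_bigr => l _; rewrite mulrC.
rewrite e; congr (- _).
under eq_bigr => l _ do rewrite mulr_sumr.
rewrite exchange_big; apply: eq_bigr => m _.
rewrite (pd_chain k ha hb oV Vx ax bx (sJ i m)) mulr_suml.
by apply: eq_bigr => l _; rewrite mulrA.
Qed.

(** Since p_b = J p_a with J = [jac b a], the right-hand side is the derivative of J p_a along
    Hamilton's equations in a. The derivative of J has to match what arises from differentiating H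
    along b with the b-momenta held fixed; [pd_jac_inv] provides this match. *)
Lemma X_H_snd_change a b x xi i : atlas a -> atlas b -> cdom a x -> cdom b x ->
  let v := X_H S a x (covec_in a x xi) in
  (X_H S b x (covec_in b x xi)).2 i 0 =
  \sum_k ((\sum_j v.1 0 j * pd a j (fun y => jac b a y i k) x) * covec_in a x xi k 0 +
          jac b a x i k * v.2 k 0).
Proof.
move=> ha hb ax bx; set P := covec_in a x xi => v.
have oV : open (cdom a `&` cdom b) by apply: openI; exact: cdom_open.
have Vx : (cdom a `&` cdom b) x by [].
have sub : (cdom a `&` cdom b) `<=` cdom a by move=> y [].
have sg k l : smooth_on (cdom a `&` cdom b) (fun y => g_coef S a y k l).
  exact: smooth_on_sub (smooth_on_g_coef S k l ha).
(* q y holds the a-components at y of the covector whose b-components are those of xi at x, the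
   momenta held fixed when differentiating along b. *)
pose q y := jac a b y *m covec_in b x xi.
have qx : q x = P by rewrite /q /P (covec_in_change _ hb ha bx ax).
have sK k' l : smooth_on (cdom a `&` cdom b) (fun y => jac a b y k' l).
  by apply: smooth_on_sub (smooth_on_jac k' l ha hb) => y [].
have sc (r : R) := smooth_on_cst (M := M) (cdom a `&` cdom b) r.
have sq k : smooth_on (cdom a `&` cdom b) (fun y => q y k 0).
  apply: (smooth_on_eq oV (f := fun y => \sum_l jac a b y k l * covec_in b x xi l 0)).
    by move=> y _; rewrite [RHS]mxE.
  by apply: smooth_on_sum => // m; apply: smooth_onM.
have dq k : pd b i (fun y => q y k 0) x = - \sum_m pd a k (fun y => jac b a y i m) x * P m 0.
  rewrite -(pd_jac_inv _ _ _ ha hb ax bx) /P -(covec_in_change _ ha hb ax bx).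
  have -> : (fun y => q y k 0) = fun y => \sum_l jac a b y k l * covec_in b x xi l 0.
    by apply/funext => y; rewrite mxE.
  rewrite (pd_sum i _ oV hb Vx bx (fun l => smooth_onM oV (sK k l) (sc _))).
  apply: eq_bigr => l _; rewrite (pdM i hb Vx bx (sK k l) (sc _)) pd_cst mulr0 add0r.
  by rewrite mulrC.
have eH y : (cdom a `&` cdom b) y -> sr_hamiltonian S y (covec_of b y (covec_in b x xi)) =
    2^-1 * \sum_k \sum_l g_coef S a y k l * (q y k 0 * q y l 0).
  move=> [ay by_]; rewrite /sr_hamiltonian.
  have -> : covec_of b y (covec_in b x xi) = covec_of a y (q y).
    have [hy dy] := chart_atP y.
    by rewrite /covec_of /q mulmxA jac_mul.
  rewrite gbar_covec_of; congr (_ * _); apply: eq_bigr => k _; apply: eq_bigr => l _.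
  by rewrite mulrA.
have st k l : smooth_on (cdom a `&` cdom b) (fun y => g_coef S a y k l * (q y k 0 * q y l 0)).
  exact: smooth_onM oV (sg k l) (smooth_onM oV (sq k) (sq l)).
have ss k : smooth_on (cdom a `&` cdom b)
    (fun y => \sum_l g_coef S a y k l * (q y k 0 * q y l 0)).
  exact: smooth_on_sum oV (st k).
(* T collects the derivatives of the coefficients g^kl and W those of the momenta q; in W the factor
   1/2 is absorbed by the symmetry of g^kl. *)
pose T := \sum_k \sum_l pd b i (fun y => g_coef S a y k l) x * P k 0 * P l 0.
pose W := \sum_k v.1 0 k * pd b i (fun y => q y k 0) x.
transitivity (- (2^-1 * T + W)).
  rewrite [LHS]mxE; congr (- _); rewrite (pd_eq i oV Vx bx eH).
  rewrite (pdM i hb Vx bx (sc 2^-1) (smooth_on_sum _ oV ss)) pd_cst mulr0 addr0.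
  have W2 : W = 2^-1 * (\sum_k \sum_l g_coef S a x k l * (P l 0 * pd b i (fun y => q y k 0) x) +
      \sum_k \sum_l g_coef S a x k l * (P k 0 * pd b i (fun y => q y l 0) x)).
    have e1 : \sum_k \sum_l g_coef S a x k l * (P l 0 * pd b i (fun y => q y k 0) x) = W.
      rewrite /W /v X_H_fst; apply: eq_bigr => k _; rewrite mxE mulr_suml.
      by apply: eq_bigr => l _; rewrite mulrA.
    rewrite [X in _ + X]exchange_big /=.
    have -> : \sum_j \sum_i0 g_coef S a x i0 j * (P i0 0 * pd b i (fun y => q y j 0) x) = W.
      rewrite -e1; apply: eq_bigr => k _; apply: eq_bigr => l _.
      by rewrite g_coefC.
    by rewrite e1; field.
  rewrite W2 -mulrDr; congr (_ * _); rewrite /T -!big_split /=.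
  rewrite (pd_sum i _ oV hb Vx bx ss); apply: eq_bigr => k _.
  rewrite (pd_sum i _ oV hb Vx bx (st k)) -!big_split /=; apply: eq_bigr => l _.
  rewrite (pdM i hb Vx bx (sg k l) (smooth_onM oV (sq k) (sq l))).
  rewrite (pdM i hb Vx bx (sq k) (sq l)) qx.
  set d1 := pd _ _ _ _; set d2 := pd _ _ _ _; set d3 := pd _ _ _ _; ring.
transitivity (\sum_k (\sum_j v.1 0 j * pd a j (fun y => jac b a y i k) x) * P k 0 +
    \sum_k jac b a x i k * v.2 k 0); last by rewrite -big_split.
rewrite [LHS]opprD [LHS]addrC; congr (_ + _).
  rewrite /W -sumrN; under [RHS]eq_bigr => k _ do rewrite mulr_suml.
  rewrite exchange_big; apply: eq_bigr => k _; rewrite dq mulrN opprK mulr_sumr.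
  by apply: eq_bigr => m _; rewrite mulrA.
rewrite /T; transitivity (\sum_k jac b a x i k * - (2^-1 * \sum_j \sum_l
    pd a k (fun y => g_coef S a y j l) x * P j 0 * P l 0)); last first.
  by apply: eq_bigr => k _; rewrite /v X_H_snd.
under [RHS]eq_bigr => k _ do rewrite mulrN mulrCA.
rewrite sumrN -mulr_sumr; congr (- (_ * _)).
under [RHS]eq_bigr => k _ do rewrite mulr_sumr.
rewrite [RHS]exchange_big; apply: eq_bigr => j _.
under [RHS]eq_bigr => k _ do rewrite mulr_sumr.
rewrite [RHS]exchange_big; apply: eq_bigr => l _.
rewrite (pd_chain i hb ha oV Vx bx ax (sg j l)) !mulr_suml.
by apply: eq_bigr => k _; rewrite !mulrA.
Qed.

Definition solves_at a c p t := let v := X_H S a (c t) (covec_in a (c t) (p t)) in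
  forall i, is_derive t (1 : R) (fun s => coord a (c s) 0 i) (v.1 0 i) /\
    is_derive t (1 : R) (fun s => covec_in a (c s) (p s) i 0) (v.2 i 0).

(** [integral_curve] asks for Hamilton's equations in every chart; by the transformation laws of
    positions and momenta it suffices to verify them in one chart at each time. *)
Lemma solves_at_change a b c p t : atlas a -> atlas b -> cdom a (c t) -> cdom b (c t) ->
  {for t, continuous c} -> solves_at a c p t -> solves_at b c p t.
Proof.
move=> ha hb ac bc cc; rewrite /solves_at; set v := X_H S a _ _ => hv i.
have d1 j : is_derive t (1 : R) (fun s => coord a (c s) 0 j) (v.1 0 j) by have [] := hv j.
have oV : open (cdom a `&` cdom b) by apply: openI; exact: cdom_open.
have Vx : (cdom a `&` cdom b) (c t) by [].
split.
  have d := is_derive_curve ha (cdom_open b) bc ac (smooth_on_coord i hb) cc d1.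
  apply: (is_derive_eq d).
  have v1 : v.1 = vec_in a (c t) (g S (c t) (p t)) by exact: X_H_fst_g.
  transitivity (vec_in b (c t) (g S (c t) (p t)) 0 i).
    rewrite (vec_in_change _ ha hb ac bc) v1 [RHS]mxE.
    by apply: eq_bigr => j _; rewrite [X in _ = _ * X]mxE.
  by rewrite X_H_fst_g.
have eX := X_H_snd_change (p t) i ha hb ac bc.
rewrite eX -/v {eX}.
have dJ k := is_derive_curve ha oV Vx ac
  (smooth_on_sub (fun y (h : (cdom a `&` cdom b) y) => h) (smooth_on_jac i k hb ha)) cc d1.
have dk k : is_derive t (1 : R) (fun s => jac b a (c s) i k * covec_in a (c s) (p s) k 0)
    ((\sum_j v.1 0 j * pd a j (fun y => jac b a y i k) (c t)) * covec_in a (c t) (p t) k 0 +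
     jac b a (c t) i k * v.2 k 0).
  have d2 : is_derive t (1 : R) (fun s => covec_in a (c s) (p s) k 0) (v.2 k 0).
    by have [] := hv k.
  apply: (is_derive_eq (is_deriveM (dJ k) d2)).
  by rewrite /GRing.scale /= addrC [X in X + _]mulrC.
have dS : is_derive t (1 : R) (fun s => \sum_k jac b a (c s) i k * covec_in a (c s) (p s) k 0)
    (\sum_k ((\sum_j v.1 0 j * pd a j (fun y => jac b a y i k) (c t)) *
      covec_in a (c t) (p t) k 0 + jac b a (c t) i k * v.2 k 0)).
  have := @is_derive_sum _ _ _ _
    (fun k s => jac b a (c s) i k * covec_in a (c s) (p s) k 0) t 1 _ dk.
  have -> // : \sum_(k < n) (fun s => jac b a (c s) i k * covec_in a (c s) (p s) k 0) =
      fun s => \sum_k jac b a (c s) i k * covec_in a (c s) (p s) k 0.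
  by apply/funext => s; rewrite fct_sumE.
apply: near_eq_is_derive dS.
have nr : \forall s \near t, forall xi, \sum_k jac b a (c s) i k * covec_in a (c s) xi k 0 =
    covec_in b (c s) xi i 0.
  apply: (near_curve (P := fun y => forall xi, \sum_k jac b a y i k * covec_in a y xi k 0 =
    covec_in b y xi i 0) cc oV Vx) => y [ay by_] xi.
  by rewrite (covec_in_change _ ha hb ay by_) [RHS]mxE.
by apply: filterS nr => s; exact.
Qed.

End Curves.

(** * Existence of integral curves *)

Section Primitive.
Context {R : realType}.

Lemma primitive_exists (f : R -> R) (T : R) : 0 < T -> continuous f ->
  exists F : R -> R, F 0 = 0 /\ forall t : R, `|t| < T -> is_derive t 1 F (f t).
Proof.
move=> T0 cf.
have intf : (@lebesgue_measure R).-integrable `[- T, T] (EFin \o f).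
  apply: continuous_compact_integrable; first exact: segment_compact.
  exact: continuous_subspaceT.
(* Integration starts at -T, so that the fundamental theorem applies on both sides of 0; the value
   at 0 is subtracted afterwards. *)
pose F0 x := (\int[@lebesgue_measure R]_(t in [set` `[- T, x]]) (f t))%R.
have dF (t : R) : `|t| < T -> is_derive t 1 F0 (f t).
  rewrite ltr_norml => /andP[t1 t2].
  have [d1 d2] := continuous_FTC1_closed t2 intf t1 (cf t).
  by split; [exact: d1|rewrite -derive1E; exact: d2].
exists (fun x => F0 x - F0 0); split; first by rewrite subrr.
move=> t ht; have d := is_deriveB (dF t ht) (is_derive_cst (F0 0) t 1).
by apply: (is_derive_eq d); rewrite subr0.
Qed.

Lemma norm_le_derive (f f' : R -> R) (d K : R) : 0 <= K ->
  f 0 = 0 -> continuous f -> (forall t : R, `|t| < d -> is_derive t 1 f (f' t)) ->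
  (forall t : R, `|t| < d -> `|f' t| <= K) -> forall t : R, `|t| <= d -> `|f t| <= K * d.
Proof.
move=> K0 f0 cf df bf t ht.
have [t0|t0] := leP 0 t.
  have dx (x : R) : x \in `]0, t[%R -> is_derive x 1 f (f' x).
    rewrite in_itv /= => /andP[x0 xt]; apply: df.
    by rewrite gtr0_norm // (lt_le_trans xt) // -(ger0_norm t0).
  have cw : {within `[0, t], continuous f} by exact: continuous_subspaceT.
  have [t00|t0'] := eqVneq t 0.
    by rewrite t00 f0 normr0 mulr_ge0 // (le_trans _ ht).
  have tp : 0 < t by rewrite lt_neqAle eq_sym t0'.
  have [x xt] := MVT tp dx cw.
  rewrite f0 !subr0 => ->; rewrite normrM ler_pM //; apply: bf.
  move: xt; rewrite in_itv /= => /andP[x0 xt].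
  by rewrite gtr0_norm // (lt_le_trans xt) // -(ger0_norm t0).
have dx (x : R) : x \in `]t, 0[%R -> is_derive x 1 f (f' x).
  rewrite in_itv /= => /andP[x0 xt]; apply: df.
  by rewrite ltr0_norm // (lt_le_trans _ ht) // ltr0_norm // ltrN2.
have cw : {within `[t, 0], continuous f} by exact: continuous_subspaceT.
have [x xt] := MVT t0 dx cw.
rewrite f0 !sub0r => /(congr1 Num.norm); rewrite normrN => ->.
rewrite normrM normrN ler_pM //; apply: bf.
move: xt; rewrite in_itv /= => /andP[x0 xt].
by rewrite ltr0_norm // (lt_le_trans _ ht) // ltr0_norm // ltrN2.
Qed.

(** The radii e k = 2 C 2^-k are the sums of the bounds on the remaining increments, so the
    intervals of radius e k around u k are nested; the limit is the supremum of their left ends. *)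
Lemma geometric_limit (u : nat -> R) (C : R) :
  (forall k, `|u k.+1 - u k| <= C * 2^-1 ^+ k) ->
  exists l, forall k, `|l - u k| <= 2 * C * 2^-1 ^+ k.
Proof.
move=> h; pose e k := 2 * C * 2^-1 ^+ k.
have eS k : e k - e k.+1 = C * 2^-1 ^+ k by rewrite /e exprS; field.
have C0 : 0 <= C by have := h 0%N; rewrite expr0 mulr1; exact: le_trans.
have e0 k : 0 <= e k by rewrite /e !mulr_ge0 // exprn_ge0.
have lo j k : u j - e j <= u (j + k)%N - e (j + k)%N.
  elim: k => [|k IH]; first by rewrite addn0.
  apply: (le_trans IH); rewrite addnS; have := h (j + k)%N; have := eS (j + k)%N.
  by rewrite ler_norml => ? /andP[? ?]; lra.
have up j k : u (j + k)%N + e (j + k)%N <= u j + e j.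
  elim: k => [|k IH]; first by rewrite addn0.
  apply: le_trans IH; rewrite addnS; have := h (j + k)%N; have := eS (j + k)%N.
  by rewrite ler_norml => ? /andP[? ?]; lra.
have sep j k : u j - e j <= u k + e k.
  have [jk|kj] := leqP j k.
    have := lo j (k - j)%N; rewrite subnKC // => l1; apply: (le_trans l1).
    by have := e0 k; lra.
  have := up k (j - k)%N; rewrite subnKC ?(ltnW kj) // => l1; apply: le_trans l1.
  by have := e0 j; lra.
pose A := [set u k - e k | k in [set: nat]].
have hA : has_sup A.
  split; first by exists (u 0%N - e 0%N), 0%N.
  by exists (u 0%N + e 0%N) => _ [k _ <-]; exact: sep.
exists (sup A) => k; rewrite ler_norml -/(e k); apply/andP; split.
  have : u k - e k <= sup A by apply: sup_upper_bound => //; exists k.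
  by lra.
have : sup A <= u k + e k.
  by apply: ge_sup; [exact: hA.1|move=> _ [j _ <-]; exact: sep].
by lra.
Qed.

Lemma half_pow_small (C e : R) : 0 < e -> exists k, C * 2^-1 ^+ k < e.
Proof.
move=> e0; have c0 : `|2^-1 : R| < 1 by rewrite ger0_norm ?invf_lt1 ?ltr1n ?invr_ge0.
have cv := @cvg_geometric R C _ c0.
have /cvgrPdist_lt/(_ e e0) := cv.
move=> [N _ /(_ N)]; rewrite /= leqnn => /(_ isT); rewrite sub0r normrN /geometric /= => h.
by exists N; apply: le_lt_trans (ler_norm _) h.
Qed.

End Primitive.

Section RowLimits.
Context {R : realType} {m : nat}.

Lemma continuous_dist (T : topologicalType) (f : T -> 'rV[R]_m) (x : T) :
  (forall e : R, 0 < e -> \forall y \near x, `|f x - f y| < e) -> {for x, continuous f}.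
Proof. by move=> h; apply/cvgrPdist_lt. Qed.

Lemma dist_continuous (T : topologicalType) (f : T -> 'rV[R]_m) (x : T) :
  {for x, continuous f} -> forall e : R, 0 < e -> \forall y \near x, `|f x - f y| < e.
Proof. by move=> /cvgrPdist_lt. Qed.

Lemma near_dist (u : 'rV[R]_m) (e : R) : 0 < e -> \forall v \near u, `|u - v| < e.
Proof. by move=> e0; have := nbhsx_ballx u e e0; rewrite -ball_normE. Qed.

Lemma continuous_entry (T : topologicalType) (f : T -> 'rV[R]_m) (x : T) i :
  {for x, continuous f} -> {for x, continuous (fun y => f y 0 i)}.
Proof.
move=> cf; apply: (@continuous_comp _ _ _ f (fun w : 'rV[R]_m => w 0 i)); first exact: cf.
exact: matrix_normedtype.coord_continuous.
Qed.

End RowLimits.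

(** * Picard iteration for globally Lipschitz fields *)

Section Picard.
Context {R : realType} {m : nat}.
Variables (F : 'rV[R]_m -> 'rV[R]_m) (L : R) (w0 : 'rV[R]_m).
Hypothesis L0 : 0 <= L.
Hypothesis lipF : forall u v, `|F u - F v| <= L * `|u - v|.

(** The choice gives L d <= 1/2, so that a Picard step halves distances; L + 1 keeps the denominator
    positive when L = 0. *)
Let d : R := (2 * (L + 1))^-1.
Let d0 : 0 < d. Proof. by rewrite invr_gt0 mulr_gt0 // ltr_wpDl. Qed.
Let Ld : L * d <= 2^-1.
Proof.
rewrite /d; have L1 : 0 < L + 1 by rewrite ltr_wpDl.
by rewrite ler_pdivrMr ?mulr_gt0 // mulKf // lerDl.
Qed.

(** Time is frozen outside [-d, d], so the iterates are continuous on the whole line and the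
    estimates hold for every t. *)
Let clampt (t : R) : R := Num.max (- d) (Num.min t d).

Let clampt_bound t : `|clampt t| <= d.
Proof.
rewrite ler_norml /clampt le_max lexx /= ge_max ge_min lexx orbT andbT.
by apply: (@le_trans _ _ 0); [rewrite oppr_le0 ltW|rewrite ltW].
Qed.

Let clamptE t : `|t| <= d -> clampt t = t.
Proof.
by rewrite ler_norml /clampt => /andP[t1 t2]; rewrite (min_idPl t2) (max_idPr t1).
Qed.

Let continuous_clampt : continuous clampt.
Proof.
have h1 : continuous ((id : R -> R^o) \min cst d).
  by move=> t; apply: continuous_min; [exact: cvg_id|exact: cst_continuous].
move=> t; have h2 : {for t, continuous (cst (- d) : R -> R^o)} by exact: cst_continuous.
exact: (continuous_max h2 (h1 t)).
Qed.

Let continuous_F : continuous F.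
Proof.
move=> u; apply: continuous_dist => e e0; have L1 : 0 < L + 1 by rewrite ltr_wpDl.
have e1 : 0 < e / (L + 1) by exact: divr_gt0.
have : \forall v \near u, `|u - v| < e / (L + 1) by exact: near_dist.
apply: filterS => v; rewrite ltr_pdivlMr // => h.
apply: le_lt_trans (lipF u v) _; apply: le_lt_trans h.
by rewrite mulrC ler_wpM2l // lerDl.
Qed.

(** v is w0 plus the integral of F o u from 0, frozen outside [-d, d]. Describing it by its
    derivative and initial value suits estimates by the mean value theorem. *)
Definition picard_step (u v : R -> 'rV[R]_m) :=
  [/\ continuous v, v 0 = w0, forall t, v t = v (clampt t) &
      forall (t : R) i, `|t| < d -> is_derive t 1 (fun s => v s 0 i) (F (u t) 0 i)].

Lemma picard_step_exists u : continuous u -> exists v, picard_step u v.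
Proof.
move=> cu.
(* A primitive on |t| < 2d is differentiable, hence continuous, also at the ends of [-d, d]. *)
have d2 : 0 < 2 * d by rewrite mulr_gt0.
have cf i : continuous (fun t => F (u t) 0 i).
  move=> t; apply: (continuous_entry (f := F \o u)).
  by apply: continuous_comp; [exact: cu|exact: continuous_F].
have ex i := primitive_exists d2 (cf i).
have [P hP] := choice ex.
exists (fun t => \row_i (w0 0 i + P i (clampt t))); split.
- move=> t; apply: continuous_row => i.
  have -> : (fun y : R => (\row_i (w0 0 i + P i (clampt y))) 0 i) =
      fun y : R => w0 0 i + P i (clampt y) by apply/funext => y; rewrite mxE.
  apply: continuousD; first exact: cst_continuous.
  apply: continuous_comp; first exact: continuous_clampt.
  have [_ /(_ (clampt t))] := hP i.
  have lt : `|clampt t| < 2 * d.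
    by apply: le_lt_trans (clampt_bound t) _; rewrite mulr2n mulrDl mul1r ltrDl.
  by move=> /(_ lt)[/derivable1_diffP/differentiable_continuous].
- apply/rowP => i; rewrite mxE clamptE ?normr0 ?(ltW d0) //.
  by have [-> _] := hP i; rewrite addr0.
- move=> t; apply/rowP => i; rewrite !mxE.
  by rewrite [clampt (clampt t)]clamptE // clampt_bound.
- move=> t i ht.
  have lt : `|t| < 2 * d.
    by apply: (lt_trans ht); rewrite mulr2n mulrDl mul1r ltrDl.
  have [_ /(_ t lt) dP] := hP i.
  have dD := is_deriveD (is_derive_cst (w0 0 i) t 1) dP.
  have : is_derive t 1 (fun s => w0 0 i + P i s) (F (u t) 0 i).
    by apply: (is_derive_eq dD); rewrite add0r.
  apply: near_eq_is_derive.
  have oB : open [set s : R | `|s| < d].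
    have -> : [set s : R | `|s| < d] = ball 0 d.
      by apply/seteqP; rewrite -ball_normE; split=> s /=; rewrite sub0r normrN.
    exact: ball_open.
  apply: (near_open oB ht) => s hs.
  by rewrite mxE clamptE // ltW.
Qed.

(** The components of v - v' vanish at 0 and have derivative at most L e for |t| < d, and L d <=
    1/2. *)
Lemma picard_contract u u' v v' e : picard_step u v -> picard_step u' v' ->
  0 <= e -> (forall t, `|u t - u' t| <= e) -> forall t, `|v t - v' t| <= 2^-1 * e.
Proof.
move=> [cv v0 vc dv] [cv' v0' vc' dv'] e0 hu t.
rewrite vc vc'; have := clampt_bound t; move: (clampt t) => {}t ht.
apply: normr_row_le => [|i]; first by rewrite mulr_ge0 // invr_ge0.
have K0 : 0 <= L * e by rewrite mulr_ge0.
have c1 : continuous (fun s => v s 0 i - v' s 0 i).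
  move=> s; apply: continuousB.
    exact: continuous_entry (cv s).
  exact: continuous_entry (cv' s).
have z0 : v 0 0 i - v' 0 0 i = 0 by rewrite v0 v0' subrr.
have := norm_le_derive K0 z0 c1 (fun s hs => is_deriveB (dv s i hs) (dv' s i hs)) _ ht.
rewrite !mxE => h; apply: le_trans (h _) _.
  move=> s hs; have := normr_coord (F (u s) - F (u' s)) i; rewrite !mxE.
  move=> /le_trans; apply; apply: le_trans (lipF _ _) _.
  by rewrite ler_wpM2l.
by rewrite mulrAC ler_wpM2r.
Qed.

Lemma picard_global : exists2 w : R -> 'rV[R]_m, w 0 = w0 & continuous w /\
  exists2 r : R, 0 < r & forall (t : R) i, `|t| < r ->
    is_derive t 1 (fun s => w s 0 i) (F (w t) 0 i).
Proof.
have ex u : exists v, continuous u -> picard_step u v.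
  have [cu|ncu] := pselect (continuous u); last by exists u.
  by have [v hv] := picard_step_exists cu; exists v.
have [T hT] := choice ex.
pose u k := iter k T (fun=> w0).
have cu k : continuous (u k).
  elim: k => [|k IH]; first exact: cst_continuous.
  by have [] := hT _ IH.
have su k : picard_step (u k) (u k.+1) by apply: hT; exact: cu.
have [C C0 hC] : exists2 C, 0 <= C & forall t, `|u 1%N t - u 0%N t| <= C.
  exists (`|F w0| * d); first by rewrite mulr_ge0 // ltW.
  have [cv v0 vc dv] := su 0%N.
  move=> t; rewrite vc -[u 0%N t]/w0; have := clampt_bound t; move: (clampt t) => {}t ht.
  apply: normr_row_le => [|i]; first by rewrite mulr_ge0 // ltW.
  have c1 : continuous (fun s => u 1%N s 0 i - w0 0 i).
    move=> s; apply: continuousB; last exact: cst_continuous.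
    exact: continuous_entry (cv s).
  have z0 : u 1%N 0 0 i - w0 0 i = 0 by rewrite v0 subrr.
  have := norm_le_derive (normr_ge0 (F w0)) z0 c1
    (fun s hs => is_deriveB (dv s i hs) (is_derive_cst (w0 0 i) s 1)) _ ht.
  rewrite !mxE => h; apply: h => s hs; rewrite subr0; exact: normr_coord.
have hu k t : `|u k.+1 t - u k t| <= C * 2^-1 ^+ k.
  elim: k t => [|k IH] t; first by rewrite expr0 mulr1.
  have e0 : 0 <= C * 2^-1 ^+ k by rewrite mulr_ge0 // exprn_ge0.
  by rewrite exprS mulrCA; exact: (picard_contract (su k.+1) (su k) e0 IH).
have lim t i : exists l, forall k, `|l - u k t 0 i| <= 2 * C * 2^-1 ^+ k.
  apply: geometric_limit => k; apply: le_trans (hu k t).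
  by have := normr_coord (u k.+1 t - u k t) i; rewrite !mxE.
pose l t := projT1 (choice (lim t)).
have hl t i k : `|l t i - u k t 0 i| <= 2 * C * 2^-1 ^+ k.
  exact: (projT2 (choice (lim t)) i k).
pose w t : 'rV[R]_m := \row_i l t i.
have wu k t : `|w t - u k t| <= 2 * C * 2^-1 ^+ k.
  apply: normr_row_le => [|i]; last by rewrite !mxE.
  by rewrite !mulr_ge0 // exprn_ge0.
have cw : continuous w.
  move=> t; apply: continuous_dist => e e0.
  have [k hk] := half_pow_small (2 * C) (divr_gt0 e0 (ltr0n R 3)).
  have : \forall s \near t, `|u k t - u k s| < e / 3%:R.
    by apply: dist_continuous; [exact: cu|rewrite divr_gt0].
  apply: filterS => s hs.
  have -> : w t - w s = (w t - u k t) + (u k t - u k s) + (u k s - w s).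
    by rewrite -!addrA !addKr.
  apply: le_lt_trans (ler_normD _ _) _.
  have h1 := le_lt_trans (wu k t) hk; have h2 := le_lt_trans (wu k s) hk.
  have h3 := ler_normD (w t - u k t) (u k t - u k s).
  by rewrite distrC in h2; lra.
(* The limit w is so far only continuous. Its own Picard step v is differentiable on |t| < d, and v
   and w are both limits of the iterates, so v = w. *)
have [v sv] := picard_step_exists cw.
have vw : v = w.
  apply/funext => t; apply/eqP; rewrite -subr_eq0 -normr_le0; apply/ler_addgt0Pl => e e0.
  rewrite addr0.
  have [k hk] := half_pow_small (2 * C) e0.
  have h0 : 0 <= 2 * C * 2^-1 ^+ k by rewrite !mulr_ge0 // exprn_ge0.
  have h1 := picard_contract sv (su k) h0 (wu k) t.
  have h2 := wu k.+1 t.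
  have h3 := ler_normD (v t - u k.+1 t) (u k.+1 t - w t).
  rewrite subrKA in h3; rewrite distrC in h2.
  have e1 : 2 * C * 2^-1 ^+ k.+1 = 2^-1 * (2 * C * 2^-1 ^+ k) by rewrite exprS; ring.
  by rewrite e1 in h2; lra.
have [_ w00 _ dw] := sv; rewrite vw in w00 dw.
by exists w => //; split=> //; exists d.
Qed.

End Picard.

Lemma near_forall (T : topologicalType) (x : T) (I : finType) (P : I -> T -> Prop) :
  (forall i, \forall y \near x, P i y) -> \forall y \near x, forall i, P i y.
Proof. by move=> h; exact: filter_forall. Qed.

(** * Local solutions of C^1 differential equations *)

Section LocalExistence.
Context {R : realType} {m : nat}.
Local Notation e_ j := (delta_mx 0 j : 'rV[R]_m).

(** The coordinatewise retraction onto the cube of radius rho around w0. It is 1-Lipschitz in the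
    maximum norm, so composing with it turns a field that is Lipschitz on the cube into a globally
    Lipschitz one. *)
Definition clampv (w0 : 'rV[R]_m) (rho : R) (z : 'rV[R]_m) : 'rV[R]_m :=
  \row_i Num.max (w0 0 i - rho) (Num.min (z 0 i) (w0 0 i + rho)).

Lemma clampv_bound w0 (rho : R) z : 0 <= rho -> `|clampv w0 rho z - w0| <= rho.
Proof.
move=> r0; apply: normr_row_le => // i; rewrite !mxE ler_distl.
rewrite le_max lexx /= ge_max ge_min lexx orbT andbT.
by rewrite lerD2l (le_trans _ r0) // oppr_le0.
Qed.

Lemma clampvE w0 (rho : R) z : `|z - w0| <= rho -> clampv w0 rho z = z.
Proof.
move=> h; apply/rowP => i; rewrite !mxE.
have := le_trans (normr_coord (z - w0) i) h; rewrite !mxE ler_distl => /andP[h1 h2].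
by rewrite (min_idPl h2) (max_idPr h1).
Qed.

Lemma clampv_lip w0 (rho : R) z z' : 0 <= rho ->
  `|clampv w0 rho z - clampv w0 rho z'| <= `|z - z'|.
Proof.
move=> r0; apply: normr_row_le => // i; rewrite !mxE.
have := normr_coord (z - z') i; rewrite !mxE; apply: le_trans.
move: (z 0 i) (z' 0 i) (w0 0 i) => s t u.
have e : s - t <= `|s - t| by exact: ler_norm.
have e' : t - s <= `|s - t| by rewrite distrC ler_norm.
move: e e'; move: `|s - t| => N e e'; rewrite ler_norml.
case: (leP s (u + rho)) => h1; case: (leP t (u + rho)) => h2.
- by case: (leP (u - rho) s) => h3; case: (leP (u - rho) t) => h4; lra.
- by case: (leP (u - rho) s) => h3; case: (leP (u - rho) (u + rho)) => h4; lra.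
- by case: (leP (u - rho) (u + rho)) => h3; case: (leP (u - rho) t) => h4; lra.
- by case: (leP (u - rho) (u + rho)) => h3; lra.
Qed.

Lemma ode_local (F : 'rV[R]_m -> 'rV[R]_m) (V : set 'rV[R]_m) w0 :
  open V -> V w0 -> (forall i, is_Ck 1 V (fun w => F w 0 i)) ->
  exists2 w : R -> 'rV[R]_m, w 0 = w0 & continuous w /\
  exists2 r : R, 0 < r & forall t : R, `|t| < r -> V (w t) /\
    forall i, is_derive t 1 (fun s => w s 0 i) (F (w t) 0 i).
Proof.
move=> oV Vw hF.
pose D i j y := 'D_(e_ j) (fun w => F w 0 i) y.
pose K := \sum_i \sum_j (`|D i j w0| + 1).
have : nbhs w0 [set y | V y /\ forall i j, `|D i j y| <= `|D i j w0| + 1].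
  have n1 : nbhs w0 V by exact: open_nbhs_nbhs.
  have n2 : \forall y \near w0, forall i j, `|D i j y| <= `|D i j w0| + 1.
    apply: near_forall => i; apply: near_forall => j.
    have [_ /(_ j)[_ [+ _]]] := hF i => /(_ w0 Vw) cD.
    have : \forall y \near w0, `|D i j w0 - D i j y| < 1.
      by move/cvgrPdist_lt: cD => /(_ 1 ltr01).
    apply: filterS => y hy; rewrite -[D i j y](subrK (D i j w0)).
    rewrite addrC (le_trans (ler_normD _ _)) // lerD2l distrC; exact: ltW.
  exact: filterI n1 n2.
move=> /nbhs_ballP[r0 /= r00 hr].
(* Points at distance at most |u' - v'| <= 2 rho from v' are within 3 rho < r0 of w0, where the
   partial derivatives are bounded. *)
pose rho := r0 / 4; have rho0 : 0 < rho by rewrite divr_gt0.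
have inB y : `|y - w0| <= 3 * rho -> V y /\ forall i j, `|D i j y| <= `|D i j w0| + 1.
  move=> hy; apply: hr; rewrite -ball_normE /= distrC; apply: le_lt_trans hy _.
  by rewrite /rho mulrA ltr_pdivrMr // mulrC ltr_pM2l // ltr_nat.
have K0 : 0 <= K by rewrite sumr_ge0 // => i _; rewrite sumr_ge0 // => j _; rewrite addr_ge0.
pose Fc z := F (clampv w0 rho z).
have lip u v : `|Fc u - Fc v| <= K * `|u - v|.
  pose u' := clampv w0 rho u; pose v' := clampv w0 rho v.
  apply: (@le_trans _ _ (K * `|u' - v'|)); last first.
    by rewrite ler_wpM2l // clampv_lip // ltW.
  have bu : `|u' - w0| <= rho by apply: clampv_bound; exact: ltW.
  have bv : `|v' - w0| <= rho by apply: clampv_bound; exact: ltW.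
  have near_v y : `|y - v'| <= `|u' - v'| -> `|y - w0| <= 3 * rho.
    move=> hy; have h1 := ler_normD (y - v') (v' - w0).
    have h2 := ler_normD (u' - w0) (w0 - v').
    rewrite subrKA in h1; rewrite subrKA [in X in _ <= _ + X]distrC in h2.
    by move: hy h1 h2 bu bv; move: `|_| `|_| `|_| `|_| `|_| => *; lra.
  apply: normr_row_le => [|i]; first by rewrite mulr_ge0.
  have dv y : `|y - v'| <= `|u' - v'| -> forall j, derivable (fun w => F w 0 i) y (e_ j).
    move=> hy j; have [_ /(_ j)[+ _]] := hF i; apply.
    by have [] := inB _ (near_v _ hy).
  have [xi [hxi e]] := finite_increments dv.
  rewrite !mxE -/u' -/v' e; apply: le_trans (ler_norm_sum _ _ _) _.
  apply: (@le_trans _ _ (\sum_j (`|D i j w0| + 1) * `|u' - v'|)).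
    apply: ler_sum => j _; rewrite normrM mulrC ler_pM //.
      by have [_] := inB _ (near_v _ (hxi j)); apply.
    by have := normr_coord (u' - v') j; rewrite !mxE.
  rewrite -mulr_suml ler_wpM2r // /K [leRHS](bigD1 i) //= lerDl sumr_ge0 // => l _.
  by rewrite sumr_ge0 // => j _; rewrite addr_ge0.
have [w w00 [cw [r1 r10 dw]]] := picard_global w0 K0 lip.
exists w => //; split=> //.
(* Continuity keeps w in the cube for small t, where the truncated field is F itself. *)
have : \forall t \near (0 : R), `|w 0 - w t| < rho by apply: dist_continuous => //; exact: cw.
move=> /nbhs_ballP[r2 /= r20 hr2].
exists (Num.min r1 r2); first by rewrite lt_min r10.
move=> t; rewrite lt_min => /andP[t1 t2].
have hw : `|w t - w0| <= rho.
  rewrite distrC -w00; apply: ltW; apply: hr2.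
  by rewrite -ball_normE /= sub0r normrN.
split; first by apply: (inB _ _).1; apply: (le_trans hw); lra.
by move=> i; have := dw t i t1; rewrite /Fc clampvE.
Qed.

End LocalExistence.

Section HamiltonianFlow.
Context {R : realType} {n : nat} {M : manifold R n} (S : sub_riemannian M).

(** In the chart at x Hamilton's equations form a smooth system on R^(n+n), with positions on the
    left and momenta on the right. [ode_local] keeps the positions in the image of the chart, and
    [solves_at_change] transfers the equations to all other charts. *)
Lemma X_H_integral_curve (x : M) (xi : 'cV[R]_n) : exists (r : R) c p,
  [/\ 0 < r, c 0 = x, p 0 = xi & integral_curve (X_H S) [set t | `|t| < r] c p].
Proof.
have [ha ax] := chart_atP x; set a := chart_at x in ha ax.
pose Z : set 'rV[R]_(n + n) := [set w | (coord a @` cdom a) (lsubmx w)].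
have cl : continuous (lsubmx : 'rV[R]_(n + n) -> 'rV[R]_n).
  move=> w; apply: continuous_row => j.
  have -> : (fun y : 'rV[R]_(n + n) => lsubmx y 0 j) = fun y => y 0 (lshift n j).
    by apply/funext => y; rewrite mxE.
  exact: matrix_normedtype.coord_continuous.
have oZ : open Z.
  have -> : Z = lsubmx @^-1` (coord a @` cdom a) by [].
  by apply: open_comp => [w _|]; [exact: cl|exact: cimg_open].
pose F (w : 'rV[R]_(n + n)) : 'rV[R]_(n + n) :=
  row_mx (X_H S a (param a (lsubmx w)) (rsubmx w)^T).1
    (X_H S a (param a (lsubmx w)) (rsubmx w)^T).2^T.
have sf (f : M -> R) : smooth_on (cdom a) f -> is_Coo Z (fun w => f (param a (lsubmx w))).
  move=> hf; have hf' : is_Coo (coord a @` cdom a) (f \o param a).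
    by have := hf a ha; rewrite setIid.
  apply: (is_Coo_comp (phi := lsubmx) oZ (cimg_open (c := a)) _ _ hf') => // j.
  apply: (is_Coo_eq oZ _ (is_Coo_coord Z (lshift n j))) => w _.
  by rewrite mxE.
have sr j : is_Coo Z (fun w : 'rV[R]_(n + n) => (rsubmx w)^T j 0).
  apply: (is_Coo_eq oZ _ (is_Coo_coord Z (rshift n j))) => w _.
  by rewrite !mxE.
have sF i : is_Ck 1 Z (fun w => F w 0 i).
  suff : is_Coo Z (fun w => F w 0 i) by exact.
  case: (splitP i) => j ij.
    have -> : i = lshift n j by exact: val_inj.
    apply: (is_Coo_eq oZ (f := fun w =>
        \sum_k g_coef S a (param a (lsubmx w)) j k * (rsubmx w)^T k 0)).
      by move=> w _; rewrite /F row_mxEl X_H_fst mxE.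
    move=> k; apply: is_Ck_sum => // l; apply: is_CkM => //; last exact: sr.
    exact: (sf (fun y => g_coef S a y j l) (smooth_on_g_coef S j l ha)).
  have -> : i = rshift n j by exact: val_inj.
  apply: (is_Coo_eq oZ (f := fun w => (- 2^-1) * \sum_k \sum_l
      pd a j (fun y => g_coef S a y k l) (param a (lsubmx w)) *
      (rsubmx w)^T k 0 * (rsubmx w)^T l 0)).
    move=> w [y ay yw]; have aw : cdom a (param a (lsubmx w)) by rewrite -yw (coordK ay).
    by rewrite /F row_mxEr mxE X_H_snd // mulNr.
  apply: is_CooM => //; first exact: is_Coo_cst.
  move=> k; apply: is_Ck_sum => // l; apply: is_Ck_sum => // l'.
  apply: is_CkM => //; last exact: sr.
  apply: is_CkM => //; last exact: sr.
  have sg := smooth_on_pd j ha (cdom_open a) (smooth_on_g_coef S l l' ha).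
  by rewrite setIid in sg; exact: (sf _ sg).
pose w0 : 'rV[R]_(n + n) := row_mx (coord a x) (covec_in a x xi)^T.
have Zw0 : Z w0 by rewrite /Z /w0 /= row_mxKl; exists x.
have [w w00 [cw [r r0 hw]]] := ode_local oZ Zw0 sF.
pose c (t : R) := param a (lsubmx (w t)).
pose p (t : R) := covec_of a (c t) (rsubmx (w t))^T.
have ac (t : R) : `|t| < r -> cdom a (c t).
  by move=> /hw [[y ay yw] _]; rewrite /c -yw (coordK ay).
have coordc (t : R) : `|t| < r -> coord a (c t) = lsubmx (w t).
  by move=> /hw [[y ay yw] _]; rewrite /c -yw (coordK ay).
have pin (t : R) : `|t| < r -> covec_in a (c t) (p t) = (rsubmx (w t))^T.
  by move=> ht; rewrite /p covec_ofK //; exact: ac.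
have cc (t : R) : `|t| < r -> {for t, continuous c}.
  move=> ht; have [Zt _] := hw t ht.
  apply: (@continuous_comp _ _ _ w (fun u => param a (lsubmx u))); first exact: cw.
  apply: (@continuous_comp _ _ _ lsubmx (param a)); first exact: cl.
  exact: param_continuous Zt.
have near_t (t : R) : `|t| < r -> \forall s \near t, `|s| < r.
  have oB : open [set s : R | `|s| < r].
    have -> : [set s : R | `|s| < r] = ball 0 r.
      by apply/seteqP; rewrite -ball_normE; split=> s /=; rewrite sub0r normrN.
    exact: ball_open.
  by move=> ht; exact: open_nbhs_nbhs (conj oB ht).
exists r, c, p; split=> //.
- by rewrite /c w00 row_mxKl (coordK ax).
- by rewrite /p /c w00 row_mxKl (coordK ax) row_mxKr trmxK covec_inK.
move=> t ht; split; first exact: cc.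
move=> b hb bc; apply: (solves_at_change ha hb (ac t ht) bc (cc t ht)) => v i.
have [_ dw] := hw t ht; rewrite /v (pin t ht) {v}; split.
  have := dw (lshift n i); rewrite /F row_mxEl.
  apply: near_eq_is_derive.
  have := near_t t ht; apply: filterS => s hs.
  by rewrite coordc // mxE.
have := dw (rshift n i); rewrite /F row_mxEr mxE.
apply: near_eq_is_derive.
have := near_t t ht; apply: filterS => s hs.
by rewrite pin // !mxE.
Qed.

End HamiltonianFlow.

(** * Auto-parallel curves, geodesics and normal extremals *)

Section CurveCriteria.
Context {R : realType} {n : nat} {M : manifold R n} (S : sub_riemannian M)
  (nabla : (M -> 'cV[R]_n) -> (M -> 'cV[R]_n) -> M -> 'cV[R]_n).

Lemma geodesic_field_snd a x p j : (geodesic_field S nabla a x p).2 j 0 =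
  - \sum_i \sum_k christoffel nabla a x i k j * p i 0 * p k 0.
Proof. by rewrite mxE. Qed.

Lemma integral_curve_solves I c p : integral_curve (X_H S) I c p <->
  forall t, I t -> {for t, continuous c} /\
    forall a, atlas a -> cdom a (c t) -> solves_at S a c p t.
Proof. by []. Qed.

(** At time t the covariant derivative along c is written in the chart chosen at c t, where its
    vanishing is the momentum equation of the geodesic field. With the two fields equal, this is
    Hamilton's equation in that chart, hence in all. *)
Lemma auto_parallel_integral I c al : eq_cot_field (geodesic_field S nabla) (X_H S) ->
  (auto_parallel S nabla I c al <-> integral_curve (X_H S) I c al).
Proof.
move=> h; split=> [[had hl hp]|hi].
  apply/integral_curve_solves => t It; have [cc dv] := had t It.
  split=> // b hb bc; have [ha ac] := chart_atP (c t); set a := chart_at (c t) in ha ac.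
  apply: (solves_at_change ha hb ac bc cc) => v i; rewrite /v {v}; split.
    by rewrite X_H_fst_g //; exact: dv.
  have [_ /(_ a ha ac i)[_ dp]] := hl t It.
  split=> //; rewrite -derive1E.
  have /matrixP/(_ i 0) := hp t It; rewrite mxE [RHS]mxE => /eqP.
  rewrite addr_eq0 => /eqP ->.
  by rewrite -h // geodesic_field_snd covec_in_chart_at.
have hs := (integral_curve_solves I c al).1 hi.
split.
- move=> t It; have [cc hc] := hs t It; split=> // a ha ac i.
  have [] := hc a ha ac i; rewrite X_H_fst_g //.
- move=> t It; have [cc hc] := hs t It; split=> // a ha ac i.
  by have [[d1 _] [d2 _]] := hc a ha ac i.
- move=> t It; have [cc hc] := hs t It; have [ha ac] := chart_atP (c t).
  apply/colP => i; rewrite mxE [RHS]mxE derive1E.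
  have [_ [_ ->]] := hc _ ha ac i.
  by rewrite -h // geodesic_field_snd covec_in_chart_at addNr.
Qed.

(** At time 0 the momentum derivative of the integral curve through xi is given by X_H and, the
    curve being auto-parallel, also by the geodesic field. Comparing the two for all xi gives
    normality at x. *)
Lemma curves_normal : g_connection S nabla ->
  (forall I c al, open_interval I ->
     (auto_parallel S nabla I c al <-> integral_curve (X_H S) I c al)) ->
  normal_connection S nabla.
Proof.
move=> hn h; apply: (normalP S nabla).2 => x; have [ha ax] := chart_atP x.
apply: (normal_at_geodesic_field hn ha ax).2 => xi.
have [r [c [p [r0 cx px hi]]]] := X_H_integral_curve S x xi.
have oI : open_interval [set t : R | `|t| < r].
  split.
    have -> : [set s : R | `|s| < r] = ball 0 r.
      by apply/seteqP; rewrite -ball_normE; split=> s /=; rewrite sub0r normrN.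
    exact: ball_open.
  move=> s t /=; rewrite !ltr_norml => /andP[s1 s2] /andP[t1 t2] z /andP[z1 z2].
  by rewrite ltr_norml (lt_le_trans s1) // (le_lt_trans z2).
have I0 : [set t : R | `|t| < r] 0 by rewrite /= normr0.
have [_ _ /(_ 0 I0) hp] := (h _ c p oI).2 hi.
have [cc hc] := (integral_curve_solves _ c p).1 hi 0 I0.
rewrite cx in hc.
rewrite [LHS]surjective_pairing [RHS]surjective_pairing; congr (_, _).
  by rewrite X_H_fst.
apply/colP => j; have [_ [_ e]] := hc _ ha ax j.
have e2 := hp; move/matrixP/(_ j 0): e2; rewrite mxE [RHS]mxE derive1E cx px e cx px.
rewrite covec_in_chart_at => /eqP; rewrite addr_eq0 => /eqP ->.
by rewrite geodesic_field_snd.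
Qed.

End CurveCriteria.

(** * Integral curves meeting the zero section *)

Section VanishingCovector.
Context {R : realType} {n : nat} {M : manifold R n} (S : sub_riemannian M).

Lemma derive_bound (f f' : R -> R) (t1 d K : R) :
  (forall s : R, `|s - t1| <= d -> is_derive s 1 f (f' s)) ->
  (forall s : R, `|s - t1| <= d -> `|f' s| <= K) ->
  forall t : R, `|t - t1| <= d -> `|f t - f t1| <= K * `|t - t1|.
Proof.
move=> df bf t ht.
have [t1t|tt1] := leP t1 t.
  have hs (s : R) : s \in `[t1, t]%R -> `|s - t1| <= d.
    rewrite in_itv /= => /andP[s1 s2]; rewrite ger0_norm ?subr_ge0 //.
    by apply: le_trans ht; rewrite ger0_norm ?subr_ge0 // lerD2r.
  have cw : {within `[t1, t], continuous f}.
    by apply: derivable_within_continuous => s /hs/df[].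
  have ds (s : R) : s \in `]t1, t[%R -> is_derive s 1 f (f' s).
    by move=> si; apply/df/hs; apply: subset_itv_oo_cc si.
  have [s si ->] := MVT_segment t1t ds cw.
  by rewrite normrM ler_wpM2r // bf // hs.
have hs (s : R) : s \in `[t, t1]%R -> `|s - t1| <= d.
  rewrite in_itv /= => /andP[s1 s2]; rewrite distrC ger0_norm ?subr_ge0 //.
  by apply: le_trans ht; rewrite distrC ger0_norm ?subr_ge0 ?(ltW tt1) // lerB.
have cw : {within `[t, t1], continuous f}.
  by apply: derivable_within_continuous => s /hs/df[].
have ds (s : R) : s \in `]t, t1[%R -> is_derive s 1 f (f' s).
  by move=> si; apply/df/hs; apply: subset_itv_oo_cc si.
have [s si e] := MVT_segment (ltW tt1) ds cw.
rewrite distrC e (distrC t) normrM ler_wpM2r // bf // hs //.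
Qed.

Lemma near_interval (t1 : R) (P : R -> Prop) : (\forall s \near t1, P s) ->
  exists2 d : R, 0 < d & forall s : R, `|s - t1| <= d -> P s.
Proof.
move=> /nbhs_ballP[e /= e0 he]; exists (e / 2); first exact: divr_gt0.
move=> s hs; apply: he; rewrite -ball_normE /= distrC; apply: le_lt_trans hs _.
by rewrite ltr_pdivrMr // mulr2n mulrDr mulr1 ltrDl.
Qed.

Lemma continuous_smooth U (f : M -> R) x : open U -> U x -> smooth_on U f ->
  {for x, continuous f}.
Proof.
move=> oU Ux hf; have [ha ax] := chart_atP x; set a := chart_at x in ha ax.
have Vz : (coord a @` (U `&` cdom a)) (coord a x) by exists x.
have [cf _] := hf a ha 0%N.
have c1 : {for x, continuous ((f \o param a) \o coord a)}.
  by apply: continuous_comp; [exact: coord_continuous|exact: cf].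
apply: near_eq_continuous c1.
by apply: (near_open (cdom_open a) ax) => y ay /=; rewrite (coordK ay).
Qed.

(* X_H is quadratic in the momentum, so a Gronwall estimate shows that an integral
   curve meeting the zero section stays in it. *)
Lemma vanishing_open I c p t1 : open I -> I t1 -> integral_curve (X_H S) I c p ->
  p t1 = 0 -> \forall s \near t1, p s = 0 /\ c s = c t1.
Proof.
move=> oI It1 hi p0; have [cc _] := hi t1 It1.
have [ha ac] := chart_atP (c t1); set a := chart_at (c t1) in ha ac.
pose P i s := covec_in a (c s) (p s) i 0.
pose B i k l y := pd a i (fun z => g_coef S a z k l) y.
pose K0 := \sum_i \sum_k \sum_l (`|B i k l (c t1)| + 1).
have sB i k l : smooth_on (cdom a) (B i k l).
  have := smooth_on_pd i ha (cdom_open a) (smooth_on_g_coef S k l ha).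
  by rewrite setIid.
have dP s i : I s -> cdom a (c s) -> is_derive s (1 : R) (P i)
    (- (2^-1 * \sum_k \sum_l B i k l (c s) * P k s * P l s)).
  move=> Is ac'; have [_ /(_ a ha ac' i)[_ d]] := hi s Is.
  by apply: (is_derive_eq d); rewrite X_H_snd.
have P0 i : P i t1 = 0 by rewrite /P p0 /covec_in mulmx0 mxE.
have cP i : {for t1, continuous (P i)}.
  by have [/derivable1_diffP/differentiable_continuous] := dP t1 i It1 ac.
have K00 : 0 <= K0.
  by do 3 (apply: sumr_ge0 => ? _); rewrite addr_ge0.
have nr : \forall s \near t1, [/\ I s, cdom a (c s),
    (forall i k l, `|B i k l (c s)| <= `|B i k l (c t1)| + 1) & forall i, `|P i s| <= 1].
  have n1 : nbhs t1 I by exact: open_nbhs_nbhs.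
  have n2 := near_curve cc (cdom_open a) ac (fun y h => h).
  have n3 : \forall s \near t1, forall i k l, `|B i k l (c s)| <= `|B i k l (c t1)| + 1.
    apply: near_forall => i; apply: near_forall => k; apply: near_forall => l.
    have cB : {for t1, continuous (fun s => B i k l (c s))}.
      apply: (@continuous_comp _ _ _ c (B i k l)); first exact: cc.
      exact: continuous_smooth (cdom_open a) ac (sB i k l).
    have : \forall s \near t1, `|B i k l (c t1) - B i k l (c s)| < 1.
      by move/cvgrPdist_lt: cB => /(_ 1 ltr01).
    apply: filterS => s hs; rewrite -[B i k l (c s)](subrK (B i k l (c t1))).
    by rewrite addrC (le_trans (ler_normD _ _)) // lerD2l distrC ltW.
  have n4 : \forall s \near t1, forall i, `|P i s| <= 1.
    apply: near_forall => i.
    have : \forall s \near t1, `|P i t1 - P i s| < 1.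
      by move/cvgrPdist_lt: (cP i) => /(_ 1 ltr01).
    by apply: filterS => s; rewrite P0 sub0r normrN => /ltW.
  near=> s; split.
  - by near: s; exact: n1.
  - by near: s; exact: n2.
  - by near: s; exact: n3.
  - by near: s; exact: n4.
have [d1 d10 hd1] := near_interval nr.
(* The second bound gives K0 d <= 1/2, the factor gained in each round of [halve]. *)
pose d := Num.min d1 (2 * (K0 + 1))^-1.
have K1 : 0 < 2 * (K0 + 1) by rewrite mulr_gt0 // ltr_wpDl.
have d0 : 0 < d by rewrite lt_min d10 invr_gt0.
have Kd : K0 * d <= 2^-1.
  apply: (@le_trans _ _ (K0 * (2 * (K0 + 1))^-1)).
    by rewrite ler_wpM2l // ge_min lexx orbT.
  by rewrite ler_pdivrMr // mulKf // lerDl.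
have hd s : `|s - t1| <= d -> [/\ I s, cdom a (c s),
    (forall i k l, `|B i k l (c s)| <= `|B i k l (c t1)| + 1) & forall i, `|P i s| <= 1].
  by move=> hs; apply: hd1; apply: (le_trans hs); rewrite ge_min lexx.
(* If |P| <= m, then in the quadratic right-hand side one momentum factor is bounded by 1 and the
   other by m, so |P'| <= K0 m and |P| <= K0 m d <= m/2. Starting from m = 1, iteration forces P =
   0. *)
have halve m : (forall s i, `|s - t1| <= d -> `|P i s| <= m) ->
    forall s i, `|s - t1| <= d -> `|P i s| <= m / 2.
  move=> hm s i hs.
  have m0 : 0 <= m by apply: le_trans (hm s i hs).
  have bd s' : `|s' - t1| <= d ->
      `|- (2^-1 * \sum_k \sum_l B i k l (c s') * P k s' * P l s')| <= K0 * m.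
    move=> hs'; have [_ _ bB b1] := hd s' hs'.
    rewrite normrN normrM ger0_norm ?invr_ge0 //.
    apply: (@le_trans _ _ (1 * \sum_k \sum_l (`|B i k l (c t1)| + 1) * m)).
      apply: ler_pM => //; first by rewrite invf_le1 // ler1n.
      apply: le_trans (ler_norm_sum _ _ _) _; apply: ler_sum => k _.
      apply: le_trans (ler_norm_sum _ _ _) _; apply: ler_sum => l _.
      rewrite !normrM; apply: ler_pM => //; last exact: hm.
      by rewrite -[leRHS]mulr1; apply: ler_pM.
    rewrite mul1r /K0 [X in _ <= X * _](bigD1 i) //= mulrDl; apply: ler_wpDr.
      by rewrite mulr_ge0 //; do 3 (apply: sumr_ge0 => ? _); rewrite addr_ge0.
    rewrite mulr_suml; apply: ler_sum => k _; by rewrite mulr_suml.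
  have ds s' : `|s' - t1| <= d -> is_derive s' (1 : R) (P i)
      (- (2^-1 * \sum_k \sum_l B i k l (c s') * P k s' * P l s')).
    by move=> hs'; have [? ? _ _] := hd s' hs'; exact: dP.
  have := derive_bound ds bd hs; rewrite P0 subr0 => /le_trans; apply.
  apply: (@le_trans _ _ (K0 * m * d)); first by rewrite ler_wpM2l // mulr_ge0.
  by rewrite mulrAC mulrC ler_wpM2l.
have small k s i : `|s - t1| <= d -> `|P i s| <= 1 * 2^-1 ^+ k.
  elim: k s i => [|k IH] s i hs; first by rewrite mulr1; have [_ _ _ /(_ i)] := hd s hs.
  by rewrite exprSr mulrA; apply: halve => // s' i'; exact: IH.
have Pz s i : `|s - t1| <= d -> P i s = 0.
  move=> hs; apply/eqP; rewrite -normr_le0; apply/ler_addgt0Pl => e e0; rewrite addr0.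
  by have [k hk] := half_pow_small 1 e0; apply: le_trans (ltW hk); exact: small.
have pz s : `|s - t1| <= d -> p s = 0.
  move=> hs; have [_ ac' _ _] := hd s hs.
  rewrite -(covec_inK (p s) ha ac'); have -> : covec_in a (c s) (p s) = 0.
    by apply/colP => i; rewrite -[LHS]/(P i s) Pz // mxE.
  by rewrite /covec_of mulmx0.
have cz s : `|s - t1| <= d -> c s = c t1.
  move=> hs; have [_ ac' _ _] := hd s hs.
  rewrite -[LHS](coordK ac') -[RHS](coordK ac); congr param; apply/rowP => i.
  have ds s' : `|s' - t1| <= d -> is_derive s' (1 : R) (fun u => coord a (c u) 0 i) 0.
    move=> hs'; have [Is' as' _ _] := hd s' hs'.
    have [_ /(_ a ha as' i)[dd _]] := hi s' Is'; apply: (is_derive_eq dd).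
    by rewrite X_H_fst_g // pz // g0 /vec_in mul0mx mxE.
  have b0 (s' : R) : `|s' - t1| <= d -> `|(0 : R)| <= 0 by rewrite normr0.
  have := derive_bound ds b0 hs.
  by rewrite mul0r normr_le0 subr_eq0 => /eqP.
apply/nbhs_ballP; exists d => //= s; rewrite -ball_normE /= distrC => /ltW hs.
by split; [exact: pz|exact: cz].
Unshelve. all: by end_near. Qed.

(** The set A of times at which the covector is 0 and the base point is c t0 is open by
    [vanishing_open] and closed in I by continuity, M being Hausdorff; I is connected. *)
Lemma vanishing_curve I c p t0 : open_interval I -> I t0 ->
  integral_curve (X_H S) I c p -> p t0 = 0 ->
  forall t, I t -> p t = 0 /\ c t = c t0.
Proof.
move=> [oI iI] It0 hi p0.
pose A := [set t | I t /\ (p t = 0 /\ c t = c t0)].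
have oA : open A.
  rewrite openE => t [It [pt ct]]; rewrite /interior.
  have n1 : nbhs t I by exact: open_nbhs_nbhs.
  have := vanishing_open oI It hi pt; apply: filterS2 n1 => s Is [ps cs].
  by split=> //; split; [exact: ps|rewrite cs].
have clA t : I t -> closure A t -> A t.
  move=> It cAt; have [cc hc] := hi t It; split=> //; split.
    have [ha ac] := chart_atP (c t); set a := chart_at (c t) in ha ac.
    rewrite -(covec_inK (p t) ha ac); have -> : covec_in a (c t) (p t) = 0.
      apply/colP => i; rewrite [RHS]mxE; apply/eqP; rewrite -normr_le0.
      apply/ler_addgt0Pl => e e0; rewrite addr0.
      have [_ [/derivable1_diffP/differentiable_continuous cP _]] := hc a ha ac i.
      have : \forall s \near t, `|covec_in a (c t) (p t) i 0 - covec_in a (c s) (p s) i 0| < e.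
        by move/cvgrPdist_lt: cP => /(_ e e0).
      move=> /cAt [s [[_ [ps _]] /=]].
      by rewrite ps /covec_in mulmx0 [X in _ - X]mxE subr0 => /ltW.
    by rewrite /covec_of mulmx0.
  apply: contrapT => ne.
  have cl0 : closed [set c t0].
    by apply: accessible_closed_set1; apply: hausdorff_accessible; exact: m_hausdorff.
  have nne : nbhs (c t) (~` [set c t0]).
    by apply: open_nbhs_nbhs; split; [exact: closed_openC|].
  by have /cAt [s [[_ [_ cs]] /=]] := cc _ nne; rewrite cs; apply.
have conn : connected I by apply/connected_intervalP.
have AI : A = I.
  apply: conn.
  - by exists t0.
  - by exists A => //; apply/seteqP; split=> [t [It h]|t [It h]].
  - exists (closure A); first exact: closed_closure.
    apply/seteqP; split=> [t At|t [It /(clA t It)]] //; split.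
      by case: At.
    exact: subset_closure.
by move=> t It; have [_ [-> ->]] : A t by rewrite AI.
Qed.

Lemma annihilator_neq0 (x : M) : exists2 psi, psi != 0 & annihilator (sr_Q S x) psi.
Proof.
have [U [F [oU Ux hF fF hQ]]] := Q_frame S x.
have [kn|nk] := ltnP (sr_rank S) n.
  have : kermx (F x)^T != 0.
    rewrite -mxrank_eq0 mxrank_ker mxrank_tr.
    have /eqP -> := fF x Ux.
    by rewrite subn_eq0 -ltnNge.
  move=> /rowV0Pn[v /sub_kermxP vF v0].
  exists v^T; first by apply: contraNneq v0 => /(congr1 trmx); rewrite trmxK trmx0 => ->.
  move=> w /(hQ x w Ux)/submxP[e ->].
  have Fv : F x *m v^T = 0 by rewrite -[F x]trmxK -trmx_mul vF trmx0.
  by rewrite /pairing -mulmxA Fv mulmx0 mxE.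
(* If the rank were n, then Q would be all of TM and hence involutive. *)
exfalso; apply: (@Q_not_involutive _ _ _ S) => X Y [hX qX] [hY qY]; split.
  by apply: vf_on_lie_bracket => //; exact: openT.
move=> y; have [U' [F' [_ Uy _ fF' hQ']]] := Q_frame S y.
apply/(hQ' y _ Uy); apply: submx_full.
have /eqP r := fF' y Uy; have := rank_leq_col (F' y); rewrite r => kn'.
by rewrite /row_full r eqn_leq kn' nk.
Qed.

(** The difference quotients at r/2 and -r/2 have opposite signs, which excludes a nonzero
    derivative. It is applied to H, which is nonnegative and attains 0 on Q^0. *)
Lemma derive_at_min (V : normedModType R) (f : V -> R) z v :
  derivable f z v -> (forall y, f z <= f y) -> 'D_v f z = 0.
Proof.
move=> /derivableP[df _] fmin; have := df; set l := 'D_v f z => dfl.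
apply: contrapT => /eqP l0.
have e0 : 0 < `|l| by rewrite normr_gt0.
have : \forall h \near (0 : R)^', `|l - h^-1 *: ((f \o shift z) (h *: v) - f z)| < `|l|.
  by move/cvgrPdist_lt: dfl => /(_ _ e0).
move=> [r /= r0 hr].
have hq (s : R) : s != 0 -> `|s| < r -> `|l - s^-1 * (f (s *: v + z) - f z)| < `|l|.
  by move=> s0 sr; apply: (hr s) => //; rewrite /ball_ /= sub0r normrN.
have r2 : r / 2 < r by rewrite ltr_pdivrMr // mulr2n mulrDr mulr1 ltrDl.
have r20 : 0 < r / 2 by rewrite divr_gt0.
have h1 := hq (r / 2); have h2 := hq (- (r / 2)).
rewrite gt_eqF // gtr0_norm // in h1; rewrite oppr_eq0 gt_eqF // normrN gtr0_norm // in h2.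
have {}h1 := h1 isT r2; have {}h2 := h2 isT r2.
have q1 : 0 <= (r / 2)^-1 * (f ((r / 2) *: v + z) - f z).
  by rewrite mulr_ge0 // ?invr_ge0 ?(ltW r20) // subr_ge0.
have q2 : (- (r / 2))^-1 * (f ((- (r / 2)) *: v + z) - f z) <= 0.
  by rewrite invrN mulNr oppr_le0 mulr_ge0 // ?invr_ge0 ?(ltW r20) // subr_ge0.
move: h1 h2 q1 q2; move: (_ * _) (_ * _) => s1 s2.
have [lp|ln] := ltP 0 l.
  by rewrite (gtr0_norm lp) !ltr_norml => /andP[? ?] /andP[? ?]; lra.
have ln' : l < 0 by rewrite lt_neqAle l0.
by rewrite (ltr0_norm ln') !ltr_norml => /andP[? ?] /andP[? ?]; lra.
Qed.

(** On Q^0 both g and H vanish, and H >= 0 makes the position derivatives of H vanish there as well,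
    so X_H is zero at psi. *)
Lemma annihilator_constant_curve I c x psi : open I -> (forall t, I t -> c t = x) ->
  annihilator (sr_Q S x) psi -> integral_curve (X_H S) I c (fun=> psi).
Proof.
move=> oI cx /annihilator_g g0'; apply/integral_curve_solves => t It.
have nc : \forall s \near t, x = c s.
  by apply: (near_open oI It) => s Is; rewrite cx.
split.
  by apply: near_eq_continuous nc _; exact: cst_continuous.
rewrite cx // => a ha ax; rewrite /solves_at (cx t It) => i; split.
  have -> : (X_H S a x (covec_in a x psi)).1 0 i = 0.
    by rewrite X_H_fst_g // g0' /vec_in mul0mx mxE.
  have n1 : \forall s \near t, cst (coord a x 0 i) s = coord a (c s) 0 i.
    by apply: filterS nc => s <-.
  exact: near_eq_is_derive n1 (is_derive_cst _ _ _).
have -> : (X_H S a x (covec_in a x psi)).2 i 0 = 0.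
  rewrite mxE; apply/eqP; rewrite oppr_eq0; apply/eqP.
  set P := covec_in a x psi.
  have hs : smooth_on (cdom a) (fun y => sr_hamiltonian S y (covec_of a y P)).
    rewrite /sr_hamiltonian; apply: smooth_onM; first exact: cdom_open.
      exact: smooth_on_cst.
    by apply: smooth_on_gbarf; [exact: cdom_open|exact: form_on_covec_of|exact: form_on_covec_of].
  apply: derive_at_min; first by have [] := is_pd i ha ax ax hs.
  move=> z; rewrite /= (coordK ax) /sr_hamiltonian covec_inK //.
  by rewrite {1}/gbar g0' pairing0r mulr0 mulr_ge0 ?invr_ge0 // gbar_ge0.
have n1 : \forall s \near t, cst (covec_in a x psi i 0) s = covec_in a (c s) psi i 0.
  by apply: filterS nc => s <-.
exact: near_eq_is_derive n1 (is_derive_cst _ _ _).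
Qed.

Lemma geodesic_normal_extremal nabla I c :
  eq_cot_field (geodesic_field S nabla) (X_H S) -> open_interval I ->
  (geodesic S nabla I c <-> normal_extremal S I c).
Proof.
move=> h oI; split=> [[al hal]|[_ [psi [_ hi]]]]; last first.
  (* The covector curve of the extremal is itself an auto-parallel lift. *)
  by exists psi; apply/auto_parallel_integral.
have hi := (auto_parallel_integral I c al h).1 hal.
split.
  have [had _ _] := hal; move=> t It; exists (g S (c t) (al t)); first exact: g_in.
  exact: had.
have [[t0 It0 z0]|nz] := pselect (exists2 t, I t & al t = 0); last first.
  exists al; split=> // t It; apply/eqP => z; apply: nz; by exists t.
have v := vanishing_curve oI It0 hi z0.
have [psi psi0 apsi] := annihilator_neq0 (c t0).
exists (fun=> psi); split=> //.
by apply: annihilator_constant_curve apsi; [case: oI|move=> t /v []].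
Qed.

End VanishingCovector.

Theorem theorem17 (R : realType) (n : nat) (M : manifold R n)
    (S : sub_riemannian M)
    (nabla : (M -> 'cV[R]_n) -> (M -> 'cV[R]_n) -> M -> 'cV[R]_n)
    (hnabla : g_connection S nabla) :
  [/\
    (* (1)-(4), and (4) again in terms of curves in T*M *)
    [<->
      normal_connection S nabla;

      forall al, one_form al ->
        forall x, nabla al al x = 2^-1 *: sym_bracket S al al x;

      forall al be X, one_form al -> one_form be -> vector_field X ->
        forall x,
          pairing_fun be (nabla_vf S nabla al X) x +
          pairing_fun al (nabla_vf S nabla be X) x =
          pairing_fun be (lie_bracket (gf S al) X) x +
          pairing_fun al (lie_bracket (gf S be) X) x +
          act X (gbarf S al be) x;

      eq_cot_field (geodesic_field S nabla) (X_H S);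

      forall I c al, open_interval I ->
        (auto_parallel S nabla I c al <-> integral_curve (X_H S) I c al)],

    (* (4) in terms of base curves *)
    eq_cot_field (geodesic_field S nabla) (X_H S) ->
      forall I c, open_interval I ->
        (geodesic S nabla I c <-> normal_extremal S I c) &

    (* (1) <-> (5) *)
    forall G D, riemannian_metric G -> restricts_to_h S G -> levi_civita G D ->
      (normal_connection S nabla <->
       forall al, one_form al -> forall x,
         nabla al al x =
         dual_form D (gf S al) (tau S G al) x +
         deltaB (gf S al) (tau_perp S G al) x)].
Proof.
split.
- tfae.
  + exact: (normal_diag hnabla).1.
  + by move=> h; apply: (normal_nabla_vf hnabla).1; exact: (normal_diag hnabla).2.
  + by move=> h; apply: (normal_geodesic_field hnabla).1; exact: (normal_nabla_vf hnabla).2.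
  + by move=> h I c al _; exact: auto_parallel_integral.
  + exact: curves_normal.
- by move=> h I c oI; exact: geodesic_normal_extremal.
- by move=> G D hG hGS hD; exact: normal_levi_civita.
Qed.
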